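(* Let $(S_t,n_t,V_t)_{t\ge0}$ satisfy $$dS_t=n_t\,dt+\sqrt{V_t}\,dW^s_t,\qquad dn_t=-\kappa_1 n_t\,dt+\phi\sqrt{V_t}\,dW^s_t,\qquad dV_t=\kappa_2(\theta-V_t)\,dt+\gamma\sqrt{V_t}\,dW^v_t,$$ with $d[W^s,W^v]_t=\rho\,dt$ (as described in the context), and assume that the instantaneous variance process $V$ and the mean process $n$ are in the stationary state at time $0$, i.e. $V_0=\theta$ and $n_0=0$. Then for every $t\ge0$, $$\mathrm{Var}\left(\frac{S_t-S_0}{S_0}\right)=\frac{1}{S_0^2}\left\{\frac{\phi^2\theta\left(-e^{-2\kappa_1t}+4e^{-\kappa_1t}-3+2\kappa_1t\right)}{2\kappa_1^3}+\frac{2\phi\theta\left(\kappa_1t-1+e^{-\kappa_1t}\right)}{\kappa_1^2}+\theta t\right\}.$$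
   Context: $W^s$ and $W^v$ are standard Brownian motions on a common filtered probability space with constant correlation $\rho\in[-1,1]$. The constants satisfy $\kappa_1>0$, $\kappa_2>0$, $\theta>0$, $\gamma\ge0$, $\phi\in\mathbb R$; $S_0>0$ is a deterministic constant; $V$ is the nonnegative (square-root / CIR) solution of its equation. *)

(* Defs.v *)
From HB Require Import structures.
From mathcomp Require Import all_boot all_order all_algebra.
From mathcomp Require Import all_classical all_reals all_analysis.

Set Implicit Arguments.
Unset Strict Implicit.
Unset Printing Implicit Defensive.

Import Order.TTheory GRing.Theory Num.Theory.
Import numFieldNormedType.Exports.

Local Open Scope classical_set_scope.
Local Open Scope ring_scope.

(* A process is a function R -> T -> R; only its values at times t >= 0 are
   ever used. *)

Section stochastic_calculus.
Context {R : realType} {d : measure_display} {T : measurableType d}.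
Variable P : probability T R.

Definition filtration (F : R -> set_system T) : Prop :=
  [/\ forall t : R, 0 <= t -> sigma_algebra setT (F t),
      forall t : R, 0 <= t -> F t `<=` measurable &
      forall s t : R, 0 <= s -> s <= t -> F s `<=` F t].

Definition sub_measurable (G : set_system T) (X : T -> R) : Prop :=
  preimage_set_system setT X measurable `<=` G.

Definition adapted (F : R -> set_system T) (X : R -> T -> R) : Prop :=
  forall t : R, 0 <= t -> sub_measurable (F t) (X t).

Definition continuous_paths (X : R -> T -> R) : Prop :=
  {ae P, forall w, {within `[0, +oo[, continuous (X ^~ w)}}.

(* No completeness or usual conditions are assumed, so the event below need not
   be measurable; the outer measure P^* extends P to all sets. *)
Definition cvg0_in_probability (X : nat -> T -> \bar R) : Prop :=
  forall e : R, 0 < e ->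
    (fun k => (P^*%mu [set w | (e%:E <= X k w)%E])) @ \oo --> 0%E.

Record brownian_motion (F : R -> set_system T) (W : R -> T -> R) : Prop :=
  BrownianMotion {
    bm_adapted : adapted F W;
    bm_init : {ae P, forall w, W 0 w = 0};
    bm_continuous : continuous_paths W;
    bm_normal : forall (s t : R) (B : set R), 0 <= s -> s < t -> measurable B ->
      P ((W t \- W s) @^-1` B) = normal_prob 0 (Num.sqrt (t - s)) B;
    bm_indep : forall (s t : R) (A : set T) (B : set R), 0 <= s -> s < t ->
      F s A -> measurable B ->
      P (A `&` (W t \- W s) @^-1` B) = (P A * P ((W t \- W s)%R @^-1` B))%E }.

(* A partition a = t_0 < t_1 < ... < t_m = b is encoded, as in itv_partition,
   by the sequence [:: t_1; ...; t_m]. *)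
Definition part_pt (a : R) (s : seq R) (i : nat) : R := nth a (a :: s) i.

Definition mesh (a : R) (s : seq R) : R :=
  \big[Num.max/0]_(0 <= i < size s) (part_pt a s i.+1 - part_pt a s i).

(* [X, Y]_t = C t for all t >= 0, the bracket being the limit in probability of
   the sums of products of increments as the mesh goes to 0. *)
Definition quadratic_covariation (X Y : R -> T -> R) (C : R -> T -> R) : Prop :=
  forall (t : R) (s : nat -> seq R), 0 <= t ->
    (forall k, itv_partition 0 t (s k)) ->
    (fun k => mesh 0 (s k)) @ \oo --> (0 : R) ->
    cvg0_in_probability (fun k w =>
      (`| \sum_(0 <= i < size (s k))
            (X (part_pt 0 (s k) i.+1) w - X (part_pt 0 (s k) i) w) *
            (Y (part_pt 0 (s k) i.+1) w - Y (part_pt 0 (s k) i) w)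
          - C t w |)%:E).

(* Simple predictable integrands
   sum_i xi_i 1_(t_i, t_{i+1}] with xi_i bounded and F_{t_i}-measurable. *)
Record simple_process (F : R -> set_system T) (t : R) := SimpleProcess {
  sp_part : seq R;
  sp_coef : nat -> T -> R;
  sp_partP : itv_partition 0 t sp_part;
  sp_adapted : forall i, (i < size sp_part)%N ->
    sub_measurable (F (part_pt 0 sp_part i)) (sp_coef i);
  sp_bounded : forall i, (i < size sp_part)%N ->
    exists M : R, forall w, `|sp_coef i w| <= M }.

Definition simple_val F t (K : simple_process F t) (s : R) (w : T) : R :=
  \sum_(0 <= i < size (sp_part K)) sp_coef K i w *
    \1_(`]part_pt 0 (sp_part K) i, part_pt 0 (sp_part K) i.+1]%classic) s.

Definition simple_integral F t (K : simple_process F t) (W : R -> T -> R)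
    (w : T) : R :=
  \sum_(0 <= i < size (sp_part K)) sp_coef K i w *
    (W (part_pt 0 (sp_part K) i.+1) w - W (part_pt 0 (sp_part K) i) w).

(* I is a version of the Ito integral of H with respect to the Brownian motion
   W over [0, t], for H with square-integrable paths: H is approximated by
   simple processes K_k with int_0^t (K_k - H)^2 ds -> 0 in probability, and I
   is the limit in probability of their elementary integrals.  By the isometry
   and localization, the limit does not depend on the approximation, up to
   a null set. *)
Definition ito_integral (F : R -> set_system T) (W H : R -> T -> R) (t : R)
    (I : T -> R) : Prop :=
  exists K : nat -> simple_process F t,
    cvg0_in_probability (fun k w => (\int[lebesgue_measure]_(s in `[0%R, t])
      ((simple_val (K k) s w - H s w) ^+ 2)%:E)%E) /\
    cvg0_in_probability (fun k w => (`|simple_integral (K k) W w - I w|)%:E).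

(* dX_t = b_t dt + H_t dW_t for t >= 0 *)
Record ito_process (F : R -> set_system T) (W X b H : R -> T -> R) : Prop :=
  ItoProcess {
    ito_adapted : adapted F X;
    ito_continuous : continuous_paths X;
    ito_drift_adapted : adapted F b;
    ito_diffusion_adapted : adapted F H;
    ito_drift_integrable : forall t : R, 0 <= t -> {ae P, forall w,
      lebesgue_measure.-integrable `[0, t] (EFin \o b ^~ w)};
    ito_diffusion_measurable : forall t : R, 0 <= t -> {ae P, forall w,
      measurable_fun (`[0, t] : set R) (H ^~ w)};
    ito_diffusion_integrable : forall t : R, 0 <= t -> {ae P, forall w,
      lebesgue_measure.-integrable `[0, t] (fun s => ((H s w) ^+ 2)%:E)};
    ito_equation : forall t : R, 0 <= t -> exists2 I : T -> R,
      ito_integral F W H t I &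
      {ae P, forall w, X t w =
        X 0 w + \int[lebesgue_measure]_(s in `[0, t]) b s w + I w} }.

End stochastic_calculus.

(* Main.v *)
(* Put N_t = int_0^t n_s ds and M_t = S_t - S_0 - N_t = int_0^t sqrt(V_s) dW^s_s.
   Since E V = theta, the isometry gives E (M_t - M_s)^2 = theta (t - s), and the
   equation for n integrates to n + kappa1 N = phi M.  This linear equation is
   solved pathwise, exp(kappa1 t) N_t = phi int_0^t exp(kappa1 s) M_s ds, and
   Fubini gives E [N_t M_t], then E N_t^2.

   The properties of the Ito integral are obtained without stopping times.  For a
   step process h with F_{t_i}-measurable, possibly unbounded, coefficients, put
   X = int h dW and Q = int h^2 dt; then E exp(l X - l^2 Q / 2) = 1 for all l.
   By Markov's inequality the smallness of Q in probability controls that of X,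
   so that the integral of a continuous H is the limit of its sums on uniform
   grids.  Fatou's lemma yields E exp(l Z - l^2 q / 2) <= 1 for the limit Z, with
   q = int H^2 dt; hence E Z = 0 (let l tend to 0) when Z and q are integrable,
   exponential moments of V, and the fourth moment bounds that carry the isometry
   from the grid sums to Z. *)

(* The hypotheses give little: [ito_integral] only asserts, separately for each time and integrand,
   that some approximating sequence converges in probability, and no moment of [V], [n] or [S] is
   assumed finite. Grid sums serve as a common reference: they turn an increment over [s, t] into a
   limit of sums that involve the times of [s, t] alone, and they identify int phi sqrt(V) dW with
   phi int sqrt(V) dW. As sqrt(V) is unbounded, these sums are not integrals of simple processes,
   whence the step processes with arbitrary adapted coefficients. Exponentials are used because
   their identities relate integrals of nonnegative functions and presuppose no moment. For [V], the
   compensator lam^2 gamma^2 q / 2 is a multiple of q = int V, which the mean reversion term kappa2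
   q dominates for small lam: this is where integrability comes from. Finally, Fatou gives upper
   bounds only. Equality is recovered for the mean by using both signs of lam, and for the isometry
   by a nonnegative polynomial in which the square carries a minus sign. *)
Require Import Defs.
From HB Require Import structures.
From mathcomp Require Import all_boot all_order all_algebra.
From mathcomp Require Import all_classical all_reals all_analysis.
From mathcomp Require Import measurable_realfun ring lra.

Set Implicit Arguments.
Unset Strict Implicit.
Unset Printing Implicit Defensive.

Import Order.TTheory GRing.Theory Num.Theory.
Import numFieldNormedType.Exports.

Local Open Scope classical_set_scope.
Local Open Scope ring_scope.

(** * Gaussian integrals *)

Section normal_moments.
Context {R : realType}.
Implicit Types (a b m s x : R).
Local Notation mu := (@lebesgue_measure R).

(** The change of variables is phrased with the Radon-Nikodym derivative; it equals the Gaussian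
    density almost everywhere because both have the same integral over every measurable set. *)
Lemma ge0_integral_normal_prob m s (f : R -> R) :
  measurable_fun setT f -> (forall x, 0 <= f x) ->
  (\int[normal_prob m s]_x (f x)%:E =
   \int[mu]_x (f x * normal_pdf m s x)%:E)%E.
Proof.
move=> mf f0.
have dom := normal_prob_dominates m s.
have mf' : measurable_fun setT (EFin \o f) by exact/measurable_EFinP.
have f0' x : (0 <= (EFin \o f) x)%E by rewrite lee_fin.
rewrite -(Radon_Nikodym_SigmaFinite.change_of_variables dom f0' measurableT mf')/=.
apply: ae_eq_integral => //.
- apply: emeasurable_funM; first exact/measurable_EFinP.
  exact: (measurable_int _ (Radon_Nikodym_SigmaFinite.f_integrable dom)).
- apply/measurable_EFinP/measurable_funM => //; exact: measurable_normal_pdf.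
under [X in ae_eq _ _ _ X]eq_fun do rewrite EFinM.
apply: ae_eqe_mul2l.
apply: integral_ae_eq => //.
- exact: Radon_Nikodym_SigmaFinite.f_integrable.
- by apply/measurable_EFinP; exact: measurable_normal_pdf.
- by move=> E _ mE; rewrite -Radon_Nikodym_SigmaFinite.f_integral.
Qed.

(** Completing the square: the integrand times the density of variance s^2 centred at 0 is the
    density centred at b s^2. *)
Lemma integral_normal_expR s b : 0 < s ->
  (\int[normal_prob 0%R s]_x (expR (b * x - b ^+ 2 * s ^+ 2 / 2))%:E = 1)%E.
Proof.
move=> s0.
rewrite ge0_integral_normal_prob; first last.
- by move=> x; exact: expR_ge0.
- by apply: measurableT_comp => //; apply: measurable_funB => //; exact: measurable_funM.
rewrite -(@integral_normal_pdf R (b * s ^+ 2) s).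
apply: eq_integral => x _; congr EFin.
rewrite !normal_pdfE ?gt_eqF//= mulrCA; congr (_ * _).
rewrite /normal_fun -expRD; congr expR.
by field; rewrite gt_eqF.
Qed.

Lemma integral_FTC2 (f F : R -> R) a b : a <= b -> continuous f ->
  (forall x, is_derive x 1 F (f x)) ->
  (\int[mu]_(x in `[a, b]) (f x)%:E = (F b - F a)%:E)%E.
Proof.
rewrite le_eqVlt => /predU1P[<- _ _|ab cf dF].
  by rewrite set_itv1 integral_set1 subrr.
have cF : continuous F.
  move=> x; apply: differentiable_continuous; apply/derivable1_diffP.
  by case: (dF x).
rewrite (@continuous_FTC2 _ f F)//.
- exact: continuous_subspaceT.
- split.
  + by move=> x _; case: (dF x).
  + exact: cvg_at_right_filter (cF a).
  + exact: cvg_at_left_filter (cF b).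
- by move=> x _; rewrite derive1E; case: (dF x).
Qed.

(** Since p' = - x p / s^2, the function ((a + b x)^2 - c) p, with [c] the claimed value, has the
    explicit primitive [F]. It is integrated over the symmetric intervals [I n], where the boundary
    terms tend to 0 and both sides increase to their limits. *)
Lemma integral_normal_affine_sqr s a b : 0 < s ->
  (\int[normal_prob 0%R s]_x ((a + b * x) ^+ 2)%:E = (a ^+ 2 + b ^+ 2 * s ^+ 2)%:E)%E.
Proof.
move=> s0.
rewrite ge0_integral_normal_prob; first last.
- by move=> x; exact: sqr_ge0.
- by apply: measurable_funX; apply: measurable_funD => //; exact: measurable_funM.
set p := normal_pdf 0 s.
have pE x : p x = normal_peak s * expR (- (x ^+ 2) / (s ^+ 2 *+ 2)).
  by rewrite /p normal_pdfE ?gt_eqF//= /normal_fun subr0.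
have cp : continuous p by apply: continuous_normal_pdf; rewrite gt_eqF.
have dp x : is_derive x 1 p (- x / s ^+ 2 * p x).
  rewrite (_ : p = (fun x => normal_peak s * expR (- (x ^+ 2) / (s ^+ 2 *+ 2)))); last exact/funext.
  apply: is_derive_eq.
  by rewrite /GRing.scale/=; field; rewrite gt_eqF.
pose c := a ^+ 2 + b ^+ 2 * s ^+ 2.
pose F x := - s ^+ 2 * ((2 * a * b + b ^+ 2 * x) * p x).
have dF x : is_derive x 1 F ((a + b * x) ^+ 2 * p x - c * p x).
  apply: is_derive_eq.
  by rewrite /GRing.scale/= /c; field; rewrite gt_eqF.
pose I n : set R := `[- n.+1%:R, n.+1%:R]%classic.
have ndI : nondecreasing_seq I.
  move=> n m nm; rewrite subsetEset; apply: subset_itv; rewrite bnd_simp.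
    by rewrite lerN2 ler_nat.
  by rewrite ler_nat.
have UI : \bigcup_i I i = setT.
  apply/seteqP; split => // x _; exists (Num.bound `|x|) => //=.
  by rewrite /I/= in_itv/= -ler_norml (le_trans (ltW (archi_boundP _)) _)// ler_nat.
have c2 : continuous (fun x => (a + b * x) ^+ 2 * p x).
  move=> x; apply: (@cvgM _ _ _ _ (fun x => (a + b * x) ^+ 2)); last exact: cp.
  apply: (@continuous_comp _ _ _ (fun x => a + b * x) (fun x => x ^+ 2)); last exact: exprn_continuous.
  by apply: cvgD; [exact: cvg_cst|apply: cvgM; [exact: cvg_cst|exact: cvg_id]].
have c3 : continuous (fun x => (a + b * x) ^+ 2 * p x - c * p x).
  move=> x; apply: cvgB; first exact: c2.
  by apply: cvgM; [exact: cvg_cst|exact: cp].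
have mI n : @measurable _ (measurableTypeR R) (I n) by exact: measurable_itv.
have p0 x : 0 <= p x by exact: normal_pdf_ge0.
have LT (f : R -> R) : continuous f -> (forall x, 0 <= f x) ->
    (\int[mu]_(x in I n) (f x)%:E)%E @[n --> \oo] --> (\int[mu]_x (f x)%:E)%E.
  move=> cf f0; rewrite -UI; apply: ge0_nondecreasing_set_cvg_integral => //.
  - move=> n; apply: measurable_funTS; apply/measurable_EFinP.
    exact: continuous_measurable_fun.
  - by move=> n x _; rewrite lee_fin.
have A := LT _ c2 (fun x => mulr_ge0 (sqr_ge0 (a + b * x)) (p0 x)).
have B := LT _ cp p0.
rewrite /p integral_normal_pdf -/p in B.
have iE (f : R -> R) n : continuous f -> mu.-integrable (I n) (EFin \o f).
  move=> cf; apply: continuous_compact_integrable; first exact: segment_compact.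
  exact: continuous_subspaceT.
have AB n : (\int[mu]_(x in I n) ((a + b * x) ^+ 2 * p x)%:E =
    c%:E * \int[mu]_(x in I n) (p x)%:E + (F n.+1%:R - F (- n.+1%:R))%:E)%E.
  have nn : - n.+1%:R <= n.+1%:R :> R by rewrite -subr_ge0 opprK addr_ge0.
  rewrite -(integral_FTC2 nn c3 dF).
  have ip : mu.-integrable (I n) (EFin \o p) by exact: iE.
  have ip' := integrableZl (mI n) c ip.
  have i3 := iE _ n c3.
  rewrite -(integralZl (mI n) ip) -(integralD (mI n) ip' i3).
  by apply: eq_integral => x _ /=; rewrite -EFinM -EFinD; congr EFin; ring.
have F0 : F n.+1%:R - F (- n.+1%:R) @[n --> \oo] --> (0 : R).
  apply: norm_cvg0.
  apply: (@squeeze_cvgr _ _ _ _ (cst 0) (fun n => 4 * s ^+ 4 * b ^+ 2 * normal_peak s * n.+1%:R^-1)).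
  - apply: nearW => n; rewrite normr_ge0/=.
    have n0 : (0 < n.+1%:R :> R) by rewrite ltr0n.
    set y : R := n.+1%:R in n0 *.
    have -> : F y - F (- y) =
        - (s ^+ 2 * (b ^+ 2 * (y + y)) * (normal_peak s * expR (- y ^+ 2 / (s ^+ 2 *+ 2)))).
      by rewrite /F !pE sqrrN; ring.
    have k0 : 0 <= s ^+ 2 * (b ^+ 2 * (y + y)).
      by apply: mulr_ge0; [exact: sqr_ge0|apply: mulr_ge0; [exact: sqr_ge0|apply: addr_ge0; exact: ltW]].
    rewrite normrN ger0_norm; last by apply: mulr_ge0 => //; rewrite mulr_ge0 ?normal_peak_ge0 ?expR_ge0.
    (* exp(- z) <= 1 / z, a consequence of exp z >= 1 + z, is enough decay against the factor y of
       the boundary term: what remains is O(1 / y). *)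
    have e1 : expR (- y ^+ 2 / (s ^+ 2 *+ 2)) <= s ^+ 2 *+ 2 / y ^+ 2.
      rewrite mulNr expRN -[leRHS]invrK lef_pV2 ?posrE ?expR_gt0 ?invr_gt0 ?divr_gt0 ?mulrn_wgt0 ?exprn_gt0//.
      by rewrite invf_div (le_trans _ (expR_ge1Dx _))// lerDr.
    have {e1} := ler_wpM2l (normal_peak_ge0 s) e1.
    move=> /(ler_wpM2l k0) /le_trans; apply.
    rewrite le_eqVlt; apply/orP; left; apply/eqP; field.
    by rewrite gt_eqF.
  - exact: cvg_cst.
  - rewrite -[X in _ --> X](mulr0 (4 * s ^+ 4 * b ^+ 2 * normal_peak s)).
    exact: (cvgM (cvg_cst _) cvg_harmonic).
have C : (\int[mu]_(x in I n) ((a + b * x) ^+ 2 * p x)%:E)%E @[n --> \oo] --> (c%:E * 1 + 0)%E.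
  under eq_fun do rewrite AB.
  apply: cvgeD => //; first by apply: cvgeZl.
  by apply: cvg_EFin => //; exact: nearW.
by rewrite mule1 adde0 in C; exact: (cvg_unique _ A C).
Qed.

End normal_moments.

(** * Step integrals against Brownian motion *)

(** The hypothesis says that the joint law of (X, Y) agrees on rectangles with the product of the
    law of X and [nu]; uniqueness of the product measure makes them equal, and Tonelli applies. *)
Lemma independent_tonelli {R : realType} d d1 d2 (T : measurableType d)
    (T1 : measurableType d1) (T2 : measurableType d2) (P : probability T R)
    (X : {mfun T >-> T1}) (Y : {mfun T >-> T2}) (nu : probability T2 R)
    (f : T1 * T2 -> \bar R) :
  (forall A B, measurable A -> measurable B ->
    P (X @^-1` A `&` Y @^-1` B) = (P (X @^-1` A) * nu B)%E) ->
  measurable_fun setT f -> (forall z, 0 <= f z)%E ->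
  (\int[P]_w f (X w, Y w) = \int[P]_w \int[nu]_y f (X w, y))%E.
Proof.
move=> ind mf f0.
have mZ : measurable_fun setT (fun w => (X w, Y w)).
  by apply/measurable_fun_pairP; split => /=; exact: measurable_funP.
pose Z : {mfun T >-> (T1 * T2)%type} :=
  HB.pack (fun w => (X w, Y w)) (isMeasurableFun.Build _ _ _ _ _ mZ).
transitivity (\int[distribution P Z]_z f z)%E.
  by rewrite ge0_integral_distribution.
transitivity (\int[distribution P X \x nu]_z f z)%E.
  apply: eq_measure_integral => A mA _; apply/esym.
  by apply: product_measure_unique => // B C mB mC; exact: ind.
rewrite fubini_tonelli1// ge0_integral_distribution//.
- exact: measurable_fun_fubini_tonelli_F.
- by move=> y; apply: integral_ge0.
Qed.

Section discrete_martingales.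
Context {R : realType} {d : measure_display} {T : measurableType d}.
Variable P : probability T R.

Lemma sub_measurableP (G : set_system T) (X : T -> R) : sigma_algebra setT G ->
  sub_measurable G X <-> measurable_fun [set: g_sigma_algebraType G] X.
Proof.
move=> sG; split=> [GX _ B mB|mX _ [B mB <-]].
  by rewrite measurable_g_measurableTypeE//; apply: GX; exists B.
by rewrite -(@measurable_g_measurableTypeE T G sG); exact: mX.
Qed.

Lemma sub_measurable_fun (G : set_system T) (X : T -> R) : G `<=` measurable ->
  sub_measurable G X -> measurable_fun setT X.
Proof. by move=> Gm GX _ B mB; apply/Gm/GX; exists B. Qed.

Lemma sub_measurableS (G H : set_system T) (X : T -> R) : G `<=` H ->
  sub_measurable G X -> sub_measurable H X.
Proof. by move=> GH GX; exact: subset_trans GH. Qed.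

Variables (F : R -> set_system T) (W : R -> T -> R).
Hypotheses (hF : filtration F) (hW : brownian_motion P F W).

Lemma filtration_measurable t (X : T -> R) : 0 <= t ->
  sub_measurable (F t) X -> measurable_fun setT X.
Proof. by move=> t0; apply: sub_measurable_fun; case: hF => _ + _; exact. Qed.

Lemma filtrationS s t (X : T -> R) : 0 <= s -> s <= t ->
  sub_measurable (F s) X -> sub_measurable (F t) X.
Proof. by move=> s0 st; apply: sub_measurableS; case: hF => _ _; exact. Qed.

(** Conditioning without conditional expectations. The first variable is the identity of T, seen as
    a map into T with the sigma-algebra [F s]; its independence of the increment allows freezing
    everything known at time s and integrating the increment against its Gaussian law. *)
Lemma brownian_tonelli s t (f : g_sigma_algebraType (F s) * measurableTypeR R -> \bar R) :
  0 <= s -> s < t -> measurable_fun setT f -> (forall z, 0 <= f z)%E ->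
  (\int[P]_w f (w, W t w - W s w)%R =
   \int[P]_w \int[normal_prob 0%R (Num.sqrt (t - s))]_y f (w, y))%E.
Proof.
move=> s0 st mf f0.
have [sF Fm _] := hF.
have mX : measurable_fun [set: T] (id : T -> g_sigma_algebraType (F s)).
  move=> _ A; rewrite measurable_g_measurableTypeE ?setTI//; last exact: sF.
  exact: Fm.
have mY : measurable_fun [set: T] (fun w => W t w - W s w : measurableTypeR R).
  apply: measurable_funB.
  - by apply: (@filtration_measurable t); [lra|apply: bm_adapted hW _ _; lra].
  - by apply: (@filtration_measurable s); [lra|apply: bm_adapted hW _ _; lra].
pose X : {mfun T >-> g_sigma_algebraType (F s)} :=
  HB.pack (id : T -> g_sigma_algebraType (F s)) (isMeasurableFun.Build _ _ _ _ _ mX).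
pose Y : {mfun T >-> measurableTypeR R} :=
  HB.pack (fun w => W t w - W s w : measurableTypeR R) (isMeasurableFun.Build _ _ _ _ _ mY).
apply: (@independent_tonelli R _ _ _ T _ _ P X Y (normal_prob 0 (Num.sqrt (t - s)))) => //.
move=> A B; rewrite measurable_g_measurableTypeE; last exact: sF.
move=> FA mB; apply: etrans (bm_indep hW s0 st FA mB) _.
by congr (_ * _)%E; apply: etrans (bm_normal hW s0 st mB) _.
Qed.

(** Given [F s], the exponential factor has Gaussian mean 1. [Y] need not be integrable: it will be
    the exponential accumulated over the earlier steps. *)
Lemma brownian_step_expR s t (Y h : T -> R) : 0 <= s -> s < t ->
  sub_measurable (F s) Y -> sub_measurable (F s) h -> (forall w, 0 <= Y w) ->
  (\int[P]_w (Y w * expR (h w * (W t w - W s w) - h w ^+ 2 * (t - s) / 2))%:E =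
   \int[P]_w (Y w)%:E)%E.
Proof.
move=> s0 st FY Fh Y0.
have sF : sigma_algebra setT (F s) by case: hF => + _ _; exact.
move: FY Fh => /(sub_measurableP _ sF) mY /(sub_measurableP _ sF) mh.
have mY1 := measurableT_comp mY (@measurable_fst _ _ _ (measurableTypeR R)).
have mh1 := measurableT_comp mh (@measurable_fst _ _ _ (measurableTypeR R)).
pose f (z : g_sigma_algebraType (F s) * measurableTypeR R) : \bar R :=
  (Y z.1 * expR (h z.1 * z.2 - h z.1 ^+ 2 * (t - s) / 2))%:E.
rewrite (@brownian_tonelli s t f)//; first last.
- by move=> z; rewrite lee_fin mulr_ge0 ?expR_ge0.
- apply/measurable_EFinP; apply: measurable_funM => //.
  apply: measurableT_comp => //; apply: measurable_funB.
  + exact: measurable_funM.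
  + apply: measurable_funM => //; apply: measurable_funM => //.
    exact: measurable_funX.
apply: eq_integral => w _; rewrite /f/=.
under eq_integral do rewrite EFinM.
rewrite ge0_integralZl_EFin//.
- have := @integral_normal_expR R (Num.sqrt (t - s)) (h w).
  by rewrite sqrtr_gt0 subr_gt0 sqr_sqrtr ?subr_ge0 ?ltW// => ->//; rewrite mule1.
- apply/measurable_EFinP; apply: measurableT_comp => //.
  by apply: measurable_funB => //; exact: measurable_funM.
Qed.

(** The cross term 2 Y h (W t - W s) disappears inside the inner Gaussian integral, so the identity
    holds in the extended reals, whatever the moments of [Y] and [h]. *)
Lemma brownian_step_sqr s t (Y h : T -> R) : 0 <= s -> s < t ->
  sub_measurable (F s) Y -> sub_measurable (F s) h ->
  (\int[P]_w ((Y w + h w * (W t w - W s w)) ^+ 2)%:E =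
   \int[P]_w (Y w ^+ 2)%:E + (t - s)%:E * \int[P]_w (h w ^+ 2)%:E)%E.
Proof.
move=> s0 st FY Fh.
have sF : sigma_algebra setT (F s) by case: hF => + _ _; exact.
have [mYT mhT] := (filtration_measurable s0 FY, filtration_measurable s0 Fh).
move: FY Fh => /(sub_measurableP _ sF) mY /(sub_measurableP _ sF) mh.
have mY1 := measurableT_comp mY (@measurable_fst _ _ _ (measurableTypeR R)).
have mh1 := measurableT_comp mh (@measurable_fst _ _ _ (measurableTypeR R)).
pose f (z : g_sigma_algebraType (F s) * measurableTypeR R) : \bar R :=
  ((Y z.1 + h z.1 * z.2) ^+ 2)%:E.
rewrite (@brownian_tonelli s t f)//; first last.
- by move=> z; rewrite lee_fin sqr_ge0.
- apply/measurable_EFinP; apply: measurable_funX; apply: measurable_funD => //.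
  exact: measurable_funM.
rewrite -ge0_integralZl_EFin ?subr_ge0 ?(ltW st)//; first last.
- by apply/measurable_EFinP; exact: measurable_funX.
- by move=> w _; rewrite lee_fin sqr_ge0.
rewrite -ge0_integralD//; first last.
- apply/measurable_EFinP; apply: measurable_funM => //; exact: measurable_funX.
- by move=> w _; rewrite -EFinM lee_fin mulr_ge0 ?sqr_ge0// subr_ge0 ltW.
- by apply/measurable_EFinP; exact: measurable_funX.
- by move=> w _; rewrite lee_fin sqr_ge0.
apply: eq_integral => w _; rewrite /f/=.
rewrite integral_normal_affine_sqr ?sqrtr_gt0 ?subr_gt0//.
by rewrite sqr_sqrtr ?subr_ge0 ?ltW// mulrC.
Qed.

Section sums.
Variables (q : nat -> R) (h : nat -> T -> R).
Hypothesis q0 : 0 <= q 0%N.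

(** The elementary integral over the cells of the grid [q]. Unlike in [simple_process], the
    coefficients may be unbounded, so that sqrt(V) can be sampled directly. *)
Definition step_sum n w := \sum_(i < n) h i w * (W (q i.+1) w - W (q i) w).

Definition step_var n w := \sum_(i < n) h i w ^+ 2 * (q i.+1 - q i).

Let qS_ge0 n : (forall i, (i < n)%N -> q i < q i.+1) ->
  forall i j, (i <= j <= n)%N -> q i <= q j.
Proof.
move=> qlt i j /andP[]; elim: j => [|j IH]; first by rewrite leqn0 => /eqP ->.
rewrite leq_eqVlt => /predU1P[-> //|ij jn].
by rewrite (le_trans (IH _ (ltnW jn)))// ltW// qlt.
Qed.

Lemma step_sum_adapted n : (forall i, (i < n)%N -> q i < q i.+1) ->
  (forall i, (i < n)%N -> sub_measurable (F (q i)) (h i)) ->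
  sub_measurable (F (q n)) (step_sum n) /\ sub_measurable (F (q n)) (step_var n).
Proof.
move=> qlt Fh.
have qge i : (i <= n)%N -> 0 <= q i by move=> i_n; rewrite (le_trans q0)// (@qS_ge0 n).
have sF : sigma_algebra setT (F (q n)) by case: hF => + _ _; apply; exact: qge.
have mF i (X : T -> R) : (i <= n)%N -> sub_measurable (F (q i)) X ->
    measurable_fun [set: g_sigma_algebraType (F (q n))] X.
  move=> i_n FX; apply/(sub_measurableP _ sF).
  by apply: (filtrationS _ _ FX); [exact: qge|apply: (@qS_ge0 n) => //; rewrite i_n leqnn].
have mW i : (i <= n)%N -> measurable_fun [set: g_sigma_algebraType (F (q n))] (W (q i)).
  by move=> i_n; apply: (mF i) => //; apply: bm_adapted hW _ _; exact: qge.
have mh (i : 'I_n) : measurable_fun [set: g_sigma_algebraType (F (q n))] (h i).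
  by apply: (mF i); [exact: ltnW|exact: Fh].
split; apply/(sub_measurableP _ sF); apply: measurable_sum => i.
- apply: measurable_funM => //; apply: measurable_funB; apply: mW => //.
  exact: ltnW.
- by apply: measurable_funM => //; exact: measurable_funX.
Qed.

(** The exponential over the first n cells is measurable at time [q n] and is the factor [Y] of
    [brownian_step_expR]; each new cell leaves the integral unchanged. Equality persists for
    unbounded coefficients because only nonnegative functions are integrated. *)
Lemma integral_expR_step n : (forall i, (i < n)%N -> q i < q i.+1) ->
  (forall i, (i < n)%N -> sub_measurable (F (q i)) (h i)) ->
  (\int[P]_w (expR (step_sum n w - step_var n w / 2))%:E = 1)%E.
Proof.
elim: n => [|n IH] qlt Fh.
  under eq_integral do rewrite /step_sum /step_var !big_ord0 mul0r subr0 expR0.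
  by rewrite integral_cst//= probability_setT mule1.
have qlt' i : (i < n)%N -> q i < q i.+1 by move=> i_n; apply: qlt; exact: ltnW.
have Fh' i : (i < n)%N -> sub_measurable (F (q i)) (h i).
  by move=> i_n; apply: Fh; exact: ltnW.
have qn0 : 0 <= q n by rewrite (le_trans q0)// (@qS_ge0 n)// leqnn.
have sF : sigma_algebra setT (F (q n)) by case: hF => + _ _; exact.
have [/(sub_measurableP _ sF) mX /(sub_measurableP _ sF) mV] := step_sum_adapted qlt' Fh'.
have FY : sub_measurable (F (q n)) (fun w => expR (step_sum n w - step_var n w / 2)).
  apply/(sub_measurableP _ sF); apply: measurableT_comp => //.
  by apply: measurable_funB => //; exact: measurable_funM.
rewrite -(IH qlt' Fh') -(brownian_step_expR qn0 (qlt n (leqnn _)) FY (Fh n (leqnn _)))//.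
apply: eq_integral => w _; congr EFin; rewrite -expRD; congr expR.
by rewrite /step_sum /step_var !big_ord_recr/=; field.
Qed.

Lemma integral_sqr_step n : (forall i, (i < n)%N -> q i < q i.+1) ->
  (forall i, (i < n)%N -> sub_measurable (F (q i)) (h i)) ->
  (\int[P]_w (step_sum n w ^+ 2)%:E =
   \sum_(i < n) (q i.+1 - q i)%:E * \int[P]_w (h i w ^+ 2)%:E)%E.
Proof.
elim: n => [|n IH] qlt Fh.
  under eq_integral do rewrite /step_sum big_ord0 expr0n.
  by rewrite big_ord0 integral_cst//= mul0e.
have qlt' i : (i < n)%N -> q i < q i.+1 by move=> i_n; apply: qlt; exact: ltnW.
have Fh' i : (i < n)%N -> sub_measurable (F (q i)) (h i).
  by move=> i_n; apply: Fh; exact: ltnW.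
have qn0 : 0 <= q n by rewrite (le_trans q0)// (@qS_ge0 n)// leqnn.
have [FX _] := step_sum_adapted qlt' Fh'.
rewrite big_ord_recr/= -(IH qlt' Fh').
rewrite -(brownian_step_sqr qn0 (qlt n (leqnn _)) FX (Fh n (leqnn _))).
by apply: eq_integral => w _; rewrite /step_sum big_ord_recr.
Qed.

End sums.

End discrete_martingales.

(** * Simple integrands as lists of blocks *)

(* Used for blocks, whose coefficients T -> R have no decidable equality, so that
   membership in a sequence of blocks is not available. *)
Fixpoint all_prop (A : Type) (Q : A -> Prop) (s : seq A) : Prop :=
  if s is x :: s' then Q x /\ all_prop Q s' else True.

Lemma all_prop_cat (A : Type) (Q : A -> Prop) (s1 s2 : seq A) :
  all_prop Q s1 -> all_prop Q s2 -> all_prop Q (s1 ++ s2).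
Proof. by elim: s1 => //= x s1 IH [Qx /IH Qs1] Qs2; split => //; exact: Qs1. Qed.

Lemma all_prop_imply (A : Type) (Q Q' : A -> Prop) (s : seq A) :
  (forall x, Q x -> Q' x) -> all_prop Q s -> all_prop Q' s.
Proof. by move=> QQ'; elim: s => //= x s IH [/QQ' Qx /IH]. Qed.

Lemma all_prop_mkseq (A : Type) (Q : A -> Prop) (f : nat -> A) n :
  (forall i, (i < n)%N -> Q (f i)) -> all_prop Q (mkseq f n).
Proof.
rewrite /mkseq => Qf.
have : forall i, i \in iota 0 n -> Q (f i) by move=> i; rewrite mem_iota => /Qf.
elim: (iota 0 n) => //= x s IH Qs; split; first by apply: Qs; rewrite mem_head.
by apply: IH => i si; apply: Qs; rewrite inE si orbT.
Qed.

Lemma indic_oc {R : realType} (a b u : R) : a <= b ->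
  \1_(`]a, b]%classic) u = (u <= b)%R%:R - (u <= a)%R%:R :> R.
Proof.
move=> ab; rewrite indicE mem_setE in_itv/=.
case: (leP u a) => ua/=; last by rewrite subr0.
by rewrite (le_trans ua ab) subrr.
Qed.

Lemma sum_indic_oc {R : realType} (q : nat -> R) n u :
  (forall i, (i < n)%N -> q i <= q i.+1) ->
  \sum_(i < n) \1_(`]q i, q i.+1]%classic) u = (u <= q n)%R%:R - (u <= q 0%N)%R%:R :> R.
Proof.
move=> qle; rewrite -(telescope_sumr (fun i => (u <= q i)%R%:R) (leq0n n)) big_mkord.
by apply: eq_bigr => i _; rewrite indic_oc// qle.
Qed.

Lemma integral_scale_indic_oc {R : realType} (c a b s t : R) :
  s <= a -> a <= b -> b <= t ->
  (\int[lebesgue_measure]_(u in `[s, t]) (c * \1_(`]a, b]%classic) u)%:E = (c * (b - a))%:E)%E.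
Proof.
move=> sa ab bt.
have i1 : lebesgue_measure.-integrable `[s, t] (EFin \o (\1_(`]a, b]%classic) : R -> R)).
  by apply: (integrableS measurableT) => //; exact: integrable_indic_itv.
under eq_integral do rewrite EFinM.
rewrite (integralZl _ i1)//= integral_indic//.
rewrite (_ : _ `&` _ = `]a, b]%classic); last first.
  apply/seteqP; split => u/=; rewrite !in_itv/=; first by case.
  by move=> /andP[au ub]; split; [rewrite au ub|rewrite (le_trans sa (ltW au)) (le_trans ub bt)].
rewrite /= lebesgue_measure_itv/= lte_fin; case: ltP => [_|ba]; first by rewrite EFinM.
by rewrite (@le_anti _ _ a b) ?ab// subrr mulr0 mule0.
Qed.

Section blocks.
Context {R : realType} {d : measure_display} {T : measurableType d}.
Variable P : probability T R.
Variables (F : R -> set_system T) (W : R -> T -> R).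
Hypotheses (hF : filtration F) (hW : brownian_motion P F W).

(* (a, b, xi) stands for the integrand xi 1_(]a, b]).  Blocks may overlap, so that
   sums of simple processes are concatenations; block_refine recovers a partition. *)
Definition block : Type := R * R * (T -> R).

Implicit Types L : seq block.

Definition block_sum L w := \sum_(x <- L) x.2 w * (W x.1.2 w - W x.1.1 w).

Definition block_val L (u : R) w :=
  \sum_(x <- L) x.2 w * \1_(`]x.1.1, x.1.2]%classic) u.

Definition block_adapted t (x : block) :=
  [/\ 0 <= x.1.1, x.1.1 <= x.1.2, x.1.2 <= t & sub_measurable (F x.1.1) x.2].

Section grid.
Variables (q : nat -> R) (n : nat).
Hypothesis qlt : forall i, (i < n)%N -> q i < q i.+1.

Lemma grid_le i j : (i <= n)%N -> (j <= n)%N -> (q i <= q j) = (i <= j)%N.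
Proof.
have ltq k l : (k < l <= n)%N -> q k < q l.
  move=> /andP[]; elim: l => // l IH; rewrite ltnS leq_eqVlt => /predU1P[->|kl] ln.
    exact: qlt.
  by rewrite (lt_trans (IH kl (ltnW ln)))// qlt.
move=> i_n jn; case: (ltngtP i j) => [ij|ji|->]; last exact: lexx.
- by rewrite ltW// ltq// ij.
- by apply: lt_geF; rewrite ltq// ji.
Qed.

Lemma grid_lt i j : (i <= n)%N -> (j <= n)%N -> (q i < q j) = (i < j)%N.
Proof. by move=> i_n jn; rewrite ltNge grid_le// ltnNge. Qed.

(** Cuts a block whose ends are grid points into cells: the truth value selects the cells from [ia]
    up to [ib], along which the increments of [g], a path of W, telescope. *)
Lemma grid_telescope (g : R -> R) ia ib : (ia <= ib <= n)%N ->
  \sum_(i < n) (q ia <= q i < q ib)%R%:R * (g (q i.+1) - g (q i)) =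
  g (q ib) - g (q ia).
Proof.
move=> /andP[ab bn]; have an := leq_trans ab bn.
rewrite -(big_mkord xpredT (fun i => (q ia <= q i < q ib)%R%:R * (g (q i.+1) - g (q i)))).
rewrite (big_cat_nat (leq0n ia) an)/= (big_cat_nat ab bn)/=.
rewrite big_nat_cond big1 ?add0r; last first.
  move=> i /andP[/andP[_ ia_i] _].
  have i_n : (i <= n)%N by rewrite ltnW// (leq_trans ia_i).
  by rewrite grid_le// leqNgt ia_i mul0r.
rewrite [X in _ + X]big_nat_cond [X in _ + X]big1 ?addr0; last first.
  move=> i /andP[/andP[ib_i i_n] _].
  by rewrite grid_lt ?(ltnW i_n)// ltnNge ib_i andbF mul0r.
rewrite -(telescope_sumr (fun i => g (q i)) ab).
rewrite big_nat_cond [RHS]big_nat_cond; apply: eq_bigr => i /andP[/andP[ia_i i_ib] _].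
have i_n : (i < n)%N by rewrite (leq_trans i_ib).
have i_n' := ltnW i_n.
by rewrite grid_le// grid_lt// ia_i i_ib mul1r.
Qed.

Definition on_grid (x : block) :=
  exists ia ib, [/\ (ia <= ib <= n)%N, x.1.1 = q ia & x.1.2 = q ib].

(** The coefficient on the cell ]q i, q i.+1] collects the blocks containing this cell. The test is
    made at the left end of the cell: a block that passes it begins no later than [q i], so its
    coefficient is known at that time. *)
Definition grid_coef L i w := \sum_(x <- L) x.2 w * (x.1.1 <= q i < x.1.2)%R%:R.

Lemma block_sum_grid L w : all_prop on_grid L ->
  block_sum L w = step_sum W q (grid_coef L) n w.
Proof.
rewrite /block_sum /step_sum /grid_coef => gL.
under [RHS]eq_bigr do rewrite mulr_suml.
rewrite exchange_big/=; elim: L gL => [|x L IH]; first by rewrite !big_nil.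
case=> -[ia [ib [iab aE bE]]] /IH {}IH; rewrite !big_cons IH; congr (_ + _).
rewrite aE bE -(grid_telescope (W^~ w) iab) mulr_sumr.
by apply: eq_bigr => i _; rewrite mulrA.
Qed.

Lemma block_val_grid L i u w : all_prop on_grid L -> (i < n)%N ->
  u \in `]q i, q i.+1] -> block_val L u w = grid_coef L i w.
Proof.
rewrite in_itv/= /block_val /grid_coef => gL i_n /andP[qu uq].
elim: L gL => [|x L IH]; first by rewrite !big_nil.
case=> -[ia [ib [/andP[ab bn] aE bE]]] /IH {}IH; rewrite !big_cons IH; congr (_ * _ + _).
have an := leq_trans ab bn; have i_n' := ltnW i_n.
rewrite indicE; congr (_%:R); congr nat_of_bool; rewrite aE bE grid_le// grid_lt//; apply/idP/idP.
- rewrite inE/= in_itv/= => /andP[au ub].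
  have := lt_le_trans au uq; rewrite grid_lt// ltnS => ->/=.
  by have := lt_le_trans qu ub; rewrite grid_lt.
- move=> /andP[ia_i i_ib]; rewrite inE/= in_itv/=; apply/andP; split.
    by apply: le_lt_trans qu; rewrite grid_le.
  by apply: (le_trans uq); rewrite grid_le.
Qed.

Lemma grid_coef_adapted t L i : 0 <= q 0%N -> (i < n)%N -> all_prop (block_adapted t) L ->
  sub_measurable (F (q i)) (grid_coef L i).
Proof.
move=> q0 i_n.
have qi0 : 0 <= q i by rewrite (le_trans q0)// grid_le// ltnW.
have sF : sigma_algebra setT (F (q i)) by case: hF => + _ _; exact.
move=> aL; apply/(sub_measurableP _ sF).
elim: L aL => [_|x L IH [[a0 ab _ Fx] /IH {}IH]].
  by rewrite (_ : grid_coef _ _ = cst 0)//; apply/funext => w; rewrite /grid_coef big_nil.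
rewrite (_ : grid_coef _ _ = fun w => x.2 w * (x.1.1 <= q i < x.1.2)%R%:R + grid_coef L i w); last first.
  by apply/funext => w; rewrite /grid_coef big_cons.
apply: measurable_funD => //; case: (boolP (x.1.1 <= q i)) => [aq|_].
  apply: measurable_funM => //; apply/(sub_measurableP _ sF).
  exact: filtrationS hF _ _ _ a0 aq Fx.
by rewrite (_ : (fun _ => _) = cst 0)//; apply/funext => w; rewrite mulr0.
Qed.

End grid.

Lemma measurable_block_val L w D : measurable_fun D (block_val L ^~ w).
Proof.
apply: measurable_funTS; elim: L => [|x L IH].
  by rewrite (_ : (fun _ => _) = cst 0)//; apply/funext => u; rewrite /block_val big_nil.
rewrite (_ : (fun _ => _) = fun u => x.2 w * \1_(`]x.1.1, x.1.2]%classic) u + block_val L u w).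
  by apply: measurable_funD => //; exact: measurable_funM.
by apply/funext => u; rewrite /block_val big_cons.
Qed.

Lemma all_on_grid (s : seq R) L t : sorted <%R s -> all_prop (block_adapted t) L ->
  (forall x, x \in flatten [seq [:: x.1.1; x.1.2] | x <- L] -> x \in s) ->
  all_prop (on_grid (nth 0 s) (size s).-1) L.
Proof.
move=> ss; elim: L => // -[[a b] x] L IH /= [[_ /= ab _ _] /IH {}IH] Ls; split; last first.
  by apply: IH => y yL; apply: Ls; rewrite !inE yL !orbT.
have [sa sb] : a \in s /\ b \in s by split; apply: Ls; rewrite !inE eqxx ?orbT.
exists (index a s), (index b s); rewrite !nth_index//; split => //; apply/andP; split.
- rewrite leqNgt; apply/negP => ba.
  have := @sorted_ltn_nth _ _ (@lt_trans _ R) 0 _ ss (index b s) (index a s).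
  by rewrite !inE !index_mem !nth_index// => /(_ sb sa ba); rewrite ltNge ab.
- by rewrite -ltnS prednK ?index_mem//; case: (s) sb.
Qed.

(** The sorted end points of all the blocks form a grid on which overlapping blocks are merged cell
    by cell. For the quadratic part an inequality is enough, since it enters tail bounds only. *)
Lemma block_refine L t : 0 <= t -> all_prop (block_adapted t) L ->
  exists q h n, [/\ 0 <= q 0%N, forall i, (i < n)%N -> q i < q i.+1,
    forall i, (i < n)%N -> sub_measurable (F (q i)) (h i),
    forall w, block_sum L w = step_sum W q h n w &
    forall w, ((step_var q h n w)%:E <=
      \int[lebesgue_measure]_(u in `[0%R, t]) (block_val L u w ^+ 2)%:E)%E].
Proof.
move=> t0 aL.
(* The point 0 is added so that the grid is nonempty even when there is no block. *)
pose ends := 0 :: flatten [seq [:: x.1.1; x.1.2] | x <- L].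
pose s := sort <=%R (undup ends).
have ss : sorted <%R s by rewrite sort_lt_sorted undup_uniq.
have sE x : (x \in s) = (x \in ends) by rewrite mem_sort mem_undup.
have ends0t x : x \in ends -> 0 <= x <= t.
  rewrite /ends inE => /predU1P[->|]; first by rewrite lexx.
  elim: L aL {ends s ss sE} => //= y L IH [[a0 ab bt _] /IH {}IH].
  rewrite !inE => /orP[/eqP ->|/orP[/eqP ->|/IH //]].
    by rewrite a0 (le_trans ab).
  by rewrite bt (le_trans a0).
have s_gt0 : (0 < size s)%N.
  by rewrite size_sort -has_predT; apply/hasP; exists 0 => //; rewrite mem_undup mem_head.
have gL : all_prop (on_grid (nth 0 s) (size s).-1) L.
  by apply: (@all_on_grid _ _ t) => // x xL; rewrite sE inE xL orbT.
set q := nth 0 s in gL *; set n := (size s).-1 in gL *.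
have nS : n.+1 = size s by rewrite prednK.
have qlt i : (i < n)%N -> q i < q i.+1.
  by move=> i_n; apply: (sorted_ltn_nth lt_trans) => //; rewrite inE -nS ltnS // ltnW.
have q0t i : (i <= n)%N -> 0 <= q i <= t.
  by move=> i_n; apply: ends0t; rewrite -sE mem_nth// -nS ltnS.
have q0 : 0 <= q 0%N by have /andP[] := q0t _ (leq0n n).
exists q, (grid_coef q L), n; split => //.
- by move=> i i_n; exact: (grid_coef_adapted qlt q0 i_n aL).
- by move=> w; exact: block_sum_grid.
move=> w; rewrite /step_var.
pose f i u := grid_coef q L i w ^+ 2 * \1_(`]q i, q i.+1]%classic) u.
have mf i : measurable_fun `[0, t] (f i).
  by apply: measurable_funM => //; apply: measurable_indic; exact: measurable_itv.
have f0 i u : 0 <= f i u by rewrite mulr_ge0 ?sqr_ge0.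
rewrite [leLHS](_ : _ = \int[lebesgue_measure]_(u in `[0%R, t]) (\sum_(i < n) (f i u)%:E))%E; last first.
  rewrite ge0_integral_sum//; first last.
  - by move=> i u _; rewrite lee_fin.
  - by move=> i; apply/measurable_EFinP; exact: mf.
  rewrite -sumEFin; apply: eq_bigr => i _.
  have /andP[qi0 _] := q0t _ (ltnW (ltn_ord i)).
  have /andP[_ qit] := q0t _ (ltn_ord i).
  by rewrite integral_scale_indic_oc// ltW// qlt.
apply: ge0_le_integral => //.
- by move=> u _; apply: sume_ge0 => i _; rewrite lee_fin.
- by apply: emeasurable_sum => i; apply/measurable_EFinP; exact: mf.
- by apply/measurable_EFinP; apply: measurable_funX; exact: measurable_block_val.
move=> u _; rewrite sumEFin lee_fin.
rewrite (eq_bigr (fun i : 'I_n => block_val L u w ^+ 2 * \1_(`]q i, q i.+1]%classic) u)); last first.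
  move=> i _; rewrite /f indicE mem_setE; case: (boolP (u \in _)) => [uI|_]; last by rewrite !mulr0.
  by rewrite (block_val_grid qlt w gL (ltn_ord i) uI).
(* The cells are disjoint: their indicators telescope to a difference of two truth values, at most
   1. *)
rewrite -mulr_sumr sum_indic_oc => [|i i_n]; last by rewrite ltW// qlt.
rewrite ler_piMr ?sqr_ge0//.
by case: (u <= q n); case: (u <= q 0%N); rewrite ?subr0 ?subrr ?sub0r ?lerN10.
Qed.

End blocks.

(** * Tail bounds *)

Section tail_bounds.
Context {R : realType} {d : measure_display} {T : measurableType d}.
Variable P : probability T R.

Lemma measurable_set_ge (g : T -> R) c : measurable_fun setT g ->
  measurable [set w | c <= g w].
Proof.
move=> mg; rewrite (_ : [set _ | _] = setT `&` g @^-1` `[c, +oo[%classic).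
  by apply: mg => //; exact: measurable_itv.
by apply/seteqP; split => w /=; rewrite in_itv/= andbT// => -[].
Qed.

Lemma markov_ge0 (g : T -> R) (c : R) : 0 < c -> measurable_fun setT g ->
  (forall w, 0 <= g w) ->
  (P [set w | c <= g w]%R <= (c^-1)%:E * \int[P]_w (g w)%:E)%E.
Proof.
move=> c0 mg g0; have mA := measurable_set_ge c mg.
rewrite lee_pdivlMl// -[X in P X]setIT -(integral_indic _ measurableT mA).
rewrite -ge0_integralZl_EFin//; last 2 first.
- by apply/measurable_EFinP; exact: measurable_indic.
- exact: ltW.
apply: ge0_le_integral => //.
- by move=> w _; rewrite -EFinM lee_fin mulr_ge0// ltW.
- by apply/measurable_EFinP; apply: measurable_funM => //; exact: measurable_indic.
- exact/measurable_EFinP.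
move=> w _; rewrite -EFinM lee_fin indicE.
by case: (boolP (w \in _)) => [|_]; [rewrite inE/= mulr1|rewrite mulr0].
Qed.

(** The events met in limits in probability may fail to be measurable, so inclusions that hold
    almost surely are compared through the outer measure, at the cost of a measurable null set. *)
Lemma outer_ae_le (A B : set T) : {ae P, forall w, A w -> B w} ->
  (P^*%mu A <= P^*%mu B)%E.
Proof.
move=> [N [mN N0 AB]].
apply: (@le_trans _ _ (P^*%mu (B `|` N))).
  apply: le_outer_measure => w Aw; have [Bw|nBw] := pselect (B w); first by left.
  by right; apply: AB => /= /(_ Aw).
apply: le_trans (outer_measureU2 _ _ _) _.
have {}N0 : P N = 0%E by exact: N0.
have PN : (P^*%mu N <= 0)%E by rewrite measurable_mu_extE// le_eqVlt; apply/orP; left; apply/eqP; exact: N0.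
by rewrite -[leRHS]adde0; apply: leeD.
Qed.

Variables (F : R -> set_system T) (W : R -> T -> R).
Hypotheses (hF : filtration F) (hW : brownian_motion P F W).

Lemma measurable_step_sum (q : nat -> R) h n : 0 <= q 0%N ->
  (forall i, (i < n)%N -> q i < q i.+1) ->
  (forall i, (i < n)%N -> sub_measurable (F (q i)) (h i)) ->
  measurable_fun setT (step_sum W q h n) /\ measurable_fun setT (step_var q h n).
Proof.
move=> q0 qlt Fh; have [FX FV] := step_sum_adapted hF hW q0 qlt Fh.
have qn0 : 0 <= q n by rewrite (le_trans q0)// (@grid_le _ q n).
by split; [apply: filtration_measurable hF _ _ qn0 FX|apply: filtration_measurable hF _ _ qn0 FV].
Qed.

Lemma integral_expR_scale_step (q : nat -> R) h n lam : 0 <= q 0%N ->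
  (forall i, (i < n)%N -> q i < q i.+1) ->
  (forall i, (i < n)%N -> sub_measurable (F (q i)) (h i)) ->
  (\int[P]_w (expR (lam * step_sum W q h n w - lam ^+ 2 * step_var q h n w / 2))%:E = 1)%E.
Proof.
move=> q0 qlt Fh.
rewrite -(@integral_expR_step _ _ _ P F W hF hW q (fun i w => lam * h i w) q0 n)//.
  apply: eq_integral => w _; congr (expR (_ - _ / _))%:E.
  - by rewrite /step_sum mulr_sumr; apply: eq_bigr => i _; rewrite mulrA.
  - by rewrite /step_var mulr_sumr; apply: eq_bigr => i _; rewrite exprMn mulrA.
move=> i i_n; have qi0 : 0 <= q i by rewrite (le_trans q0)// (@grid_le _ q n)// ltnW.
have sF : sigma_algebra setT (F (q i)) by case: hF => + _ _; exact.
apply/(sub_measurableP _ sF); apply: measurable_funM => //.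
by apply/(sub_measurableP _ sF); exact: Fh.
Qed.

(* Markov's inequality for exp(+- lam X - lam^2 Q / 2), of mean 1, off the event
   where Q >= dl. *)
Lemma block_tail (L : seq (@block R d T)) (t lam e dl : R) : 0 <= t ->
  all_prop (block_adapted F t) L -> 0 <= lam ->
  (P^*%mu [set w | e <= `|block_sum W L w| ]%R <=
   (2 * expR (- lam * e + lam ^+ 2 * dl / 2))%:E +
   P^*%mu [set w | dl%:E <=
     \int[lebesgue_measure]_(u in `[0%R, t]) (block_val L u w ^+ 2)%:E])%E.
Proof.
move=> t0 aL lam0.
have [q [h [n [q0 qlt Fh YE VE]]]] := block_refine W hF t0 aL.
have [mX mV] := measurable_step_sum q0 qlt Fh.
set c := expR (- lam * e + _).
have c0 : 0 < c^-1 by rewrite invr_gt0 expR_gt0.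
pose g (l : R) w := expR (l * step_sum W q h n w - l ^+ 2 * step_var q h n w / 2).
have mg l : measurable_fun setT (g l).
  apply: measurableT_comp => //; apply: measurable_funB; first exact: measurable_funM.
  by apply: measurable_funM => //; exact: measurable_funM.
have Pg l : (P^*%mu [set w | c^-1 <= g l w]%R <= c%:E)%E.
  rewrite measurable_mu_extE; last exact: measurable_set_ge.
  apply: le_trans (markov_ge0 c0 (mg l) (fun w => expR_ge0 _)) _.
  by rewrite integral_expR_scale_step// mule1 invrK.
pose B := [set w | dl%:E <=
     \int[lebesgue_measure]_(u in `[0%R, t]) (block_val L u w ^+ 2)%:E]%E.
apply: (@le_trans _ _ (P^*%mu (([set w | c^-1 <= g lam w] `|`
    [set w | c^-1 <= g (- lam) w]) `|` B))).
  apply: le_outer_measure => w /= eY.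
  have [Bw|/negP] := pselect (B w); first by right.
  rewrite /B/= -ltNge => Bw; left.
  have Vdl : step_var q h n w <= dl by rewrite -lee_fin (le_trans (VE w))// ltW.
  have key l x : lam * e <= l * x -> l ^+ 2 = lam ^+ 2 ->
      c^-1 <= expR (l * x - l ^+ 2 * step_var q h n w / 2).
    move=> ex ->; rewrite /c -expRN ler_expR opprD mulNr opprK.
    by rewrite lerB// ler_pM2r ?invr_gt0// ler_wpM2l// sqr_ge0.
  move: eY; rewrite YE; case: (ger0P (step_sum W q h n w)) => x0 eY; [left|right].
  - by apply: key => //; rewrite ler_wpM2l.
  - by apply: key; rewrite ?sqrrN// mulNr -mulrN ler_wpM2l.
apply: le_trans (outer_measureU2 _ _ _) _; apply: leeD => //.
apply: le_trans (outer_measureU2 _ _ _) _.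
by rewrite mulr_natl mulr2n EFinD; apply: leeD; exact: Pg.
Qed.

End tail_bounds.

(** * Uniform grids and continuous processes *)

Section riemann_steps.
Context {R : realType}.
Implicit Types (f : R -> R) (s t u : R).
Local Notation mu := (@lebesgue_measure R).

Lemma bounded_cvg_integral s t (g_ : nat -> R -> R) (g : R -> R) (M : R) : s <= t ->
  (forall n, measurable_fun setT (g_ n)) -> measurable_fun setT g ->
  (forall u, u \in `]s, t] -> g_ n u @[n --> \oo] --> g u) ->
  (forall n u, u \in `]s, t] -> `|g_ n u| <= M) ->
  (\int[mu]_(u in `]s, t]) (g_ n u)%:E)%E @[n --> \oo] -->
  (\int[mu]_(u in `]s, t]) (g u)%:E)%E.
Proof.
move=> st mg_ mg cg bg.
have [] := @dominated_convergence _ _ _ mu `]s, t]%classic (measurable_itv _)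
  (fun n u => (g_ n u)%:E) (fun u => (g u)%:E) (cst M%:E) => //.
- by move=> n; apply: measurable_funTS; apply/measurable_EFinP; exact: mg_.
- by apply: measurable_funTS; apply/measurable_EFinP; exact: mg.
- by apply: aeW => u ut; apply: cvg_EFin; [exact: nearW|exact: cg].
- apply/integrableP; split; first exact: measurable_cst.
  rewrite integral_cst//= lebesgue_measure_itv/=.
  by case: ifP => _; rewrite ?mule0 ?ltry// -EFinD -EFinM ltry.
- by apply: aeW => u n ut; rewrite lee_fin; exact: bg.
Qed.

(* The grid has m.+1 steps, so that m = 0 is not degenerate. *)
Definition gpt s t m i := s + (t - s) * (i%:R / m.+1%:R).

(** Each cell is open on the left and carries the value at its left end, so an adapted path yields a
    predictable integrand; on ]s, t] exactly one cell contributes, and none at s. *)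
Definition step_fun f s t m u :=
  \sum_(i < m.+1) f (gpt s t m i) * \1_(`]gpt s t m i, gpt s t m i.+1]%classic) u.

Lemma gpt0 s t m : gpt s t m 0 = s.
Proof. by rewrite /gpt mul0r mulr0 addr0. Qed.

Lemma gptn s t m : gpt s t m m.+1 = t.
Proof. by rewrite /gpt divff// mulr1 addrC subrK. Qed.

Lemma gptB s t m i : gpt s t m i.+1 - gpt s t m i = (t - s) / m.+1%:R.
Proof.
have : m.+1%:R != 0 :> R by rewrite pnatr_eq0.
by rewrite /gpt -[i.+1]addn1 natrD; move: m.+1%:R => x x0; field.
Qed.

Lemma gpt_lt s t m i : s < t -> gpt s t m i < gpt s t m i.+1.
Proof. by move=> st; rewrite -subr_gt0 gptB divr_gt0// subr_gt0. Qed.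

Lemma gpt_itv s t m i : s <= t -> (i <= m.+1)%N -> s <= gpt s t m i <= t.
Proof.
move=> st im; rewrite /gpt lerDl mulr_ge0 ?subr_ge0 ?divr_ge0//=.
by rewrite -lerBrDl ler_piMr ?subr_ge0// ler_pdivrMr// mul1r ler_nat.
Qed.

Lemma step_fun_indic s t m u : s < t -> u \in `]s, t] ->
  \sum_(i < m.+1) \1_(`]gpt s t m i, gpt s t m i.+1]%classic) u = 1 :> R.
Proof.
move=> st; rewrite in_itv/= => /andP[su ut].
rewrite (@sum_indic_oc _ (gpt s t m)) => [|i _]; last exact/ltW/gpt_lt.
by rewrite gpt0 gptn ut leNgt su subr0.
Qed.

Lemma step_fun0 f s t m u : s < t -> u <= s -> step_fun f s t m u = 0.
Proof.
move=> st us; rewrite /step_fun big1// => i _.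
rewrite indicE memNset ?mulr0// => /=; rewrite in_itv/= => /andP[].
have /andP[+ _] := @gpt_itv s t m i (ltW st) (ltnW (ltn_ord i)).
by move=> /(le_trans us); rewrite leNgt => /negbTE ->.
Qed.

Lemma measurable_step_fun f s t m : measurable_fun setT (step_fun f s t m).
Proof.
by apply: measurable_sum => i; apply: measurable_funM => //; exact: measurable_indic.
Qed.

Lemma cvg_step_fun f s t u : s < t -> continuous f -> u \in `]s, t] ->
  step_fun f s t m u @[m --> \oo] --> f u.
Proof.
move=> st cf ut; apply/cvgrPdist_le => e e0.
have /cvgrPdist_le/(_ e e0) := cf u; rewrite -nbhs_ballE => -[dl /= dl0 fdl].
near=> m.
have md : (t - s) / m.+1%:R < dl.
  rewrite ltr_pdivrMr// mulrC -ltr_pdivrMr//.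
  near: m; exists (Num.bound ((t - s) / dl)) => // m /= bm.
  have ts0 : 0 <= (t - s) / dl by rewrite divr_ge0// ?subr_ge0 ltW.
  rewrite (lt_le_trans (archi_boundP ts0))// ler_nat; exact: leqW.
(* Writing f u as f u times the sum of the indicators, which is 1, reduces the error to that on the
   single cell containing u, of length below [dl]. *)
rewrite -[f u]mulr1 -(@step_fun_indic s t m u st ut) mulr_sumr /step_fun -sumrB.
apply: (le_trans (ler_norm_sum _ _ _)).
rewrite -[leRHS]mulr1 -(@step_fun_indic s t m u st ut) mulr_sumr.
apply: ler_sum => i _; rewrite -mulrBl normrM.
rewrite [X in _ * X]ger0_norm//.
rewrite indicE; case: (boolP (u \in _)) => [|_]; last by rewrite !mulr0.
rewrite inE/= in_itv/= => /andP[qu uq]; rewrite !mulr1; apply: fdl.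
rewrite /ball/= gtr0_norm ?subr_gt0//; apply: le_lt_trans md.
by rewrite -(gptB s t m i) lerD2r.
Unshelve. all: by end_near. Qed.

Lemma continuous_bounded f s t : s <= t -> continuous f ->
  exists2 M, 0 <= M & forall u, u \in `[s, t] -> `|f u| <= M.
Proof.
move=> st cf.
have cnf : continuous (fun x => `|f x|).
  by move=> x; apply: (@continuous_comp _ _ _ f Num.norm); [exact: cf|exact: norm_continuous].
have [c _ cM] := EVT_max st (continuous_subspaceT cnf).
by exists `|f c|.
Qed.

Lemma step_fun_bounded f s t M m u : s < t -> 0 <= M ->
  (forall v, v \in `[s, t] -> `|f v| <= M) -> u \in `]s, t] -> `|step_fun f s t m u| <= M.
Proof.
move=> st M0 fM ut; rewrite -[leRHS]mulr1 -(@step_fun_indic s t m u st ut) mulr_sumr.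
apply: (le_trans (ler_norm_sum _ _ _)); apply: ler_sum => i _.
rewrite normrM [X in _ * X]ger0_norm// ler_wpM2r//.
by apply: fM; rewrite in_itv/= gpt_itv// ?ltW// ltnW.
Qed.

Lemma step_fun_cvg_L2 f s t : s < t -> continuous f ->
  (\int[mu]_(u in `]s, t]) ((step_fun f s t m u - f u) ^+ 2)%:E)%E @[m --> \oo] --> 0%E.
Proof.
move=> st cf; have [M M0 fM] := continuous_bounded (ltW st) cf.
rewrite -[X in _ --> X](@integral0 _ _ _ mu `]s, t]%classic).
apply: (@bounded_cvg_integral s t (fun m u => (step_fun f s t m u - f u) ^+ 2) (cst 0) ((M + M) ^+ 2)).
- exact: ltW.
- move=> m; apply: measurable_funX; apply: measurable_funB; first exact: measurable_step_fun.
  exact: continuous_measurable_fun.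
- exact: measurable_cst.
- move=> u ut; rewrite [X in _ --> X](_ : _ = (f u - f u) ^+ 2); last by rewrite subrr expr0n.
  apply: (@cvg_comp _ _ _ (fun m => step_fun f s t m u - f u) (fun x => x ^+ 2)); last exact: exprn_continuous.
  by apply: cvgB; [exact: cvg_step_fun|exact: cvg_cst].
- move=> m u ut; rewrite normrX lerXn2r ?nnegrE ?addr_ge0//.
  apply: (le_trans (ler_normB _ _)); apply: lerD; first exact: step_fun_bounded fM ut.
  by apply: fM; move: ut; rewrite !in_itv/= => /andP[/ltW -> ->].
Qed.

Lemma integral_step_fun f s t m : s < t ->
  (\int[mu]_(u in `]s, t]) (step_fun f s t m u)%:E =
   ((t - s) / m.+1%:R * \sum_(i < m.+1) f (gpt s t m i))%:E)%E.
Proof.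
move=> st; rewrite integral_itv_obnd_cbnd; last first.
  by apply/measurable_EFinP; apply: measurable_funTS; exact: measurable_step_fun.
under eq_integral do rewrite /step_fun -sumEFin.
rewrite integral_sum//=.
  rewrite mulr_sumr -sumEFin; apply: eq_bigr => i _.
  have [sa _] := andP (@gpt_itv s t m i (ltW st) (ltnW (ltn_ord i))).
  have [_ bt] := andP (@gpt_itv s t m i.+1 (ltW st) (ltn_ord i)).
  by rewrite integral_scale_indic_oc ?(ltW (gpt_lt _ _ st))// gptB mulrC.
move=> i; apply: (integrableS measurableT) => //.
exact: (integrableZl _ _ (integrable_indic_itv _ _ false false)).
Qed.

(** The Riemann sum is the integral of [step_fun], so bounded convergence suffices. Applied path by
    path, it gives both the measurability of time integrals and the limit of the quadratic
    variations of grid sums. *)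
Lemma riemann_sum_cvg f s t : s < t -> continuous f ->
  (t - s) / m.+1%:R * \sum_(i < m.+1) f (gpt s t m i) @[m --> \oo] -->
  \int[mu]_(u in `[s, t]) f u.
Proof.
move=> st cf; have [M M0 fM] := continuous_bounded (ltW st) cf.
have if' : mu.-integrable `[s, t] (EFin \o f).
  apply: continuous_compact_integrable; first exact: segment_compact.
  exact: continuous_subspaceT.
apply: (@fine_cvg _ _ _ _ (fun m => ((t - s) / m.+1%:R * \sum_(i < m.+1) f (gpt s t m i))%:E)); rewrite /Rintegral fineK; last exact: integral_fune_fin_num if'.
rewrite -integral_itv_obnd_cbnd; last first.
  by apply: measurable_funTS; apply/measurable_EFinP; exact: continuous_measurable_fun.
under eq_fun do rewrite -integral_step_fun//.
apply: (@bounded_cvg_integral s t _ f M).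
- exact: ltW.
- by move=> m; exact: measurable_step_fun.
- exact: continuous_measurable_fun.
- by move=> u ut; exact: cvg_step_fun.
- by move=> m u ut; exact: step_fun_bounded fM ut.
Qed.

End riemann_steps.

Section continuous_processes.
Context {R : realType} {d : measure_display} {T : measurableType d}.
Variable P : probability T R.
Local Notation mu := (@lebesgue_measure R).

(** Time is frozen at 0 on the negative axis and the paths are set to 0 on a null set containing the
    discontinuous ones. That null set need not belong to [F 0], so [Y] may fail to be adapted; this
    is why later statements carry both an adapted [H] and a continuous copy [Hc]. *)
Lemma continuous_modification (X : R -> T -> R) :
  (forall s, 0 <= s -> measurable_fun setT (X s)) -> continuous_paths P X ->
  exists Y : R -> T -> R, [/\ forall w, continuous (Y ^~ w),
    forall s, measurable_fun setT (Y s) &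
    {ae P, forall w, forall s, 0 <= s -> Y s w = X s w}].
Proof.
move=> mX [N [mN N0 cX]].
pose Y s w := X (Num.max s 0) w * \1_(~` N) w.
have Ygood w : ~ N w -> Y ^~ w = (fun s => X (Num.max s 0) w).
  by move=> Nw; apply/funext => s; rewrite /Y indicE mem_set ?mulr1.
exists Y; split.
- move=> w; have [Nw|Nw] := pselect (N w).
    rewrite (_ : Y ^~ w = cst 0); first exact: cst_continuous.
    by apply/funext => s; rewrite /Y indicE memNset ?mulr0//; apply/contrapT.
  rewrite Ygood// => s.
  have : {within `[0, +oo[, continuous (X ^~ w)} by apply: contrapT => /cX.
  move=> /subspace_continuousP/(_ (Num.max s 0)).
  rewrite /= in_itv/= le_max lexx orbT => /(_ isT) cw.
  apply: (@cvg_comp _ _ _ (fun s => Num.max s 0) (X ^~ w) _ _ _ _ cw) => U.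
  have cm : continuous (fun x : R => Num.max x 0).
    by move=> x; apply: continuous_max; [exact: cvg_id|exact: cvg_cst].
  move=> HU.
  have H : nbhs s [set x : R | Num.max x 0 \in `[0, +oo[%R -> U (Num.max x 0)] by exact: cm s _ HU.
  apply: (@filterS _ (nbhs s) _ _ _ _ H) => x /=.
  by rewrite in_itv/= le_max lexx orbT; exact.
- move=> s; apply: measurable_funM; first by apply: mX; rewrite le_max lexx orbT.
  by apply: measurable_indic; exact: measurableC.
- exists N; split => // w /= h; apply: contrapT => Nw; apply: h => s s0.
  by rewrite /Y indicE mem_set// mulr1 max_l.
Qed.

Section joint.
Variable X : R -> T -> R.
Hypotheses (cX : forall w, continuous (X ^~ w)) (mX : forall s, measurable_fun setT (X s)).

Lemma measurable_Rintegral_process s t : s <= t ->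
  measurable_fun setT (fun w => \int[mu]_(u in `[s, t]) X u w).
Proof.
rewrite le_eqVlt => /predU1P[->|st].
  by under eq_fun do rewrite set_itv1 Rintegral_set1; exact: measurable_cst.
apply: (@measurable_fun_cvg _ _ _ _ (fun m w =>
  (t - s) / m.+1%:R * \sum_(i < m.+1) X (gpt s t m i) w)).
- move=> m; apply: measurable_funM => //; apply: measurable_sum => i; exact: mX.
- by move=> w _; apply: riemann_sum_cvg => //; exact: cX.
Qed.

(** Joint measurability, required by Fubini: the left-point step processes are finite sums of
    products of measurable functions, converge pointwise on ]s, t] by continuity, and vanish
    outside. *)
Lemma measurable_process s t : s < t ->
  measurable_fun setT (fun z : measurableTypeR R * T =>
    X z.1 z.2 * \1_(`]s, t]%classic) z.1).
Proof.
move=> st.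
apply: (@measurable_fun_cvg _ _ _ _ (fun m z => step_fun (X ^~ z.2) s t m z.1)).
- move=> m; apply: measurable_sum => i; apply: measurable_funM.
    exact: measurableT_comp (mX _) measurable_snd.
  by apply: measurableT_comp measurable_fst; exact: measurable_indic.
- move=> z _ /=; rewrite indicE mem_setE.
  case: (boolP (_ \in _)) => [zst|zst].
    by rewrite mulr1; apply: cvg_step_fun => //; exact: cX.
  rewrite mulr0; apply: cvg_near_cst; apply: nearW => m.
  rewrite /step_fun big1// => i _; rewrite indicE memNset ?mulr0//= => zi.
  have [sa _] := andP (@gpt_itv _ s t m i (ltW st) (ltnW (ltn_ord i))).
  have [_ bt] := andP (@gpt_itv _ s t m i.+1 (ltW st) (ltn_ord i)).
  move: zst zi; rewrite !in_itv/= => /negP + /andP[az zb]; apply.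
  by rewrite (le_lt_trans sa az) (le_trans zb bt).
Qed.

End joint.

End continuous_processes.

Lemma cvge0P {R : realType} (f : nat -> \bar R) : (forall n, 0 <= f n)%E ->
  f @ \oo --> 0%E <-> forall e : R, 0 < e -> \forall n \near \oo, (f n <= e%:E)%E.
Proof.
move=> f0; split=> [/fine_cvgP[ff /cvgr0Pnorm_le cf] e e0|fe].
  near=> n.
  have fn : f n \is a fin_num by near: n.
  rewrite -(fineK fn) lee_fin -[leLHS]ger0_norm; last exact: fine_ge0.
  by near: n; exact: cf.
apply/fine_cvgP; split.
  near=> n; rewrite ge0_fin_numE//; apply: (@le_lt_trans _ _ 1%:E); last exact: ltry.
  by near: n; exact: fe.
apply/cvgr0Pnorm_le => e e0; near=> n => /=.
rewrite ger0_norm; last exact: fine_ge0.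
rewrite -lee_fin fineK; first by near: n; exact: fe.
rewrite ge0_fin_numE//; apply: (@le_lt_trans _ _ e%:E); last exact: ltry.
by near: n; exact: fe.
Unshelve. all: by end_near. Qed.

(** * Fubini, Fatou and almost sure subsequences *)

Section probability_tools.
Context {R : realType} {d : measure_display} {T : measurableType d}.
Variable P : probability T R.
Local Notation mu := (@lebesgue_measure R).

Lemma integral_mul_indic d' (T' : measurableType d') (nu : {measure set T' -> \bar R})
  (A : set T') (h : T' -> \bar R) :
  (\int[nu]_u (h u * (\1_A u)%:E) = \int[nu]_(u in A) h u)%E.
Proof.
rewrite [RHS]integral_mkcond; apply: eq_integral => u _.
by rewrite patchE indicE; case: ifPn => _; rewrite ?mule1 ?mule0.
Qed.

(** A bound on E |X_s| uniform over the bounded interval makes X integrable for the product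
    measure. *)
Lemma process_fubini (X : R -> T -> R) (t K : R) :
  (forall w, continuous (X ^~ w)) -> (forall s, measurable_fun setT (X s)) -> 0 <= t ->
  (forall s, 0 <= s <= t -> (\int[P]_w (`|X s w|)%:E <= K%:E)%E) ->
  [/\ P.-integrable setT (fun w => (\int[mu]_(u in `[0, t]) X u w)%:E),
    mu.-integrable `[0, t] (fun u => \int[P]_w (X u w)%:E)%E &
    (\int[P]_w (\int[mu]_(u in `[0%R, t]) X u w)%:E =
     \int[mu]_(u in `[0%R, t]) \int[P]_w (X u w)%:E)%E].
Proof.
move=> cX mX t0 XK; pose A : set R := `[0, t]%classic.
pose f (z : measurableTypeR R * T) : \bar R := (X z.1 z.2 * \1_A z.1)%:E.
have mA : measurable A by exact: measurable_itv.
have m1 : measurable_fun setT (fun z : measurableTypeR R * T => \1_A z.1 : R).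
  by apply: measurableT_comp measurable_fst; exact: measurable_indic.
have mf : measurable_fun setT f.
  (* Joint measurability is available on intervals open on the left; [0, t] is cut out of ]-1, t],
     which also covers t = 0. *)
  have t1 : -1 < t by lra.
  rewrite (_ : f = EFin \o (fun z => X z.1 z.2 * \1_(`]-1, t]%classic) z.1 * \1_A z.1)).
    apply/measurable_EFinP; apply: measurable_funM m1.
    exact: measurable_process.
  apply/funext => z; rewrite /f/=; congr EFin; rewrite -mulrA; congr (_ * _).
  rewrite !indicE; case: (boolP (z.1 \in A)) => zA; last by rewrite mulr0.
  have : z.1 \in `[0, t]%R by move: zA; rewrite inE.
  rewrite in_itv/= => /andP[z0 zt].
  rewrite mem_set ?mul1r//= in_itv/= zt andbT.
  by apply: lt_le_trans z0; rewrite ltrN10.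
have FE u : (\int[P]_w f (u, w) = \int[P]_w (X u w)%:E * (\1_A u)%:E)%E.
  rewrite /f/= indicE; case: (boolP (u \in _)) => ut.
    by under eq_integral do rewrite mulr1; rewrite mule1.
  by under eq_integral do rewrite mulr0; rewrite integral0 mule0.
have If : (mu \x P)%E.-integrable setT f.
  apply/(integrable12ltyP mu P mf).
  apply: (@le_lt_trans _ _ (\int[mu]_(u in A) K%:E)%E); last first.
    rewrite integral_cst//= lebesgue_measure_itv/=.
    by case: ifP => _; rewrite ?mule0 ?ltry// -EFinD -EFinM ltry.
  rewrite -(@integral_mul_indic _ _ mu A); apply: ge0_le_integral => //.
  - by move=> u _; apply: integral_ge0.
  - apply: (@measurable_fun_fubini_tonelli_F _ _ _ _ _ P (abse \o f)) => [|z];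
      [exact: measurableT_comp|exact: abse_ge0].
  - by apply/measurable_EFinP; apply: measurable_funM => //; exact: measurable_indic.
  move=> u _; rewrite /f/= -EFinM indicE; case: (boolP (u \in _)) => ut; last first.
    by under eq_integral do rewrite mulr0 normr0; rewrite integral0 mulr0.
  under eq_integral do rewrite mulr1; rewrite mulr1; apply: XK.
  by have : u \in `[0, t]%R by move: ut; rewrite inE.
have iX w : mu.-integrable A (EFin \o X ^~ w).
  apply: continuous_compact_integrable; first exact: segment_compact.
  exact: continuous_subspaceT.
have G w : (\int[mu]_u f (u, w) = (\int[mu]_(u in A) X u w)%:E)%E.
  rewrite /f/=; under eq_integral do rewrite EFinM.
  by rewrite integral_mul_indic /Rintegral fineK//; exact: integral_fune_fin_num (iX w).
split.
- have mI : measurable_fun setT (fun w => \int[mu]_(u in A) X u w).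
    exact: measurable_Rintegral_process.
  apply/integrableP; split; first exact/measurable_EFinP.
  apply: le_lt_trans ((integrable21ltyP mu P mf).1 If).
  apply: ge0_le_integral => //.
  - by apply: measurableT_comp => //; exact/measurable_EFinP.
  - apply: (@measurable_fun_fubini_tonelli_G _ _ _ _ _ mu (abse \o f)) => [|z];
      [exact: measurableT_comp|exact: abse_ge0].
  - move=> w _; rewrite -G; apply: le_abse_integral => //.
    exact: measurableT_comp.
- have h : mu.-integrable A (fubini_F P f).
    by apply: (integrableS measurableT) (integrable_fubini_F If).
  apply: eq_integrable h => // u uA.
  by rewrite /fubini_F FE indicE uA mule1.
- under eq_integral do rewrite -G.
  rewrite -[LHS]/(\int[P]_w \int[mu]_u f (u, w))%E -(Fubini If).
  by rewrite -(@integral_mul_indic _ _ mu A); apply: eq_integral => u _; exact: FE.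
Qed.

Lemma fatou_bound (Y : nat -> T -> R) (Z : T -> R) (C : \bar R) :
  (forall k, measurable_fun setT (Y k)) -> measurable_fun setT Z ->
  (forall k w, 0 <= Y k w) -> {ae P, forall w, Y k w @[k --> \oo] --> Z w} ->
  (forall k, \int[P]_w (Y k w)%:E <= C)%E -> (\int[P]_w (Z w)%:E <= C)%E.
Proof.
move=> mY mZ Y0 YZ YC.
have mYE k : measurable_fun setT (EFin \o Y k) by exact/measurable_EFinP.
have -> : (\int[P]_w (Z w)%:E = \int[P]_w limn_einf (fun k => (Y k w)%:E))%E.
  apply: ae_eq_integral => //.
  - exact/measurable_EFinP.
  - apply: measurableT_comp => //.
    apply: (@measurable_fun_limn_esup _ _ _ _ (fun k w => - (Y k w)%:E)%E) => k.
    by apply: measurableT_comp => //; exact: mYE.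
  apply: filterS YZ => w YZw _.
  have YZE : (Y k w)%:E @[k --> \oo] --> (Z w)%:E by apply: cvg_EFin => //; exact: nearW.
  by have [-> _] := cvg_limn_einf_sup YZE.
apply: (le_trans (fatou P measurableT mYE _)).
  by move=> k w _; rewrite lee_fin.
rewrite limn_einf_lim; apply: lime_le; first exact: is_cvg_einfs.
by apply: nearW => k; apply: le_trans (YC k); apply: ereal_inf_lbound; exists k => /=.
Qed.

(** Borel-Cantelli: [phi k] is chosen so that a deviation of 1 / (k + 1) has probability at most
    2^-(k + 1). The map [phi] need not be increasing; k <= phi k suffices to compose it with limits
    at infinity. *)
Lemma cvg_in_probability_seq (X : nat -> T -> R) (Z : T -> R) :
  (forall k, measurable_fun setT (X k)) -> measurable_fun setT Z ->
  cvg0_in_probability P (fun k w => (`|X k w - Z w|)%:E) ->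
  exists phi : nat -> nat, (forall k, (k <= phi k)%N) /\
    {ae P, forall w, X (phi k) w @[k --> \oo] --> Z w}.
Proof.
move=> mX mZ XZ.
have mA c k : measurable [set w | c <= `|X k w - Z w|]%R.
  apply: measurable_set_ge; apply: measurableT_comp => //; exact: measurable_funB.
have ex k : exists m, (k <= m)%N /\
    (P [set w | k.+1%:R^-1 <= `|X m w - Z w|]%R <= (1 / (2 ^ k.+1)%:R)%:E)%E.
  have k0 : 0 < k.+1%:R^-1 :> R by [].
  have /cvge0P := XZ _ k0.
  move=> /(_ (fun n => outer_measure_ge0 _ _)) /(_ (1 / (2 ^ k.+1)%:R)).
  rewrite divr_gt0// ?ltr0n ?expn_gt0// => /(_ isT)[N _ /(_ (maxn k N) (leq_maxr _ _))/=].
  move=> H; exists (maxn k N); rewrite leq_maxl; split => //.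
  by rewrite -(measurable_mu_extE P (mA _ _)).
pose phi k := sval (cid (ex k)).
have phiP k : (k <= phi k)%N /\
    (P [set w | k.+1%:R^-1 <= `|X (phi k) w - Z w|]%R <= (1 / (2 ^ k.+1)%:R)%:E)%E.
  exact: svalP (cid (ex k)).
exists phi; split => [k|]; first by have [] := phiP k.
pose E k := [set w | k.+1%:R^-1 <= `|X (phi k) w - Z w|]%R.
have mE k : measurable (E k) by exact: mA.
exists (lim_sup_set E); split.
- by apply: bigcap_measurable => // n _; exact: bigcup_measurable.
- apply: lim_sup_set_cvg0 => //.
  apply: (@le_lt_trans _ _ 1%:E); last exact: ltry.
  apply: le_trans (epsilon_trick0 xpredT ler01).
  by apply: lee_nneseries => // k _; have [] := phiP k.
- move=> w /= nXZ; apply: contrapT => nE; apply: nXZ.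
  have [N _ NE] : \forall k \near \oo, ~ E k w.
    apply: contrapT => fE; apply: nE => N _.
    apply: contrapT => EN; apply: fE; exists N => // k /= Nk Ek.
    by apply: EN; exists k.
  apply/cvgrPdist_le => e e0; near=> k.
  have /= := NE k; rewrite /E/= => /(_ _)/negP; rewrite -ltNge => Ek.
  rewrite distrC ltW// (lt_le_trans (Ek _))//; first by near: k; exists N.
  rewrite invf_ple ?posrE//.
  have e1 : 0 <= e^-1 by rewrite invr_ge0 ltW.
  rewrite (le_trans (ltW (archi_boundP e1)))// ler_nat.
  by rewrite leqW//; near: k; exists (Num.bound e^-1).
Unshelve. all: by end_near. Qed.

End probability_tools.

(** * The Ito integral of a continuous process *)

Section ito_approximation.
Context {R : realType} {d : measure_display} {T : measurableType d}.
Variable P : probability T R.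
Local Notation mu := (@lebesgue_measure R).

Lemma cvg_in_probability (Y : nat -> T -> \bar R) :
  (forall k, measurable_fun setT (Y k)) -> (forall k w, 0 <= Y k w)%E ->
  (forall w, Y k w @[k --> \oo] --> 0%E) -> cvg0_in_probability P Y.
Proof.
move=> mY Y0 cY e e0.
have mE k : measurable [set w | e%:E <= Y k w]%E.
  by rewrite -[X in measurable X]setTI; exact: emeasurable_fun_c_infty.
rewrite (_ : (fun k => _) = (fun k => \int[P]_w (\1_[set w | e%:E <= Y k w]%E w)%:E)%E); last first.
  apply/funext => k; rewrite integral_indic// setIT; exact: measurable_mu_extE.
have [] := @dominated_convergence _ _ _ P setT measurableT
  (fun k w => (\1_[set w | e%:E <= Y k w]%E w)%:E) (cst 0%E) (cst 1%E) => //.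
- by move=> k; apply/measurable_EFinP; exact: measurable_indic.
- apply: aeW => w _; apply: cvg_near_cst.
  have /cvge0P := cY w; move=> /(_ (fun n => Y0 n w)) /(_ (e / 2)).
  rewrite divr_gt0// => /(_ isT); apply: filterS => k Yk.
  rewrite indicE memNset//= => eY.
  by have := le_trans eY Yk; rewrite lee_fin; apply/negP; rewrite -ltNge; lra.
- by apply: finite_measure_integrable_cst.
- by apply: aeW => w k _ /=; rewrite lee_fin ger0_norm// indicE; case: (_ \in _).
by move=> _ _; rewrite integral0.
Qed.

Variables (F : R -> set_system T) (W : R -> T -> R).
Hypotheses (hF : filtration F) (hW : brownian_motion P F W).

Implicit Types L : seq (@block R d T).

Lemma block_sum_cat L1 L2 w : block_sum W (L1 ++ L2) w = block_sum W L1 w + block_sum W L2 w.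
Proof. by rewrite /block_sum big_cat. Qed.

Lemma block_val_cat L1 L2 u w : block_val (L1 ++ L2) u w = block_val L1 u w + block_val L2 u w.
Proof. by rewrite /block_val big_cat. Qed.

Definition opp_blocks L := [seq (x.1, fun w => - x.2 w) | x <- L] : seq (@block R d T).

Lemma block_sum_opp L w : block_sum W (opp_blocks L) w = - block_sum W L w.
Proof. by rewrite /block_sum big_map -sumrN; apply: eq_bigr => x _; rewrite mulNr. Qed.

Lemma block_val_opp L u w : block_val (opp_blocks L) u w = - block_val L u w.
Proof. by rewrite /block_val big_map -sumrN; apply: eq_bigr => x _; rewrite mulNr. Qed.

Lemma opp_blocks_adapted t L : all_prop (block_adapted F t) L ->
  all_prop (block_adapted F t) (opp_blocks L).
Proof.
elim: L => //= x L IH [[a0 ab bt Fx] /IH aL]; split => //; split => //=.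
have sF : sigma_algebra setT (F x.1.1) by case: hF => + _ _; exact.
by apply/(sub_measurableP _ sF); apply: measurable_funN; apply/(sub_measurableP _ sF).
Qed.

Lemma block_adaptedS s t L : s <= t -> all_prop (block_adapted F s) L ->
  all_prop (block_adapted F t) L.
Proof.
move=> st; apply: all_prop_imply => x [a0 ab bs Fx]; split => //; exact: le_trans st.
Qed.

Definition simple_blocks t (K : simple_process F t) : seq (@block R d T) :=
  mkseq (fun i => (part_pt 0 (sp_part K) i, part_pt 0 (sp_part K) i.+1, sp_coef K i))
    (size (sp_part K)).

Lemma simple_blocks_sum t (K : simple_process F t) w :
  block_sum W (simple_blocks K) w = simple_integral K W w.
Proof. by rewrite /block_sum /simple_integral big_map /index_iota subn0. Qed.

Lemma simple_blocks_val t (K : simple_process F t) u w :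
  block_val (simple_blocks K) u w = simple_val K u w.
Proof. by rewrite /block_val /simple_val big_map /index_iota subn0. Qed.

Lemma simple_blocks_adapted t (K : simple_process F t) :
  all_prop (block_adapted F t) (simple_blocks K).
Proof.
apply: all_prop_mkseq => i i_n.
have pK := sp_partP K.
have i_n' : (i < (size (sp_part K)).+1)%N by exact: ltnW.
split => /=.
- by rewrite /part_pt (set_nth_default t)//; exact: itv_partition_nth_ge.
- have [+ _] := pK; rewrite /part_pt => /(pathP 0)/(_ i i_n)/ltW.
  by [].
- by rewrite /part_pt (set_nth_default t)//; exact: itv_partition_nth_le.
- exact: sp_adapted.
Qed.

(** Allows a simple process over [0, s] to be compared, on the whole of [0, t], with one over
    [0, t]. *)
Lemma simple_val_eq0 t (K : simple_process F t) u w : t < u -> simple_val K u w = 0.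
Proof.
move=> tu; rewrite -simple_blocks_val /block_val.
have := simple_blocks_adapted K; elim: (simple_blocks K) => [|x L IH]; first by rewrite big_nil.
move=> /= [[_ _ bt _] /IH {}IH]; rewrite big_cons IH addr0 indicE memNset ?mulr0//=.
by rewrite in_itv/= => /andP[_ /le_trans/(_ bt)]; rewrite leNgt tu.
Qed.

(** Kept as blocks and not as a [simple_process], whose coefficients would have to be bounded. *)
Definition grid_blocks (H : R -> T -> R) s t m : seq (@block R d T) :=
  mkseq (fun i => (gpt s t m i, gpt s t m i.+1, H (gpt s t m i))) m.+1.

Lemma grid_blocks_sum (H : R -> T -> R) s t m w :
  block_sum W (grid_blocks H s t m) w =
  step_sum W (gpt s t m) (fun i => H (gpt s t m i)) m.+1 w.
Proof.
rewrite /block_sum big_map /step_sum -(big_mkord xpredT (fun i => H (gpt s t m i) w *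
  (W (gpt s t m i.+1) w - W (gpt s t m i) w))).
by rewrite /index_iota subn0.
Qed.

Lemma grid_blocks_val (H : R -> T -> R) s t m u w :
  block_val (grid_blocks H s t m) u w = step_fun (H ^~ w) s t m u.
Proof.
rewrite /block_val big_map /step_fun -(big_mkord xpredT (fun i => H (gpt s t m i) w *
  \1_(`]gpt s t m i, gpt s t m i.+1]%classic) u)).
by rewrite /index_iota subn0.
Qed.

Lemma grid_blocks_adapted (H : R -> T -> R) s t m : adapted F H -> 0 <= s -> s < t ->
  all_prop (block_adapted F t) (grid_blocks H s t m).
Proof.
move=> aH s0 st; apply: all_prop_mkseq => i im.
have /andP[sa _] := @gpt_itv _ s t m i (ltW st) (ltnW im).
have /andP[_ bt] := @gpt_itv _ s t m i.+1 (ltW st) im.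
split => //=; first exact: le_trans sa.
- by rewrite ltW// gpt_lt.
- by apply: aH; exact: le_trans sa.
Qed.

End ito_approximation.

Lemma sqr_add_le {R : realType} (x y : R) : (x - y) ^+ 2 <= 2 * x ^+ 2 + 2 * y ^+ 2.
Proof. by have := sqr_ge0 (x + y); nra. Qed.

(** Prepares the exponential term of [block_tail] with dl = lam^-2, for which lam^2 dl / 2 is the
    constant 1 / 2. The witness makes the exponent equal to - 2 / eta, and exp(- y) <= 1 / y
    concludes. *)
Lemma exists_small_expR {R : realType} (e eta : R) : 0 < e -> 0 < eta ->
  exists2 lam, 0 < lam & 2 * expR (- lam * e + 1 / 2) <= eta.
Proof.
move=> e0 eta0; exists ((1 / 2 + 2 / eta) / e); first by rewrite divr_gt0// addr_gt0 ?divr_gt0.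
rewrite mulNr divfK ?gt_eqF// opprD addrC addrA subrr sub0r expRN.
have y0 : 0 < 2 / eta by rewrite divr_gt0.
rewrite ler_pdivrMr ?expR_gt0// -ler_pdivrMl//.
by rewrite mulrC (le_trans _ (expR_ge1Dx _))// lerDr.
Qed.

(** * Ito integrals as limits of grid sums *)

Section ito_grid.
Context {R : realType} {d : measure_display} {T : measurableType d}.
Variable P : probability T R.
Local Notation mu := (@lebesgue_measure R).
Variables (F : R -> set_system T) (W : R -> T -> R).
Hypotheses (hF : filtration F) (hW : brownian_motion P F W).

Lemma measurable_step_L2 (X : R -> T -> R) s t m : s < t ->
  (forall w, continuous (X ^~ w)) -> (forall s, measurable_fun setT (X s)) ->
  measurable_fun setT (fun w =>
    \int[mu]_(u in `]s, t]) ((step_fun (X ^~ w) s t m u - X u w) ^+ 2)%:E)%E.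
Proof.
move=> st cX mX.
pose f (z : measurableTypeR R * T) : \bar R :=
  (((step_fun (X ^~ z.2) s t m z.1 - X z.1 z.2 * \1_(`]s, t]%classic) z.1) ^+ 2)
   * \1_(`]s, t]%classic) z.1)%:E.
have m1 : measurable_fun setT (fun z : measurableTypeR R * T => \1_(`]s, t]%classic) z.1 : R).
  by apply: measurableT_comp measurable_fst; exact: measurable_indic.
have mf : measurable_fun setT f.
  apply/measurable_EFinP; apply: measurable_funM => //.
  apply: measurable_funX; apply: measurable_funB; last exact: measurable_process.
  apply: measurable_sum => i; apply: measurable_funM.
    exact: measurableT_comp (mX _) measurable_snd.
  by apply: measurableT_comp measurable_fst; exact: measurable_indic.
have f0 z : (0 <= f z)%E by rewrite lee_fin mulr_ge0 ?sqr_ge0.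
have := @measurable_fun_fubini_tonelli_G _ _ _ _ _ mu f mf f0.
apply: eq_measurable_fun => w _; rewrite /fubini_G /f/=.
rewrite -(@integral_mul_indic _ _ _ mu `]s, t]%classic); apply: eq_integral => u _.
rewrite -EFinM; congr EFin; rewrite indicE.
by case: (_ \in _); rewrite ?mulr1// !mulr0.
Qed.

(** All three functions approximate X: [f] on [0, t], [g] on [0, s] and [h] on ]s, t]. On each piece
    only two of them are present and X is inserted between them, at the cost of a factor 2. *)
Lemma integral_block_diff (f g h X : R -> R) s t : 0 <= s -> s < t ->
  measurable_fun setT f -> measurable_fun setT g -> measurable_fun setT h ->
  measurable_fun setT X -> (forall u, u <= s -> h u = 0) -> (forall u, s < u -> g u = 0) ->
  (\int[mu]_(u in `[0%R, t]) ((f u - g u - h u) ^+ 2)%:E <=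
   2%:E * \int[mu]_(u in `[0%R, t]) ((f u - X u) ^+ 2)%:E +
   2%:E * \int[mu]_(u in `[0%R, s]) ((g u - X u) ^+ 2)%:E +
   2%:E * \int[mu]_(u in `]s, t]) ((h u - X u) ^+ 2)%:E)%E.
Proof.
move=> s0 st mf mg mh mX h0 g0.
have U : `[0, t]%classic = `[0, s]%classic `|` `]s, t]%classic.
  apply/seteqP; split => u /=; rewrite !in_itv/=.
    by move=> /andP[u0 ut]; case: (leP u s) => us; [left; rewrite u0|right].
  by case=> /andP[u0 us]; [rewrite u0 (le_trans us (ltW st))|rewrite us (le_trans s0 (ltW u0))].
have D : [disjoint `[0, s]%classic & `]s, t]%classic].
  rewrite disj_set2E; apply/eqP/seteqP; split => // u [] /=; rewrite !in_itv/=.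
  by move=> /andP[_ us] /andP[su _]; move: us; rewrite leNgt su.
have mS (k : R -> R) (A : set R) : measurable_fun setT k ->
    measurable_fun A (fun u => (k u ^+ 2)%:E).
  by move=> mk; apply: measurable_funTS; apply/measurable_EFinP; exact: measurable_funX.
have mfX := measurable_funB mf mX; have mgX := measurable_funB mg mX.
have mhX := measurable_funB mh mX.
have mv := measurable_funB (measurable_funB mf mg) mh.
rewrite U ge0_integral_setU//; first last.
- by move=> u _; rewrite lee_fin sqr_ge0.
- exact: (mS (fun u => f u - g u - h u)).
rewrite ge0_integral_setU//; first last.
- by move=> u _; rewrite lee_fin sqr_ge0.
- exact: (mS (fun u => f u - X u)).
have H4 (x1 x2 x3 x4 : \bar R) : (0 <= x1 -> 0 <= x3 ->
    2%:E * x1 + 2%:E * x2 + (2%:E * x3 + 2%:E * x4) <=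
    2%:E * (x1 + x3) + 2%:E * x2 + 2%:E * x4)%E.
  by move=> x10 x30; rewrite ge0_muleDr// addeACA addeA.
have key (a b c : R -> R) (A : set R) : measurable A ->
    measurable_fun setT a -> measurable_fun setT b -> measurable_fun setT c ->
    (forall u, A u -> a u = b u - c u) ->
    (\int[mu]_(u in A) (a u ^+ 2)%:E <=
     2%:E * \int[mu]_(u in A) (b u ^+ 2)%:E + 2%:E * \int[mu]_(u in A) (c u ^+ 2)%:E)%E.
  move=> mA ma mb mc abc.
  rewrite -!ge0_integralZl_EFin//; try (by move=> u _; rewrite lee_fin sqr_ge0); try exact: mS.
  rewrite -ge0_integralD//; try (by move=> u _; rewrite -EFinM lee_fin mulr_ge0 ?sqr_ge0);
    try (by apply: measurable_funeM; exact: mS).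
  apply: ge0_le_integral => //.
  - by move=> u _; rewrite lee_fin sqr_ge0.
  - exact: mS.
  - by apply: emeasurable_funD; apply: measurable_funeM; exact: mS.
  - by move=> u Au; rewrite -!EFinM -EFinD lee_fin abc// sqr_add_le.
apply: le_trans (leeD (key _ (fun u => f u - X u) (fun u => g u - X u) _ _ mv mfX mgX _)
                      (key _ (fun u => f u - X u) (fun u => h u - X u) _ _ mv mfX mhX _)) _ => //.
- by move=> u /=; rewrite in_itv/= => /andP[_ us]; rewrite h0//; ring.
- by move=> u /=; rewrite in_itv/= => /andP[su _]; rewrite g0//; ring.
by apply: H4; apply: integral_ge0 => u _; rewrite lee_fin sqr_ge0.
Qed.

Lemma outer_measureU3 (A B C : set T) (a b c : \bar R) :
  (P^*%mu A <= a -> P^*%mu B <= b -> P^*%mu C <= c ->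
   P^*%mu (A `|` B `|` C) <= a + b + c)%E.
Proof.
move=> Aa Bb Cc; apply: le_trans (outer_measureU2 _ _ _) _; apply: leeD => //.
by apply: le_trans (outer_measureU2 _ _ _) _; apply: leeD.
Qed.

(** The simple approximations of the integrals up to t and s, and the grid sum over [s, t], combine
    into one list of blocks [D]. Its integrand is small in mean square in probability, so
    [block_tail] makes its integral small in probability: any admissible approximation is as good as
    the grid. *)
Lemma ito_grid_approx (H Hc : R -> T -> R) s t (It Is Z : T -> R) :
  adapted F H -> (forall w, continuous (Hc ^~ w)) -> (forall u, measurable_fun setT (Hc u)) ->
  {ae P, forall w, forall u, 0 <= u -> Hc u w = H u w} ->
  0 <= s -> s < t -> ito_integral P F W H t It -> ito_integral P F W H s Is ->
  {ae P, forall w, Z w = It w - Is w} ->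
  cvg0_in_probability P (fun m w => (`|block_sum W (grid_blocks H s t m) w - Z w|)%:E).
Proof.
move=> aH cH mH HcH s0 st [Kt [KtH KtI]] [Ks [KsH KsI]] ZE e e0.
have t0 : 0 <= t by rewrite (le_trans s0)// ltW.
apply/cvge0P => [n|eta eta0]; first exact: outer_measure_ge0.
(* Three differences share [e]. Six terms share [eta]: four for the simple approximations (integrand
   and integral, at t and at s), one for the grid, one for the exponential of [block_tail]. *)
have e3 : 0 < e / 3 by rewrite divr_gt0.
have eta6 : 0 < eta / 6 by rewrite divr_gt0.
have [lam lam0 lamE] := exists_small_expR e3 eta6.
pose dl := lam ^- 2.
have dl0 : 0 < dl by rewrite invr_gt0 exprn_gt0.
(* Three errors, each carrying a factor 2 in [integral_block_diff]: if their total reaches [dl], one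
   of them reaches dl / 6. *)
have dl6 : 0 < dl / 6 by rewrite divr_gt0.
have key (x y z : \bar R) : (0 <= x -> 0 <= y -> 0 <= z ->
    dl%:E <= 2%:E * x + 2%:E * y + 2%:E * z ->
    (dl / 6)%:E <= x \/ (dl / 6)%:E <= y \/ (dl / 6)%:E <= z)%E.
  move=> x0 y0 z0 dle.
  case: (leP (dl / 6)%:E x) => [xd|xd]; first by left.
  case: (leP (dl / 6)%:E y) => [yd|yd]; first by right; left.
  case: (leP (dl / 6)%:E z) => [zd|zd]; first by right; right.
  exfalso; move: x y z x0 y0 z0 xd yd zd dle => [x| |] [y| |] [z| |]//.
  by rewrite -!EFinM -!EFinD !lee_fin !lte_fin; lra.
have nrm := fun (Y : nat -> T -> \bar R) (h : cvg0_in_probability P Y) c (c0 : 0 < c) =>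
  (cvge0P (fun n => outer_measure_ge0 _ _)).1 (h c c0) _ eta6.
pose B m w := (\int[mu]_(u in `]s, t]) ((step_fun (Hc ^~ w) s t m u - Hc u w) ^+ 2)%:E)%E.
have B0 : cvg0_in_probability P B.
  apply: cvg_in_probability => [m|m w|w].
  - exact: measurable_step_L2.
  - by apply: integral_ge0 => u _; rewrite lee_fin sqr_ge0.
  - exact: step_fun_cvg_L2.
(* The index [k] of the simple approximations is fixed here; from now on only the grid parameter m
   varies. *)
have [k [k1 k2 k3 k4]] : exists k, [/\
    (P^*%mu [set w | (dl / 6)%:E <= \int[mu]_(u in `[0%R, t]) ((simple_val (Kt k) u w - H u w) ^+ 2)%:E]%E <= (eta / 6)%:E)%E,
    (P^*%mu [set w | (dl / 6)%:E <= \int[mu]_(u in `[0%R, s]) ((simple_val (Ks k) u w - H u w) ^+ 2)%:E]%E <= (eta / 6)%:E)%E,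
    (P^*%mu [set w | (e / 3)%:E <= (`|simple_integral (Kt k) W w - It w|)%:E]%E <= (eta / 6)%:E)%E &
    (P^*%mu [set w | (e / 3)%:E <= (`|simple_integral (Ks k) W w - Is w|)%:E]%E <= (eta / 6)%:E)%E].
  have [N1 _ h1] := nrm _ KtH _ dl6.
  have [N2 _ h2] := nrm _ KsH _ dl6.
  have [N3 _ h3] := nrm _ KtI _ e3.
  have [N4 _ h4] := nrm _ KsI _ e3.
  exists (maxn (maxn N1 N2) (maxn N3 N4)); split; [apply: h1|apply: h2|apply: h3|apply: h4];
    by rewrite /= !leq_max leqnn ?orbT.
have := nrm _ B0 _ dl6; apply: filterS => m Bm.
pose D := simple_blocks (Kt k) ++ opp_blocks (simple_blocks (Ks k)) ++ opp_blocks (grid_blocks H s t m).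
have aD : all_prop (block_adapted F t) D.
  apply: all_prop_cat; first exact: simple_blocks_adapted.
  apply: all_prop_cat; apply: opp_blocks_adapted => //.
    by apply: (block_adaptedS (ltW st)); exact: simple_blocks_adapted.
  exact: grid_blocks_adapted.
have DE w : block_sum W D w =
    simple_integral (Kt k) W w - simple_integral (Ks k) W w - block_sum W (grid_blocks H s t m) w.
  by rewrite /D !block_sum_cat !block_sum_opp !simple_blocks_sum addrA.
have DV w u : block_val D u w =
    simple_val (Kt k) u w - simple_val (Ks k) u w - step_fun (H ^~ w) s t m u.
  by rewrite /D !block_val_cat !block_val_opp !simple_blocks_val grid_blocks_val addrA.
have BD : (P^*%mu [set w | (e / 3 <= `|block_sum W D w|)%R] <=
    (eta / 6)%:E + ((eta / 6)%:E + (eta / 6)%:E + (eta / 6)%:E))%E.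
  apply: le_trans (block_tail hF hW (e / 3) dl t0 aD (ltW lam0)) _.
  apply: leeD.
    rewrite lee_fin; apply: le_trans lamE.
    by rewrite /dl divff ?expf_neq0 ?gt_eqF.
  apply: le_trans (outer_measureU3 k1 k2 Bm).
  apply: outer_ae_le; apply: filterS HcH => w HcHw /= dlD.
  have stepE u : step_fun (H ^~ w) s t m u = step_fun (Hc ^~ w) s t m u.
    apply: eq_bigr => i _; rewrite HcHw//.
    have /andP[+ _] := @gpt_itv _ s t m i (ltW st) (ltnW (ltn_ord i)).
    exact: le_trans.
  have msimple r (K : simple_process F r) : measurable_fun setT (simple_val K ^~ w).
    rewrite (_ : _ ^~ _ = block_val (simple_blocks K) ^~ w); first exact: measurable_block_val.
    by apply/funext => u; rewrite simple_blocks_val.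
  have simpleE r (K : simple_process F r) :
      (\int[mu]_(u in `[0%R, r]) ((simple_val K u w - H u w) ^+ 2)%:E =
       \int[mu]_(u in `[0%R, r]) ((simple_val K u w - Hc u w) ^+ 2)%:E)%E.
    by apply: eq_integral => u; rewrite inE/= in_itv/= => /andP[u0 _]; rewrite HcHw.
  have := @integral_block_diff (simple_val (Kt k) ^~ w) (simple_val (Ks k) ^~ w)
    (step_fun (Hc ^~ w) s t m) (Hc ^~ w) s t s0 st (msimple _ _) (msimple _ _)
    (measurable_step_fun (Hc ^~ w) s t m) (continuous_measurable_fun (cH w))
    (fun u us => step_fun0 (Hc ^~ w) m st us) (fun u su => simple_val_eq0 _ _ su).
  rewrite -!simpleE -/(B m w) => dle.
  have {dle} : (dl%:E <= 2%:E * \int[mu]_(u in `[0%R, t]) ((simple_val (Kt k) u w - H u w) ^+ 2)%:E +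
      2%:E * \int[mu]_(u in `[0%R, s]) ((simple_val (Ks k) u w - H u w) ^+ 2)%:E +
      2%:E * B m w)%E.
    apply: le_trans dle; apply: (le_trans dlD); rewrite le_eqVlt; apply/orP; left.
    by apply/eqP; apply: eq_integral => u _; rewrite DV stepE.
  have ge0 (A : set R) (k' : R -> R) : (0 <= \int[mu]_(u in A) ((k' u) ^+ 2)%:E)%E.
    by apply: integral_ge0 => u _; rewrite lee_fin sqr_ge0.
  move=> dle2; have := key _ _ _ _ _ _ dle2; case.
  - exact: (ge0 `[0, t]%classic (fun u => simple_val (Kt k) u w - H u w)).
  - exact: (ge0 `[0, s]%classic (fun u => simple_val (Ks k) u w - H u w)).
  - exact: (ge0 `]s, t]%classic (fun u => step_fun (Hc ^~ w) s t m u - Hc u w)).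
  - by left; left.
  by case=> [yd|zd]; [left; right|right].
apply: (@le_trans _ _ ((eta / 6)%:E + (eta / 6)%:E +
    ((eta / 6)%:E + ((eta / 6)%:E + (eta / 6)%:E + (eta / 6)%:E)))%E).
  apply: le_trans (outer_measureU3 k3 k4 BD).
  apply: outer_ae_le; apply: filterS ZE => w ZEw /=.
  rewrite !lee_fin ZEw => eG.
  case: (leP (e / 3) `|simple_integral (Kt k) W w - It w|) => h1; first by left; left.
  case: (leP (e / 3) `|simple_integral (Ks k) W w - Is w|) => h2; first by left; right.
  right; rewrite DE; move: eG h1 h2.
  set x := simple_integral _ _ _; set y := simple_integral _ _ _; set g := block_sum _ _ _.
  move=> eG h1 h2.
  have E : g - (It w - Is w) = (x - It w) - (y - Is w) - (x - y - g) by ring.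
  have := ler_normB ((x - It w) - (y - Is w)) (x - y - g); rewrite -E => n1.
  have n2 := ler_normB (x - It w) (y - Is w).
  lra.
by rewrite -!EFinD lee_fin; lra.
Qed.

End ito_grid.

(** The fourth power of y / 4 <= exp(y / 4), whence 256 = 4^4. *)
Lemma pow4_le_expR {R : realType} (x : R) : x ^+ 4 <= 256 * (expR x + expR (- x)).
Proof.
have key (y : R) : 0 <= y -> y ^+ 4 <= 256 * expR y.
  move=> y0; have -> : expR y = expR (y / 4) ^+ 4 by rewrite -expRM_natr divfK.
  have y4 : 0 <= y / 4 by rewrite divr_ge0.
  have : (y / 4) ^+ 4 <= expR (y / 4) ^+ 4.
    by rewrite lerXn2r ?nnegrE ?expR_ge0// (le_trans _ (expR_ge1Dx _))// lerDr.
  rewrite expr_div_n ler_pdivrMr// mulrC => /le_trans; apply.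
  by rewrite ler_wpM2r ?exprn_ge0 ?expR_ge0// -natrX ler_nat.
have [x0|x0] := leP 0 x.
  by apply: le_trans (key _ x0) _; rewrite ler_pM2l// lerDl expR_ge0.
have -> : x ^+ 4 = (- x) ^+ 4 by ring.
have Nx0 : 0 <= - x by rewrite oppr_ge0 ltW.
by apply: le_trans (key _ Nx0) _; rewrite ler_pM2l// lerDr expR_ge0.
Qed.

(** Jensen's inequality, by averaging the tangent line of exp at the mean, below the graph by exp x
    >= 1 + x. *)
Lemma expR_mean_le {R : realType} n (y : nat -> R) :
  expR ((\sum_(i < n.+1) y i) / n.+1%:R) <= (\sum_(i < n.+1) expR (y i)) / n.+1%:R.
Proof.
set mu := _ / _; rewrite ler_pdivlMr// mulrC.
have -> : n.+1%:R * expR mu = \sum_(i < n.+1) expR mu * (1 + (y i - mu)).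
  rewrite -mulr_sumr big_split/= sumrB !sumr_const card_ord -(mulr_natl mu) /mu.
  by rewrite [n.+1%:R * (_ / _)]mulrC divfK ?pnatr_eq0// subrr addr0 mulrC.
apply: ler_sum => i _; rewrite -{2}(subrK mu (y i)) expRD mulrC.
by rewrite ler_wpM2r ?expR_ge0// expR_ge1Dx.
Qed.

(** * Exponential inequality, mean and isometry for the Ito integral *)

Section ito_moments.
Context {R : realType} {d : measure_display} {T : measurableType d}.
Variable P : probability T R.
Local Notation mu := (@lebesgue_measure R).

Lemma ge0_integrable_bound (f : T -> R) (C : R) : measurable_fun setT f ->
  (forall w, 0 <= f w) -> (\int[P]_w (f w)%:E <= C%:E)%E ->
  P.-integrable setT (EFin \o f).
Proof.
move=> mf f0 fC; apply/integrableP; split; first exact/measurable_EFinP.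
under eq_integral do rewrite /= ger0_norm//.
by rewrite (le_lt_trans fC)// ltry.
Qed.

Lemma EFin_Rintegral (f : T -> R) : P.-integrable setT (EFin \o f) ->
  (\int[P]_w (f w)%:E)%E = (\int[P]_w f w)%:E.
Proof. by move=> fi; rewrite /Rintegral fineK//; exact: integral_fune_fin_num fi. Qed.

Variables (F : R -> set_system T) (W : R -> T -> R).
Hypotheses (hF : filtration F) (hW : brownian_motion P F W).
Variables (H Hc : R -> T -> R).
Hypotheses (aH : adapted F H) (cH : forall w, continuous (Hc ^~ w))
  (mH : forall u, measurable_fun setT (Hc u))
  (HcH : {ae P, forall w, forall u, 0 <= u -> Hc u w = H u w}).
Variables (s t : R) (It Is Z : T -> R).
Hypotheses (s0 : 0 <= s) (st : s < t) (hIt : ito_integral P F W H t It)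
  (hIs : ito_integral P F W H s Is) (mZ : measurable_fun setT Z)
  (ZE : {ae P, forall w, Z w = It w - Is w}).

Let X m := step_sum W (gpt s t m) (fun i => H (gpt s t m i)) m.+1.
Let Q m := step_var (gpt s t m) (fun i => H (gpt s t m i)) m.+1.
Let q w := \int[mu]_(u in `[s, t]) (Hc u w ^+ 2).

Let gpt_ge0 m i : (i <= m.+1)%N -> 0 <= gpt s t m i.
Proof. by move=> im; have /andP[+ _] := @gpt_itv _ s t m i (ltW st) im; exact: le_trans. Qed.

Let gp0 m : 0 <= gpt s t m 0. Proof. exact: gpt_ge0. Qed.

Let glt m i : (i < m.+1)%N -> gpt s t m i < gpt s t m i.+1.
Proof. by move=> _; exact: gpt_lt. Qed.

Let gH m i : (i < m.+1)%N -> sub_measurable (F (gpt s t m i)) (H (gpt s t m i)).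
Proof. by move=> im; apply: aH; apply: gpt_ge0; exact: ltnW. Qed.

Let mX m : measurable_fun setT (X m).
Proof. by have [] := measurable_step_sum hF hW (gp0 m) (@glt m) (@gH m). Qed.

Let mQ m : measurable_fun setT (Q m).
Proof. by have [] := measurable_step_sum hF hW (gp0 m) (@glt m) (@gH m). Qed.

Let mq : measurable_fun setT q.
Proof.
apply: (@measurable_Rintegral_process _ _ _ (fun u w => Hc u w ^+ 2)).
- move=> w u; apply: (@continuous_comp _ _ _ (Hc ^~ w) (fun x => x ^+ 2)); first exact: cH.
  exact: exprn_continuous.
- by move=> u; exact: measurable_funX.
- exact: ltW.
Qed.

Let QE m w : Q m w = (t - s) / m.+1%:R * \sum_(i < m.+1) H (gpt s t m i) w ^+ 2.
Proof. by rewrite /Q /step_var mulr_sumr; apply: eq_bigr => i _; rewrite gptB mulrC. Qed.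

(** Only the sums [X] require a subsequence. Their quadratic parts [Q] are Riemann sums of a
    continuous path and converge along the whole sequence, hence along [phi]. *)
Let cvg_subseq : exists phi : nat -> nat,
  {ae P, forall w, (X (phi k) w @[k --> \oo] --> Z w) /\ (Q (phi k) w @[k --> \oo] --> q w)}.
Proof.
have XZ : cvg0_in_probability P (fun m w => (`|X m w - Z w|)%:E).
  have := ito_grid_approx hF hW aH cH mH HcH s0 st hIt hIs ZE.
  by under eq_fun do under eq_fun do rewrite grid_blocks_sum.
have [phi [phik XphiZ]] := cvg_in_probability_seq mX mZ XZ.
exists phi; apply: filterS2 XphiZ HcH => w Xw HcHw; split => //.
have phioo : phi @ \oo --> \oo.
  move=> A [N _ NA]; exists N => // k /= Nk; apply: NA => /=.
  exact: leq_trans Nk (phik k).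
apply: (@cvg_comp _ _ _ phi (Q ^~ w) _ _ _ phioo).
have := @riemann_sum_cvg _ (fun u => Hc u w ^+ 2) s t st.
rewrite (_ : (fun m => _) = Q ^~ w); last first.
  apply/funext => m; rewrite QE; congr (_ * _); apply: eq_bigr => i _.
  by rewrite HcHw// gpt_ge0// ltnW.
apply=> u; apply: (@continuous_comp _ _ _ (Hc ^~ w) (fun x => x ^+ 2)); first exact: cH.
exact: exprn_continuous.
Qed.

Lemma ito_expR lam :
  (\int[P]_w (expR (lam * Z w - lam ^+ 2 * q w / 2))%:E <= 1)%E.
Proof.
have [phi cphi] := cvg_subseq.
apply: (@fatou_bound _ _ _ P (fun k w => expR (lam * X (phi k) w - lam ^+ 2 * Q (phi k) w / 2))).
- move=> k; apply: measurableT_comp => //; apply: measurable_funB; first exact: measurable_funM.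
  by apply: measurable_funM => //; exact: measurable_funM.
- apply: measurableT_comp => //; apply: measurable_funB; first exact: measurable_funM.
  by apply: measurable_funM => //; exact: measurable_funM.
- by move=> k w; exact: expR_ge0.
- apply: filterS cphi => w [cX cQ].
  apply: (@cvg_comp _ _ _ (fun k => lam * X (phi k) w - lam ^+ 2 * Q (phi k) w / 2) expR).
    exact: (cvgB (cvgM (cvg_cst _) cX) (cvgM (cvgM (cvg_cst _) cQ) (cvg_cst _))).
  exact: continuous_expR.
- by move=> k; rewrite (integral_expR_scale_step hF hW lam (gp0 _) (@glt _) (@gH _)).
Qed.

(* exp x >= 1 + x turns ito_expR into lam E Z <= lam^2 / 2 E q; let lam tend to 0
   from both sides. *)
Lemma ito_mean0 : P.-integrable setT (EFin \o Z) -> P.-integrable setT (EFin \o q) ->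
  \int[P]_w Z w = 0.
Proof.
move=> iZ iq; set z := \int[P]_w Z w; set c := \int[P]_w q w.
have c0 : 0 <= c.
  apply: Rintegral_ge0 => w _; apply: Rintegral_ge0 => u _; exact: sqr_ge0.
have key lam : lam * z <= lam ^+ 2 / 2 * c.
  pose f w := lam * Z w - lam ^+ 2 * q w / 2.
  have mf : measurable_fun setT f.
    apply: measurable_funB; first exact: measurable_funM.
    by apply: measurable_funM => //; exact: measurable_funM.
  have ie : P.-integrable setT (EFin \o (expR \o f)).
    apply: (@ge0_integrable_bound _ 1); first exact: measurableT_comp.
    - by move=> w; exact: expR_ge0.
    - exact: ito_expR.
  have i1 : P.-integrable setT (EFin \o (fun w => lam * Z w)).
    exact: (integrableZl measurableT lam iZ).
  have i2 : P.-integrable setT (EFin \o (fun w => lam ^+ 2 / 2 * q w)).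
    exact: (integrableZl measurableT _ iq).
  have i3 : P.-integrable setT (EFin \o (fun w => lam * Z w - lam ^+ 2 / 2 * q w)).
    exact: (integrableB measurableT i1 i2).
  have i0 : P.-integrable setT (EFin \o cst (1 : R)) by exact: finite_measure_integrable_cst.
  have i4 : P.-integrable setT (EFin \o (fun w => 1 + (lam * Z w - lam ^+ 2 / 2 * q w))).
    exact: (integrableD measurableT i0 i3).
  have : \int[P]_w (1 + (lam * Z w - lam ^+ 2 / 2 * q w)) <= 1.
    apply: (@le_trans _ _ (\int[P]_w expR (f w))).
      apply: le_Rintegral => // w _; rewrite (_ : lam * Z w - _ = f w) ?expR_ge1Dx//.
      by rewrite /f; ring.
    by rewrite -lee_fin -EFin_Rintegral//; exact: ito_expR.
  rewrite RintegralD// RintegralB// !RintegralZl// Rintegral_cst//= probability_setT/= mulr1.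
  by rewrite -/z -/c; lra.
(* The choice lam = z / (c + 1) does the work of the limit: [key] becomes z^2 / (c + 1) <= z^2 c /
   (2 (c + 1)^2), which forces z = 0. Adding 1 keeps the denominator positive when c = 0. *)
have := key (z / (c + 1)); rewrite expr_div_n.
have c1 : 0 < c + 1 by lra.
have [->//|z0] := eqVneq z 0.
have z2 : 0 < z ^+ 2 by rewrite exprn_even_gt0.
rewrite [leLHS](_ : _ = z ^+ 2 / (c + 1) ^+ 2 * (c + 1)); last by field; rewrite gt_eqF.
have : 0 < z ^+ 2 / (c + 1) ^+ 2 by rewrite divr_gt0// exprn_gt0.
move: (z ^+ 2 / _) => A A0 h; exfalso.
by have := mulr_ge0 (ltW A0) c0; nra.
Qed.

Variables (v a C : R).
Hypotheses (a0 : 0 < a)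
  (Hv : forall u, s <= u <= t -> (\int[P]_w (H u w ^+ 2)%:E = v%:E)%E)
  (HC : forall u, s <= u <= t -> (\int[P]_w (expR (a * H u w ^+ 2))%:E <= C%:E)%E).

Let mHu u : s <= u <= t -> measurable_fun setT (H u).
Proof.
move=> /andP[su _]; have u0 := le_trans s0 su.
by apply: (filtration_measurable hF u0); exact: aH.
Qed.

Let sqr_grid m : (\int[P]_w (X m w ^+ 2)%:E = (v * (t - s))%:E)%E.
Proof.
rewrite (integral_sqr_step hF hW (gp0 m) (@glt m) (@gH m)).
under eq_bigr => i _.
  rewrite gptB Hv; last by apply: gpt_itv; [exact: ltW|exact: ltnW].
  over.
rewrite -EFinM sumEFin sumr_const card_ord; congr EFin.
have : m.+1%:R != 0 :> R by rewrite pnatr_eq0.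
by rewrite -[LHS]mulr_natr; move: (m.+1%:R) => x x0; field.
Qed.

(** a Q / (t - s) is the average over the grid of the values a H^2, so Jensen bounds its exponential
    by the average of exponentials, each of mean at most C, uniformly in m. *)
Let exp_grid m : (\int[P]_w (expR (a / (t - s) * Q m w))%:E <= C%:E)%E.
Proof.
have ts : t - s != 0 by rewrite subr_eq0 gt_eqF.
pose g (i : 'I_m.+1) w := expR (a * H (gpt s t m i) w ^+ 2).
have gi (i : 'I_m.+1) : s <= gpt s t m i <= t.
  by apply: gpt_itv; [exact: ltW|exact: ltnW].
have mg i : measurable_fun setT (EFin \o g i).
  apply/measurable_EFinP; apply: measurableT_comp => //; apply: measurable_funM => //.
  by apply: measurable_funX; exact: mHu.
apply: (@le_trans _ _ (\int[P]_w (m.+1%:R^-1%:E * \sum_(i < m.+1) (EFin \o g i) w))%E).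
  apply: ge0_le_integral => //.
  - by apply/measurable_EFinP; apply: measurableT_comp => //; exact: measurable_funM.
  - by apply: measurable_funeM; exact: emeasurable_sum.
  - move=> w _; rewrite sumEFin -EFinM lee_fin [leRHS]mulrC.
    apply: le_trans (expR_mean_le _ (fun i => a * H (gpt s t m i) w ^+ 2)).
    rewrite ler_expR QE -mulr_sumr le_eqVlt; apply/orP; left; apply/eqP.
    have : m.+1%:R != 0 :> R by rewrite pnatr_eq0.
    by move: (m.+1%:R) (\sum_(_ < _) _) => x y x0; field; rewrite ts x0.
rewrite ge0_integralZl_EFin//; last 2 first.
- by move=> w _; apply: sume_ge0 => i _; rewrite lee_fin expR_ge0.
- exact: emeasurable_sum.
rewrite ge0_integral_sum//; last by move=> i w _; rewrite lee_fin expR_ge0.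
rewrite lee_pdivrMl//.
apply: (@le_trans _ _ (\sum_(i < m.+1) C%:E)%E); first by apply: lee_sum => i _; exact: HC.
by rewrite sumEFin sumr_const card_ord -EFinM mulr_natl.
Qed.

Lemma integral_ge0_scale (c : R) (f : T -> R) : 0 <= c -> measurable_fun setT f ->
  (forall w, 0 <= f w) -> (\int[P]_w (c * f w)%:E = c%:E * \int[P]_w (f w)%:E)%E.
Proof.
move=> c0 mf f0; under eq_integral do rewrite EFinM.
rewrite ge0_integralZl_EFin//; first by move=> w _; rewrite lee_fin.
exact/measurable_EFinP.
Qed.

Lemma integral_ge0_add (f g : T -> R) : measurable_fun setT f -> measurable_fun setT g ->
  (forall w, 0 <= f w) -> (forall w, 0 <= g w) ->
  (\int[P]_w (f w + g w)%:E = \int[P]_w (f w)%:E + \int[P]_w (g w)%:E)%E.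
Proof.
move=> mf mg f0 g0; under eq_integral do rewrite EFinD.
rewrite ge0_integralD//.
- by move=> w _; rewrite lee_fin.
- exact/measurable_EFinP.
- by move=> w _; rewrite lee_fin.
- exact/measurable_EFinP.
Qed.

(* lam is such that exp(lam X / 2) is, by AM-GM, at most
   (exp(lam X - lam^2 Q / 2) + exp(a / (t - s) Q)) / 2. *)
Let fourth_moment : exists K : R, forall m, (\int[P]_w (X m w ^+ 4)%:E <= K%:E)%E.
Proof.
pose lam := Num.sqrt (2 * (a / (t - s))).
have ats : 0 < a / (t - s) by rewrite divr_gt0// subr_gt0.
have lam0 : 0 < lam by rewrite sqrtr_gt0 mulr_gt0.
have lam2 : lam ^+ 2 / 2 = a / (t - s).
  rewrite sqr_sqrtr; last by rewrite mulr_ge0// ltW.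
  by move: (a / (t - s)) => x; lra.
(* 128 is the 256 of [pow4_le_expR] halved by AM-GM; 1 + 1 comes from the exponentials for lam and -
   lam, and 2 C from the term exp(a Q / (t - s)), which occurs with both signs. *)
exists ((2 / lam) ^+ 4 * 128 * (1 + 1 + 2 * C)) => m.
pose g l w := expR (l * X m w - l ^+ 2 * Q m w / 2).
pose g3 w := expR (a / (t - s) * Q m w).
have mg l : measurable_fun setT (g l).
  apply: measurableT_comp => //; apply: measurable_funB; first exact: measurable_funM.
  by apply: measurable_funM => //; exact: measurable_funM.
have mg3 : measurable_fun setT g3 by apply: measurableT_comp => //; exact: measurable_funM.
have Ig l : (\int[P]_w (g l w)%:E = 1)%E.
  exact: (integral_expR_scale_step hF hW l (gp0 _) (@glt _) (@gH _)).
have k0 : 0 <= (2 / lam) ^+ 4 * 128 by rewrite mulr_ge0 ?exprn_ge0 ?divr_ge0// ltW.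
apply: (@le_trans _ _ (\int[P]_w ((2 / lam) ^+ 4 * 128 * (g lam w + g (- lam) w + 2 * g3 w))%:E)%E).
  apply: ge0_le_integral => //.
  - by move=> w _; rewrite lee_fin -[4%N]/(2 * 2)%N exprM sqr_ge0.
  - by apply/measurable_EFinP; exact: measurable_funX.
  - apply/measurable_EFinP; apply: measurable_funM => //.
    apply: measurable_funD; last exact: measurable_funM.
    exact: measurable_funD.
  move=> w _; rewrite lee_fin.
  have -> : X m w ^+ 4 = (2 / lam) ^+ 4 * (lam * X m w / 2) ^+ 4.
    by field; rewrite gt_eqF.
  rewrite -[leRHS]mulrA ler_wpM2l ?exprn_ge0 ?divr_ge0 ?(ltW lam0)//.
  apply: le_trans (pow4_le_expR _) _.
  have amgm (x y : R) : expR ((x + y) / 2) <= (expR x + expR y) / 2.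
    have := @expR_mean_le R 1 (fun i => if i == 0%N then x else y).
    by rewrite !big_ord_recl !big_ord0/= !addr0.
  have h1 := amgm (lam * X m w - lam ^+ 2 * Q m w / 2) (a / (t - s) * Q m w).
  have h2 := amgm (- lam * X m w - (- lam) ^+ 2 * Q m w / 2) (a / (t - s) * Q m w).
  rewrite -/(g lam w) -/(g3 w) in h1; rewrite -/(g (- lam) w) -/(g3 w) in h2.
  have e1 : (lam * X m w - lam ^+ 2 * Q m w / 2 + a / (t - s) * Q m w) / 2 = lam * X m w / 2.
    by rewrite -lam2; ring.
  have e2 : (- lam * X m w - (- lam) ^+ 2 * Q m w / 2 + a / (t - s) * Q m w) / 2 = - (lam * X m w / 2).
    by rewrite -lam2; ring.
  rewrite e1 in h1; rewrite e2 in h2; lra.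
rewrite integral_ge0_scale//; first last.
- by move=> w; rewrite !addr_ge0 ?mulr_ge0 ?expR_ge0.
- apply: measurable_funD; last exact: measurable_funM.
  exact: measurable_funD.
rewrite [leRHS]EFinM lee_wpmul2l ?lee_fin//.
have g0 l w : 0 <= g l w by exact: expR_ge0.
have g30 w : 0 <= 2 * g3 w by rewrite mulr_ge0 ?expR_ge0.
have mg2 : measurable_fun setT (fun w => 2 * g3 w) by exact: measurable_funM.
rewrite (integral_ge0_add _ mg2)//; last 2 first.
- exact: measurable_funD.
- by move=> w; rewrite addr_ge0.
rewrite (integral_ge0_add (mg lam) (mg (- lam)))// (integral_ge0_scale _ mg3)//; last first.
  by move=> w; exact: expR_ge0.
rewrite !Ig -[leRHS]/(1 + 1 + 2%:E * C%:E)%E; apply: leeD => //.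
by apply: lee_wpmul2l => //; exact: exp_grid.
Qed.

(** The grid sums all have second moment v (t - s), but converge to Z only almost surely along a
    subsequence. Fatou gives one inequality; the other requires uniform integrability of the
    squares, supplied by the uniform fourth moment bound. *)
Lemma ito_isometry : P.-integrable setT (EFin \o (fun w => Z w ^+ 2)) /\
  (\int[P]_w (Z w ^+ 2)%:E = (v * (t - s))%:E)%E.
Proof.
have [phi cphi] := cvg_subseq.
have [K X4] := fourth_moment.
have cphi1 : {ae P, forall w, X (phi k) w @[k --> \oo] --> Z w}.
  by apply: filterS cphi => w [].
have pow4_ge0 (x : R) : 0 <= x ^+ 4 by rewrite -[4%N]/(2 * 2)%N exprM sqr_ge0.
have cexp n w : X (phi k) w @[k --> \oo] --> Z w -> X (phi k) w ^+ n @[k --> \oo] --> Z w ^+ n.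
  move=> cX; apply: (@cvg_comp _ _ _ (fun k => X (phi k) w) (fun x => x ^+ n)); first exact: cX.
  exact: exprn_continuous.
have Z4 : (\int[P]_w (Z w ^+ 4)%:E <= K%:E)%E.
  apply: (@fatou_bound _ _ _ P (fun k w => X (phi k) w ^+ 4)) => //.
  - by move=> k; exact: measurable_funX.
  - exact: measurable_funX.
  - by apply: filterS cphi1 => w; exact: cexp.
have Z2 : (\int[P]_w (Z w ^+ 2)%:E <= (v * (t - s))%:E)%E.
  apply: (@fatou_bound _ _ _ P (fun k w => X (phi k) w ^+ 2)) => //.
  - by move=> k; exact: measurable_funX.
  - exact: measurable_funX.
  - by move=> k w; exact: sqr_ge0.
  - by apply: filterS cphi1 => w; exact: cexp.
  - by move=> k; rewrite sqr_grid.
have mXn (Y : T -> R) n : measurable_fun setT Y -> measurable_fun setT (fun w => Y w ^+ n).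
  exact: measurable_funX.
have iZ2 : P.-integrable setT (EFin \o (fun w => Z w ^+ 2)).
  by apply: ge0_integrable_bound Z2 => //; [exact: mXn|move=> w; exact: sqr_ge0].
have iZ4 : P.-integrable setT (EFin \o (fun w => Z w ^+ 4)).
  by apply: ge0_integrable_bound Z4 => //; exact: mXn.
split => //; rewrite (EFin_Rintegral iZ2); congr EFin.
apply/eqP; rewrite eq_le; apply/andP; split.
  by rewrite -lee_fin -EFin_Rintegral.
have iX2 m : P.-integrable setT (EFin \o (fun w => X m w ^+ 2)).
  apply: (@ge0_integrable_bound _ (v * (t - s))); first exact: mXn.
  - by move=> w; exact: sqr_ge0.
  - by rewrite sqr_grid.
have iX4 m : P.-integrable setT (EFin \o (fun w => X m w ^+ 4)).
  by apply: ge0_integrable_bound (X4 m) => //; exact: mXn.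
(* Fatou for e x^4 - x^2 + 1/(4e) >= 0 gives the reverse inequality. *)
have key e : 0 < e -> v * (t - s) <= \int[P]_w (Z w ^+ 2) + e * K.
  move=> e0.
  pose g (x : R) := e * (x ^+ 2 - (2 * e)^-1) ^+ 2.
  have gE x : g x = e * x ^+ 4 - x ^+ 2 + (4 * e)^-1.
    by rewrite /g; field; rewrite gt_eqF.
  have Ig (Y : T -> R) : P.-integrable setT (EFin \o (fun w => Y w ^+ 2)) ->
      P.-integrable setT (EFin \o (fun w => Y w ^+ 4)) ->
      (\int[P]_w (g (Y w))%:E =
      (e * \int[P]_w (Y w ^+ 4) - \int[P]_w (Y w ^+ 2) + (4 * e)^-1)%:E)%E.
    move=> i2 i4.
    have i0 : P.-integrable setT (EFin \o cst ((4 * e)^-1 : R)).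
      exact: finite_measure_integrable_cst.
    have i4' : P.-integrable setT (EFin \o (fun w => e * Y w ^+ 4)).
      exact: (integrableZl measurableT e i4).
    have i42 : P.-integrable setT (EFin \o (fun w => e * Y w ^+ 4 - Y w ^+ 2)).
      exact: (integrableB measurableT i4' i2).
    under eq_integral do rewrite gE.
    rewrite (EFin_Rintegral (integrableD measurableT i42 i0)); congr EFin.
    by rewrite RintegralD// RintegralB// RintegralZl// Rintegral_cst//= probability_setT/= mulr1.
  have cg : continuous g.
    have c1 : continuous (fun x : R => x ^+ 2 - (2 * e)^-1).
      by move=> x; apply: cvgB; [exact: exprn_continuous|exact: cvg_cst].
    have c2 : continuous (fun x : R => (x ^+ 2 - (2 * e)^-1) ^+ 2).
      move=> x; apply: (@cvg_comp _ _ _ (fun x : R => x ^+ 2 - (2 * e)^-1) (fun x => x ^+ 2)).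
        exact: c1.
      exact: exprn_continuous.
    by move=> x; exact: (cvgM (cvg_cst e) (c2 x)).
  have mg : measurable_fun setT g by exact: continuous_measurable_fun.
  have : (\int[P]_w (g (Z w))%:E <= (e * K - v * (t - s) + (4 * e)^-1)%:E)%E.
    apply: (@fatou_bound _ _ _ P (fun k w => g (X (phi k) w))).
    - by move=> k; exact: measurableT_comp.
    - exact: measurableT_comp.
    - by move=> k w; rewrite /g mulr_ge0 ?sqr_ge0// ltW.
    - by apply: filterS cphi1 => w cX; apply: cvg_comp cX _; exact: cg.
    move=> k; rewrite (Ig _ (iX2 _) (iX4 _)) lee_fin lerD2r.
    have -> : \int[P]_w (X (phi k) w ^+ 2) = v * (t - s).
      by apply/EFin_inj; rewrite -EFin_Rintegral// sqr_grid.
    by rewrite lerD2r ler_pM2l// -lee_fin -EFin_Rintegral.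
  rewrite (Ig Z iZ2 iZ4) lee_fin.
  have Z40 : 0 <= \int[P]_w (Z w ^+ 4) by apply: Rintegral_ge0.
  by have := mulr_ge0 (ltW e0) Z40; lra.
have K0 : 0 <= K.
  by rewrite -lee_fin; apply: le_trans (X4 0%N); apply: integral_ge0 => w _; rewrite lee_fin.
apply/ler_addgt0Pr => e e0.
have K1 : 0 < K + 1 by lra.
apply: le_trans (key (e / (K + 1)) _) _; first by rewrite divr_gt0.
by rewrite lerD2l mulrAC ler_pdivrMr// ler_pM2l// lerDl.
Qed.

End ito_moments.

(** * Uniqueness and scaling of limits in probability *)

Section in_probability_limits.
Context {R : realType} {d : measure_display} {T : measurableType d}.
Variable P : probability T R.

Lemma cvg_in_probability_unique (X : nat -> T -> R) (Y Z : T -> R) :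
  measurable_fun setT Y -> measurable_fun setT Z ->
  cvg0_in_probability P (fun k w => (`|X k w - Y w|)%:E) ->
  cvg0_in_probability P (fun k w => (`|X k w - Z w|)%:E) ->
  {ae P, forall w, Y w = Z w}.
Proof.
move=> mY mZ XY XZ.
have mE c : measurable [set w | c <= `|Y w - Z w|]%R.
  by apply: measurable_set_ge; apply: measurableT_comp => //; exact: measurable_funB.
have P0 e : 0 < e -> P [set w | e <= `|Y w - Z w|]%R = 0%E.
  move=> e0; apply/eqP; rewrite eq_le measure_ge0 andbT.
  apply/lee_addgt0Pr => eta eta0; rewrite add0e.
  have e2 : 0 < e / 2 by rewrite divr_gt0.
  have eta2 : 0 < eta / 2 by rewrite divr_gt0.
  have [N1 _ h1] := (cvge0P (fun n => outer_measure_ge0 _ _)).1 (XY _ e2) _ eta2.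
  have [N2 _ h2] := (cvge0P (fun n => outer_measure_ge0 _ _)).1 (XZ _ e2) _ eta2.
  have {}h1 := h1 (maxn N1 N2) (leq_maxl _ _); have {}h2 := h2 (maxn N1 N2) (leq_maxr _ _).
  rewrite -(measurable_mu_extE P (mE e)).
  rewrite [leRHS](_ : _ = (eta / 2)%:E + (eta / 2)%:E)%E; last first.
    by rewrite -EFinD; congr EFin; field.
  apply: le_trans (leeD h1 h2); apply: le_trans (outer_measureU2 _ _ _).
  apply: le_outer_measure => w /= eYZ.
  set x := X _ w; case: (leP (e / 2) `|x - Y w|) => h; first by left.
  right; rewrite lee_fin.
  have := ler_normB (x - Z w) (x - Y w).
  rewrite (_ : x - Z w - (x - Y w) = Y w - Z w); last by ring.
  by rewrite -/x; lra.
exists (\bigcup_k [set w | k.+1%:R^-1 <= `|Y w - Z w|]%R); split.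
- exact: bigcup_measurable.
- apply/eqP; rewrite eq_le measure_ge0 andbT.
  apply: le_trans (measure_sigma_subadditive _ _ _ (@subset_refl _ _)) _ => //.
    exact: bigcup_measurable.
  by rewrite eseries0// => k _ _; exact: P0.
- move=> w /= YZ.
  have YZ0 : 0 < `|Y w - Z w| by rewrite normr_gt0 subr_eq0; exact/eqP.
  have iYZ : 0 <= `|Y w - Z w|^-1 by rewrite invr_ge0.
  exists (Num.bound (`|Y w - Z w|^-1)) => //=.
  rewrite invf_ple ?posrE// (le_trans (ltW (archi_boundP iYZ)))// ler_nat.
  exact: leqnSn.
Qed.

Lemma cvg0_in_probability_scale (c : R) (Y : nat -> T -> R) :
  cvg0_in_probability P (fun k w => (`|Y k w|)%:E) ->
  cvg0_in_probability P (fun k w => (`|c * Y k w|)%:E).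
Proof.
move=> Y0 e e0; have [->|c0] := eqVneq c 0.
  apply: cvg_near_cst; apply: nearW => k.
  rewrite (_ : [set _ | _] = set0) ?outer_measure0//.
  by apply/seteqP; split => // w /=; rewrite mul0r normr0 lee_fin leNgt e0.
have c1 : 0 < `|c| by rewrite normr_gt0.
have /Y0 : 0 < e / `|c| by rewrite divr_gt0.
rewrite (_ : (fun k => _) = (fun k => P^*%mu [set w | (e%:E <= `|c * Y k w|%:E)%E]))//.
apply/funext => k; congr (P^*%mu _); apply/seteqP; split => w /=;
  by rewrite !lee_fin normrM ler_pdivrMr// mulrC.
Qed.

End in_probability_limits.

(** * Linear equations *)

Section integrating_factor.
Context {R : realType}.
Local Notation mu := (@lebesgue_measure R).

Lemma continuous_expRM (k : R) : continuous (fun x : R => expR (k * x)).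
Proof.
move=> x; apply: (@continuous_comp _ _ _ (fun x => k * x) expR); last exact: continuous_expR.
by apply: cvgM; [exact: cvg_cst|exact: cvg_id].
Qed.

Lemma Rintegral_FTC2 (f F : R -> R) (a b : R) : a < b ->
  {within `[a, b], continuous f} -> {within `[a, b], continuous F} ->
  (forall x, x \in `]a, b[ -> is_derive x 1 F (f x)) ->
  \int[mu]_(u in `[a, b]) f u = F b - F a.
Proof.
move=> ab cf cF dF; rewrite /Rintegral (@continuous_FTC2 _ _ F a b ab cf)//.
- have /(continuous_within_itvP _ ab)[c1 c2 c3] := cF.
  by split => // x xb; case: (dF x xb).
- by move=> x xb; rewrite derive1E; case: (dF x xb).
Qed.

Lemma primitive_is_derive (g : R -> R) (b x : R) : 0 < b ->
  {within `[0, b], continuous g} -> x \in `]0, b[ ->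
  is_derive x 1 (fun y => \int[mu]_(v in `[0, y]) g v) (g x).
Proof.
move=> b0 cg xb; have := xb; rewrite in_itv/= => /andP[x0 xltb].
have ig : mu.-integrable `[0, b] (EFin \o g).
  by apply: continuous_compact_integrable => //; exact: segment_compact.
have gx := within_continuous_continuous b0 cg xb.
have [dG1 dG2] := @continuous_FTC1_closed _ g 0 x b xltb ig x0 gx.
by apply: DeriveDef; [exact: dG1|rewrite -derive1E].
Qed.

Lemma continuous_primitive (g : R -> R) (b : R) : 0 < b ->
  {within `[0, b], continuous g} ->
  {within `[0, b], continuous (fun y => \int[mu]_(v in `[0, y]) g v)}.
Proof.
move=> b0 cg; apply: parameterized_integral_continuous; first exact: ltW.
by apply: continuous_compact_integrable => //; exact: segment_compact.
Qed.

(** With G the primitive of g, the integrand is the derivative of exp(k x) G. For g a path of n the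
    bracket is phi M; for the centred mean of V it is 0. *)
Lemma integrating_factor (g : R -> R) (k b : R) : 0 < b ->
  {within `[0, b], continuous g} ->
  \int[mu]_(u in `[0, b]) (expR (k * u) * (g u + k * \int[mu]_(v in `[0, u]) g v)) =
  expR (k * b) * \int[mu]_(v in `[0, b]) g v.
Proof.
move=> b0 cg; pose G x := \int[mu]_(v in `[0, x]) g v.
have cG : {within `[0, b], continuous G} by exact: continuous_primitive.
have ce := continuous_subspaceT (A := `[0, b]) (@continuous_expRM k).
have cF : {within `[0, b], continuous (fun x => expR (k * x) * G x)}.
  by move=> x; apply: cvgM; [exact: ce|exact: cG].
have cf : {within `[0, b], continuous (fun x => expR (k * x) * (g x + k * G x))}.
  move=> x; apply: cvgM; first exact: ce.
  by apply: cvgD; [exact: cg|apply: cvgM; [exact: cvg_cst|exact: cG]].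
have dF x : x \in `]0, b[ ->
    is_derive x 1 (fun x => expR (k * x) * G x) (expR (k * x) * (g x + k * G x)).
  move=> xb; have dGx : is_derive x 1 G (g x) := primitive_is_derive b0 cg xb.
  by apply: is_derive_eq; rewrite /GRing.scale/=; ring.
by rewrite (Rintegral_FTC2 b0 cf cF dF) /G set_itv1 Rintegral_set1 mulr0 subr0.
Qed.

(** Same argument for exp(2 k x) G^2. For g a path of n the integrand is a multiple of N M, so the
    second moment of N follows from E [N M]. *)
Lemma integrating_factor_sqr (g : R -> R) (k b : R) : 0 < b ->
  {within `[0, b], continuous g} ->
  \int[mu]_(u in `[0, b]) (2 * expR (2 * k * u) * (\int[mu]_(v in `[0, u]) g v) *
    (g u + k * \int[mu]_(v in `[0, u]) g v)) =
  expR (2 * k * b) * (\int[mu]_(v in `[0, b]) g v) ^+ 2.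
Proof.
move=> b0 cg; pose G x := \int[mu]_(v in `[0, x]) g v.
have cG : {within `[0, b], continuous G} by exact: continuous_primitive.
have ce := continuous_subspaceT (A := `[0, b]) (@continuous_expRM (2 * k)).
have cF : {within `[0, b], continuous (fun x => expR (2 * k * x) * (G x * G x))}.
  by move=> x; apply: cvgM; [exact: ce|apply: cvgM; exact: cG].
have cf : {within `[0, b], continuous (fun x => 2 * expR (2 * k * x) * G x * (g x + k * G x))}.
  move=> x; apply: cvgM.
    by apply: cvgM; [apply: cvgM; [exact: cvg_cst|exact: ce]|exact: cG].
  by apply: cvgD; [exact: cg|apply: cvgM; [exact: cvg_cst|exact: cG]].
have dF x : x \in `]0, b[ -> is_derive x 1 (fun x => expR (2 * k * x) * (G x * G x))
    (2 * expR (2 * k * x) * G x * (g x + k * G x)).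
  move=> xb; have dGx : is_derive x 1 G (g x) := primitive_is_derive b0 cg xb.
  by apply: is_derive_eq; rewrite /GRing.scale/=; ring.
by rewrite (Rintegral_FTC2 b0 cf cF dF) /G set_itv1 Rintegral_set1 !mulr0 subr0 expr2.
Qed.

(** Processes are indexed by all of R, so continuity is also wanted at negative times, where [0, y]
    is empty. The function is a primitive, started from a negative point [a], of g cut off to [0,
    +oo[; the cut-off is integrable though discontinuous. *)
Lemma continuous_primitive_itv0 (g : R -> R) : continuous g ->
  continuous ((fun y => \int[mu]_(v in `[0, y]) g v) : R -> R).
Proof.
move=> cg x; pose a := - `|x| - 1; pose b := `|x| + 1.
have xab : x \in `]a, b[.
  by rewrite in_itv/= /a /b; have := ler_norm x; have := lerNnormlW (lexx `|x|); lra.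
have ab : a < b by move: xab; rewrite in_itv/= => /andP[/lt_trans]; exact.
pose D : set R := `[0, +oo[%classic.
have iG : mu.-integrable `[a, b] (EFin \o (g \_ D)).
  have ig : mu.-integrable `[a, b] (EFin \o g).
    apply: continuous_compact_integrable; first exact: segment_compact.
    exact: continuous_subspaceT.
  apply: (le_integrable _ _ _ ig) => //.
    apply/measurable_EFinP; rewrite patch_indic; apply: measurable_funTS.
    by apply: measurable_funM; [exact: continuous_measurable_fun|apply: measurable_indic; exact: measurable_itv].
  by move=> v _ /=; rewrite patchE; case: ifP => // _; rewrite lee_fin normr0.
have hE (y : R) : a <= y -> \int[mu]_(v in `[a, y]) (g \_ D) v = \int[mu]_(v in `[0, y]) g v.
  move=> ay; rewrite -Rintegral_mkcondr; congr (Rintegral mu _ g).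
  apply/seteqP; split => v /=; rewrite /D/= !in_itv/= ?andbT.
    by move=> [/andP[_ ->] ->].
  move=> /andP[v0 ->]; split => //; rewrite andbT (le_trans _ v0)//.
  by rewrite /a; have := normr_ge0 x; lra.
apply: (within_continuous_continuous ab) xab.
apply: subspace_eq_continuous (parameterized_integral_continuous (ltW ab) iG).
by move=> y; rewrite inE/= in_itv/= => /andP[ay _]; exact: hE.
Qed.

(* Jensen's inequality for the uniform law on [0, b]: the integral of
   (g - m)^2 is nonnegative, where m is the mean of g. *)
Lemma Rintegral_sqr_le (g : R -> R) (b : R) : 0 < b -> continuous g ->
  (\int[mu]_(u in `[0, b]) g u) ^+ 2 <= b * \int[mu]_(u in `[0, b]) (g u ^+ 2).
Proof.
move=> b0 cg; set I := \int[mu]_(u in _) g u; pose m := I / b.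
have ci (h : R -> R) : continuous h -> mu.-integrable `[0, b] (EFin \o h).
  move=> ch; apply: continuous_compact_integrable; first exact: segment_compact.
  exact: continuous_subspaceT.
have c2 : continuous (fun u => g u ^+ 2).
  by move=> u; apply: (@continuous_comp _ _ _ g (fun x => x ^+ 2)); [exact: cg|exact: exprn_continuous].
have cm : continuous (fun u => 2 * m * g u).
  by move=> u; apply: cvgM; [exact: cvg_cst|exact: cg].
have cB : continuous (fun u => g u ^+ 2 - 2 * m * g u).
  by move=> u; apply: cvgB; [exact: c2|exact: cm].
have : 0 <= \int[mu]_(u in `[0, b]) ((g u ^+ 2 - 2 * m * g u) + m ^+ 2).
  apply: Rintegral_ge0 => u _; have := sqr_ge0 (g u - m).
  by rewrite sqrrB -mulr_natl; lra.
rewrite RintegralD//; [|exact: ci|by apply: ci; exact: cst_continuous].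
rewrite RintegralB//; [|exact: ci..].
rewrite RintegralZl//; last exact: ci.
rewrite Rintegral_cst//= lebesgue_measure_itv/= lte_fin b0 -EFinB/= subr0 -/I.
have -> : I = m * b by rewrite /m divfK// gt_eqF.
by move=> h; have := mulr_ge0 (ltW b0) h; lra.
Qed.

End integrating_factor.

Section ito_increments.
Context {R : realType} {d : measure_display} {T : measurableType d}.
Variable P : probability T R.
Local Notation mu := (@lebesgue_measure R).

Lemma ito_process_increment (F : R -> set_system T) (W X b H : R -> T -> R) (s t : R) :
  ito_process P F W X b H -> 0 <= s -> s <= t ->
  exists It Is, [/\ ito_integral P F W H t It, ito_integral P F W H s Is &
   {ae P, forall w, X t w - X s w - (\int[mu]_(u in `[0, t]) b u w - \int[mu]_(u in `[0, s]) b u w)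
     = It w - Is w}].
Proof.
move=> dX s0 st; have [It hIt It_ae] := ito_equation dX (le_trans s0 st).
have [Is hIs Is_ae] := ito_equation dX s0.
exists It, Is; split => //; apply: filterS2 It_ae Is_ae => w -> ->.
ring.
Qed.

Lemma continuous_paths_integrable (X : R -> R) (t : R) : continuous X ->
  mu.-integrable `[0, t] (EFin \o X).
Proof.
move=> cX; apply: continuous_compact_integrable; first exact: segment_compact.
exact: continuous_subspaceT.
Qed.

Lemma Rintegral_itv_cst (c t : R) : 0 <= t -> \int[mu]_(u in `[0, t]) c = c * t.
Proof.
move=> t0; rewrite Rintegral_cst//= lebesgue_measure_itv/= lte_fin.
case: ltP => [_|t0']; first by rewrite -EFinB/= subr0.
by rewrite (@le_anti _ _ t 0) ?t0'// !mulr0.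
Qed.

Lemma Rintegral_affine (X Y : T -> R) (a b c : R) :
  P.-integrable setT (EFin \o X) -> P.-integrable setT (EFin \o Y) ->
  P.-integrable setT (EFin \o (fun w => a * X w + b * Y w + c)) /\
  \int[P]_w (a * X w + b * Y w + c) = a * \int[P]_w X w + b * \int[P]_w Y w + c.
Proof.
move=> iX iY.
have iaX : P.-integrable setT (EFin \o (fun w => a * X w)) by exact: (integrableZl measurableT a iX).
have ibY : P.-integrable setT (EFin \o (fun w => b * Y w)) by exact: (integrableZl measurableT b iY).
have ic : P.-integrable setT (EFin \o cst c) by exact: finite_measure_integrable_cst.
have iD : P.-integrable setT (EFin \o (fun w => a * X w + b * Y w)).
  exact: (integrableD measurableT iaX ibY).
split; first exact: (integrableD measurableT iD ic).
rewrite (RintegralD measurableT iD ic) (RintegralD measurableT iaX ibY) !RintegralZl//.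
by rewrite Rintegral_cst//= probability_setT/= mulr1.
Qed.

Lemma ae_eq_Rintegral (X Y : T -> R) :
  measurable_fun setT X -> measurable_fun setT Y -> {ae P, forall w, X w = Y w} ->
  \int[P]_w X w = \int[P]_w Y w.
Proof.
move=> mX mY XY; congr fine; apply: ae_eq_integral => //; [exact/measurable_EFinP..|].
by apply: filterS XY => w -> _.
Qed.

Lemma ae_eq_integrable (X Y : T -> R) : measurable_fun setT Y -> {ae P, forall w, X w = Y w} ->
  P.-integrable setT (EFin \o X) -> P.-integrable setT (EFin \o Y).
Proof.
move=> mY XY /integrableP[mX X0]; apply/integrableP; split; first exact/measurable_EFinP.
rewrite (@ae_eq_integral _ _ _ P setT (fun w => `|(X w)%:E|%E))//.
- by apply: measurableT_comp => //; exact/measurable_EFinP.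
- exact: measurableT_comp.
- by apply: filterS XY => w /= ->.
Qed.

End ito_increments.

(** * The variance process *)

Section cir.
Context {R : realType} {d : measure_display} {T : measurableType d}.
Variable P : probability T R.
Local Notation mu := (@lebesgue_measure R).
Variables (F : R -> set_system T) (W V Vc : R -> T -> R) (kappa theta gamma : R).
Hypotheses (hF : filtration F) (hW : brownian_motion P F W)
  (kappa0 : 0 < kappa) (theta0 : 0 < theta)
  (dV : ito_process P F W V (fun t w => kappa * (theta - V t w))
    (fun t w => gamma * Num.sqrt (V t w)))
  (V_ge0 : {ae P, forall w, forall t : R, 0 <= t -> 0 <= V t w})
  (initV : {ae P, forall w, V 0 w = theta})
  (cV : forall w, continuous (Vc ^~ w)) (mV : forall u, measurable_fun setT (Vc u))
  (VcV : {ae P, forall w, forall u, 0 <= u -> Vc u w = V u w}).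

Let q t w := \int[mu]_(u in `[0, t]) Vc u w.

(** The stochastic integral of gamma sqrt(V), read off from the equation for V with initial value
    theta, on the continuous copy of V. *)
Let Z t w := Vc t w - theta - kappa * theta * t + kappa * q t w.

Let mq t : 0 <= t -> measurable_fun setT (q t).
Proof. by move=> t0; apply: measurable_Rintegral_process. Qed.

Let mZ t : 0 <= t -> measurable_fun setT (Z t).
Proof.
move=> t0; apply: measurable_funD; last by apply: measurable_funM => //; exact: mq.
by apply: measurable_funB => //; apply: measurable_funB.
Qed.

Let q_ge0 t : {ae P, forall w, 0 <= q t w}.
Proof.
apply: filterS2 V_ge0 VcV => w Vw VcVw; apply: Rintegral_ge0 => u /=.
by rewrite in_itv/= => /andP[u0 _]; rewrite VcVw// Vw.
Qed.

(** The integral over [0, 0] is kept as [I0], so that [Z] has the form of an increment between times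
    0 and t. *)
Let cir_increment t : 0 <= t ->
  exists It I0, [/\ ito_integral P F W (fun t w => gamma * Num.sqrt (V t w)) t It,
    ito_integral P F W (fun t w => gamma * Num.sqrt (V t w)) 0 I0 &
    {ae P, forall w, Z t w = It w - I0 w}].
Proof.
move=> t0; have [It [I0 [hIt hI0 ae1]]] := ito_process_increment dV (lexx 0) t0.
exists It, I0; split => //; apply: filterS3 ae1 VcV initV => w <- VcVw V0.
rewrite set_itv1 Rintegral_set1 subr0 V0 /Z VcVw//.
rewrite (@eq_Rintegral _ _ _ mu _ (fun u => kappa * (theta - Vc u w))); last first.
  by move=> u; rewrite inE/= in_itv/= => /andP[u0 _]; rewrite VcVw.
have iV := continuous_paths_integrable t (@cV w).
have ic : mu.-integrable `[0, t] (EFin \o cst theta).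
  by apply: continuous_paths_integrable; exact: cst_continuous.
have iB : mu.-integrable `[0, t] (EFin \o (fun u => theta - Vc u w)).
  by apply: continuous_paths_integrable => u; apply: cvgB; [exact: cvg_cst|exact: cV].
rewrite RintegralZl// RintegralB// Rintegral_itv_cst// -/(q t w); ring.
Qed.

Let Hc u w := gamma * Num.sqrt (Vc u w).

Let cHc w : continuous (Hc ^~ w).
Proof.
move=> u; apply: cvgM; first exact: cvg_cst.
apply: (@continuous_comp _ _ _ (Vc ^~ w) Num.sqrt); first exact: cV.
exact: sqrt_continuous.
Qed.

Let mHc u : measurable_fun setT (Hc u).
Proof.
apply: measurable_funM => //; apply: measurableT_comp => //.
by apply: continuous_measurable_fun; exact: sqrt_continuous.
Qed.

Let HcH : {ae P, forall w, forall u, 0 <= u -> Hc u w = gamma * Num.sqrt (V u w)}.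
Proof. by apply: filterS VcV => w VcVw u u0; rewrite /Hc VcVw. Qed.

Let qE t : {ae P, forall w, \int[mu]_(u in `[0, t]) (Hc u w ^+ 2) = gamma ^+ 2 * q t w}.
Proof.
apply: filterS2 V_ge0 VcV => w Vw VcVw.
rewrite -RintegralZl//; last exact: continuous_paths_integrable.
apply: eq_Rintegral => u; rewrite inE/= in_itv/= => /andP[u0 _].
by rewrite /Hc exprMn sqr_sqrtr// VcVw// Vw.
Qed.

(* With lam0 gamma^2 <= kappa, half of the drift term kappa q absorbs the
   compensator lam0 gamma^2 q / 2. *)
Let lam0 := kappa / (gamma ^+ 2 + 1).

Let g1 : 0 < gamma ^+ 2 + 1.
Proof. by have := sqr_ge0 gamma; lra. Qed.

Let lam0_gt0 : 0 < lam0. Proof. by rewrite divr_gt0. Qed.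

(** In the exponential inequality for [Z] at [lam0], the constant part theta + kappa theta t of V -
    Z goes to the right-hand side, and at least kappa / 2 q remains with V. *)
Let cir_expR_q t : 0 < t ->
  (\int[P]_w (expR (lam0 * (Vc t w + kappa / 2 * q t w)))%:E <=
   (expR (lam0 * theta * (1 + kappa * t)))%:E)%E.
Proof.
move=> t0; have [It [I0 [hIt hI0 ZE]]] := cir_increment (ltW t0).
have := ito_expR hF hW (ito_diffusion_adapted dV) cHc mHc HcH (lexx 0) t0 hIt hI0
  (mZ (ltW t0)) ZE lam0.
set c := expR _ => h.
rewrite -[leRHS]mule1; apply: le_trans (lee_wpmul2l _ h); last by rewrite lee_fin expR_ge0.
have mq' : measurable_fun setT (fun w => \int[mu]_(u in `[0, t]) (Hc u w ^+ 2)).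
  apply: (@measurable_Rintegral_process _ _ _ (fun u w => Hc u w ^+ 2)); last exact: ltW.
  - move=> w u; apply: (@continuous_comp _ _ _ (Hc ^~ w) (fun x => x ^+ 2)); first exact: cHc.
    exact: exprn_continuous.
  - by move=> u; exact: measurable_funX.
have mf : measurable_fun setT (fun w => expR (lam0 * Z t w -
    lam0 ^+ 2 * \int[mu]_(u in `[0, t]) (Hc u w ^+ 2) / 2)).
  apply: measurableT_comp => //; apply: measurable_funB.
    by apply: measurable_funM => //; exact/mZ/ltW.
  by apply: measurable_funM => //; exact: measurable_funM.
rewrite -integral_ge0_scale//; last exact: expR_ge0.
apply: ae_ge0_le_integral => //.
- apply/measurable_EFinP; apply: measurableT_comp => //; apply: measurable_funM => //.
  by apply: measurable_funD => //; apply: measurable_funM => //; exact/mq/ltW.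
- by move=> w _; rewrite lee_fin mulr_ge0 ?expR_ge0.
- by apply/measurable_EFinP; exact: measurable_funM.
apply: filterS2 (qE t) (q_ge0 t) => w -> q0 _.
rewrite lee_fin -expRD ler_expR /Z.
have lg : lam0 * gamma ^+ 2 <= kappa.
  by rewrite /lam0 mulrAC ler_pdivrMr// ler_pM2l// lerDl.
have := ler_wpM2r (mulr_ge0 (ltW lam0_gt0) q0) lg.
by move: lam0 (q t w) (Vc t w) => l x y; lra.
Qed.

Let Vc0 t : 0 <= t -> {ae P, forall w, 0 <= Vc t w}.
Proof. by move=> t0; apply: filterS2 V_ge0 VcV => w Vw VcVw; rewrite VcVw// Vw. Qed.

Let k t := expR (lam0 * theta * (1 + kappa * t)).

Let cir_expR_c t : 0 <= t ->
  (\int[P]_w (expR (lam0 * Vc t w))%:E <= (k t)%:E)%E.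
Proof.
rewrite le_eqVlt => /predU1P[<-|t0].
  rewrite (@ae_eq_integral _ _ _ P setT (cst (k 0)%:E))//; first last.
  - apply: filterS2 VcV initV => w VcVw V0 _; rewrite VcVw// V0 /k.
    by rewrite mulr0 addr0 mulr1.
  - by apply/measurable_EFinP; apply: measurableT_comp => //; exact: measurable_funM.
  - by rewrite integral_cst//= probability_setT mule1.
apply: le_trans (cir_expR_q t0).
apply: ae_ge0_le_integral => //.
- by apply/measurable_EFinP; apply: measurableT_comp => //; exact: measurable_funM.
- apply/measurable_EFinP; apply: measurableT_comp => //; apply: measurable_funM => //.
  by apply: measurable_funD => //; apply: measurable_funM => //; exact/mq/ltW.
apply: filterS (q_ge0 t) => w q0 _; rewrite lee_fin ler_expR ler_pM2l// lerDl.
by rewrite mulr_ge0// divr_ge0// ltW.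
Qed.

Let kS s t : s <= t -> k s <= k t.
Proof.
move=> st; rewrite ler_expR; apply: ler_wpM2l; first by rewrite mulr_ge0// ltW.
by rewrite lerD2l ler_pM2l.
Qed.

(** The first integrability statement about V, from y <= exp y at y = lam0 V; being locally uniform
    in t, it makes Fubini applicable to [q]. *)
Let cir_abs t : 0 <= t -> (\int[P]_w (`|Vc t w|)%:E <= (lam0^-1 * k t)%:E)%E.
Proof.
move=> t0; rewrite EFinM.
apply: le_trans (lee_wpmul2l _ (cir_expR_c t0)); last by rewrite lee_fin invr_ge0 ltW.
have l0 : 0 <= lam0^-1 by rewrite invr_ge0 ltW.
have me : measurable_fun setT (fun w => expR (lam0 * Vc t w)).
  by apply: measurableT_comp => //; exact: measurable_funM.
rewrite -(integral_ge0_scale P l0 me (fun w => expR_ge0 _)).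
apply: ae_ge0_le_integral => //.
- by apply/measurable_EFinP; exact: measurableT_comp.
- by move=> w _; rewrite lee_fin mulr_ge0 ?expR_ge0// invr_ge0 ltW.
- by apply/measurable_EFinP; exact: measurable_funM.
apply: filterS (Vc0 t0) => w V0 _; rewrite lee_fin ger0_norm// ler_pdivlMl//.
by rewrite (le_trans _ (expR_ge1Dx _))// lerDr.
Qed.

Let iVc t : 0 <= t -> P.-integrable setT (EFin \o Vc t).
Proof.
move=> t0; apply/integrableP; split; first exact/measurable_EFinP.
by rewrite (le_lt_trans (cir_abs t0))// ltry.
Qed.

Let f t := \int[P]_w Vc t w.

Let cir_fubini t : 0 <= t -> [/\ P.-integrable setT (EFin \o q t),
  mu.-integrable `[0, t] (EFin \o f) & \int[P]_w q t w = \int[mu]_(u in `[0, t]) f u].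
Proof.
move=> t0.
have [|iq if' fE] := @process_fubini _ _ _ P Vc t (lam0^-1 * k t) cV mV t0.
  move=> s /andP[s0 st]; apply: le_trans (cir_abs s0) _.
  by rewrite lee_fin ler_pM2l ?invr_gt0//; exact: kS.
have fI : {in `[0, t]%classic, (fun u => \int[P]_w (Vc u w)%:E)%E =1 EFin \o f}.
  by move=> u; rewrite inE/= in_itv/= => /andP[u0 _] /=; rewrite (EFin_Rintegral (iVc u0)).
split => //; first by apply: eq_integrable if' => // u uA; exact: fI.
by rewrite {1}/Rintegral fE; congr fine; apply: eq_integral => u; exact: fI.
Qed.

Let cir_mean_eq t : 0 < t -> f t = theta + kappa * theta * t - kappa * \int[mu]_(u in `[0, t]) f u.
Proof.
move=> t0; have [It [I0 [hIt hI0 ZE]]] := cir_increment (ltW t0).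
have [iq if' qf] := cir_fubini (ltW t0).
have iV := iVc (ltW t0).
have mHc2 : measurable_fun setT (fun w => \int[mu]_(u in `[0, t]) (Hc u w ^+ 2)).
  apply: (@measurable_Rintegral_process _ _ _ (fun u w => Hc u w ^+ 2)); last exact: ltW.
  - move=> w u; apply: (@continuous_comp _ _ _ (Hc ^~ w) (fun x => x ^+ 2)); first exact: cHc.
    exact: exprn_continuous.
  - by move=> u; exact: measurable_funX.
have iHc2 : P.-integrable setT (EFin \o (fun w => \int[mu]_(u in `[0, t]) (Hc u w ^+ 2))).
  have g2 : P.-integrable setT (EFin \o (fun w => gamma ^+ 2 * q t w)).
    exact: (integrableZl measurableT _ iq).
  by apply: ae_eq_integrable g2 => //; apply: filterS (qE t) => w ->.
have [iZ' EZ'] := Rintegral_affine 1 kappa (- theta - kappa * theta * t) iV iq.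
have ZZ : (fun w => 1 * Vc t w + kappa * q t w + (- theta - kappa * theta * t)) = Z t.
  by apply/funext => w; rewrite /Z; ring.
rewrite ZZ in iZ' EZ'.
have := ito_mean0 hF hW (ito_diffusion_adapted dV) cHc mHc HcH (lexx 0) t0 hIt hI0
  (mZ (ltW t0)) ZE iZ' iHc2.
by rewrite EZ' qf -/(f t) => h; lra.
Qed.

(** Taking means in [Z] gives a linear integral equation for [f]. For g = f - theta it reads g +
    kappa int g = 0, so the integrating factor yields int g = 0, and the equation then returns f =
    theta. *)
Let cir_mean_c t : 0 <= t -> f t = theta.
Proof.
have f0 : f 0 = theta.
  rewrite /f (@ae_eq_Rintegral _ _ _ P (Vc 0) (cst theta))//.
    by rewrite Rintegral_cst//= probability_setT/= mulr1.
  by apply: filterS2 VcV initV => w VcVw V0; rewrite VcVw.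
rewrite le_eqVlt => /predU1P[<-//|t0].
have [_ if' _] := cir_fubini (ltW t0).
have fu u : 0 <= u <= t -> f u = theta + kappa * theta * u - kappa * \int[mu]_(v in `[0, u]) f v.
  move=> /andP[]; rewrite le_eqVlt => /predU1P[<- _|u0 _]; last exact: cir_mean_eq.
  by rewrite set_itv1 Rintegral_set1 f0; ring.
have cI := parameterized_integral_continuous (ltW t0) if'.
(* [f] is so far known only to be integrable; it inherits continuity from the equation, whose
   right-hand side is a primitive up to an affine function. *)
have cf : {within `[0, t], continuous f}.
  have h : {within `[0, t], continuous (fun u => theta + kappa * theta * u - kappa * \int[mu]_(v in `[0, u]) f v)}.
    move=> u; apply: cvgB.
      apply: cvgD; first exact: cvg_cst.
      apply: cvgM; first exact: cvg_cst.
      by apply: (continuous_subspaceT (f := id)) => v; exact: cvg_id.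
    by apply: cvgM; [exact: cvg_cst|exact: cI].
  apply: subspace_eq_continuous h => u; rewrite inE/= in_itv/= => ut.
  exact/esym/fu.
pose g u := f u - theta.
have cg : {within `[0, t], continuous g}.
  by move=> u; apply: cvgB; [exact: cf|exact: cvg_cst].
have gI u : 0 <= u <= t -> \int[mu]_(v in `[0, u]) g v = \int[mu]_(v in `[0, u]) f v - theta * u.
  move=> /andP[u0 ut]; rewrite RintegralB//; last first.
  - by apply: continuous_paths_integrable; exact: cst_continuous.
  - apply: (integrableS _ _ _ if') => //; apply: subset_itvl; by rewrite bnd_simp.
  by rewrite Rintegral_itv_cst.
have := integrating_factor kappa t0 cg.
rewrite (@eq_Rintegral _ _ _ mu _ (cst 0)); last first.
  move=> u; rewrite inE/= in_itv/= => ut; rewrite gI// /g {1}fu//; ring.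
rewrite Rintegral_itv_cst ?(ltW t0)// mul0r gI ?lexx ?(ltW t0)// => /esym/eqP.
rewrite mulf_eq0 gt_eqF ?expR_gt0//= => /eqP h.
by rewrite cir_mean_eq//; move: h; set I := \int[mu]_(_ in _) _; move=> h; rewrite (_ : I = theta * t);  lra.
Qed.

Lemma cir_mean t : 0 <= t -> (\int[P]_w (V t w)%:E = theta%:E)%E.
Proof.
move=> t0; rewrite -(cir_mean_c t0) -(EFin_Rintegral (iVc t0)).
apply: ae_eq_integral => //.
- apply/measurable_EFinP; apply: (filtration_measurable hF t0); exact: (ito_adapted dV).
- exact/measurable_EFinP.
- by apply: filterS VcV => w VcVw _; rewrite VcVw.
Qed.

(** The exponent does not depend on t and the bound increases with t, so one pair of constants
    serves a whole time interval, as the isometry demands. *)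
Lemma cir_expR_moment : exists2 lam, 0 < lam & forall t, 0 <= t ->
  (\int[P]_w (expR (lam * V t w))%:E <= (expR (lam * theta * (1 + kappa * t)))%:E)%E.
Proof.
exists lam0 => // t t0; rewrite (le_trans _ (cir_expR_c t0))//.
have mV' : measurable_fun setT (V t).
  by apply: (filtration_measurable hF t0); exact: (ito_adapted dV).
rewrite (@ae_eq_integral _ _ _ P setT (fun w => (expR (lam0 * Vc t w))%:E))//.
- by apply/measurable_EFinP; apply: measurableT_comp => //; exact: measurable_funM.
- by apply/measurable_EFinP; apply: measurableT_comp => //; exact: measurable_funM.
- by apply: filterS VcV => w VcVw _; rewrite VcVw.
Qed.

End cir.

(** * Moments of the price and of its drift *)

Section linear_response.
Context {R : realType} {d : measure_display} {T : measurableType d}.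
Variable P : probability T R.
Local Notation mu := (@lebesgue_measure R).
Local Notation sq_integrable X := (P.-integrable setT (EFin \o (fun w => X w ^+ 2))).

Lemma Rintegral_process_fubini (X : R -> T -> R) (t K : R) :
  (forall w, continuous (X ^~ w)) -> (forall s, measurable_fun setT (X s)) -> 0 <= t ->
  (forall s, 0 <= s <= t -> (\int[P]_w (`|X s w|)%:E <= K%:E)%E) ->
  P.-integrable setT (EFin \o (fun w => \int[mu]_(u in `[0, t]) X u w)) /\
  \int[P]_w \int[mu]_(u in `[0, t]) X u w = \int[mu]_(u in `[0, t]) \int[P]_w X u w /\
  \int[mu]_(u in `[0, t]) \int[P]_w X u w <= t * K.
Proof.
move=> cX mX t0 XK; have [iX iE XE] := process_fubini cX mX t0 XK.
have iXu u : 0 <= u <= t -> P.-integrable setT (EFin \o X u).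
  move=> ut; apply/integrableP; split; first exact/measurable_EFinP.
  by rewrite (le_lt_trans (XK _ ut))// ltry.
have fE : {in `[0, t]%classic, (fun u => \int[P]_w (X u w)%:E)%E =1
    EFin \o (fun u => \int[P]_w X u w)}.
  by move=> u; rewrite inE/= in_itv/= => ut /=; rewrite (EFin_Rintegral (iXu u ut)).
split => //; split.
  by rewrite {1}/Rintegral XE; congr fine; apply: eq_integral => u uA; exact: fE.
rewrite mulrC -(Rintegral_itv_cst K t0); apply: le_Rintegral => //.
- by apply: eq_integrable iE => // u uA; exact: fE.
- by apply: continuous_paths_integrable; exact: cst_continuous.
move=> u /=; rewrite in_itv/= => ut; rewrite -lee_fin -EFin_Rintegral; last exact: iXu.
apply: le_trans (XK _ ut); apply: (le_trans (lee_abs _)).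
by apply: le_abse_integral => //; exact/measurable_EFinP.
Qed.

Lemma measurable_primitive_itv0 (X : R -> T -> R) (u : R) :
  (forall w, continuous (X ^~ w)) -> (forall s, measurable_fun setT (X s)) ->
  measurable_fun setT (fun w => \int[mu]_(v in `[0, u]) X v w).
Proof.
move=> cX mX; have [u0|u0] := leP 0 u; first exact: measurable_Rintegral_process.
under eq_fun do rewrite set_itv_ge ?bnd_simp -?ltNge// Rintegral_set0.
exact: measurable_cst.
Qed.

Lemma sq_integrable_mul (X Y : T -> R) : measurable_fun setT X -> measurable_fun setT Y ->
  sq_integrable X -> sq_integrable Y ->
  P.-integrable setT (EFin \o (fun w => X w * Y w)) /\
  (\int[P]_w (`|X w * Y w|)%:E <= (\int[P]_w (X w ^+ 2) + \int[P]_w (Y w ^+ 2))%:E)%E.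
Proof.
move=> mX mY iX iY.
have [iS SE] := Rintegral_affine 1 1 0 iX iY.
have le w : `|X w * Y w| <= 1 * X w ^+ 2 + 1 * Y w ^+ 2 + 0.
  rewrite ler_norml; have := sqr_ge0 (X w + Y w); have := sqr_ge0 (X w - Y w).
  have := sqr_ge0 (X w); have := sqr_ge0 (Y w); rewrite sqrrB sqrrD.
  by move: (X w) (Y w) => x y; nra.
have mXY : measurable_fun setT (fun w => X w * Y w) by exact: measurable_funM.
split.
  apply: (le_integrable _ _ _ iS) => //; first exact/measurable_EFinP.
  by move=> w _ /=; rewrite lee_fin (le_trans (le w))// ler_norm.
have := SE; rewrite !mul1r addr0 => <-; rewrite -(EFin_Rintegral iS).
apply: ge0_le_integral => //.
- by apply/measurable_EFinP; exact: measurableT_comp.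
- by case/integrableP : iS.
- by move=> w _; rewrite lee_fin.
Qed.

Variables (M n : R -> T -> R) (k phi theta : R).
Let N t w := \int[mu]_(u in `[0, t]) n u w.
Hypotheses (k0 : 0 < k) (theta0 : 0 <= theta)
  (mM : forall u, measurable_fun setT (M u))
  (cn : forall w, continuous (n ^~ w)) (mn : forall u, measurable_fun setT (n u))
  (M0 : {ae P, forall w, M 0 w = 0})
  (M_mean : forall t, 0 <= t -> \int[P]_w M t w = 0)
  (M_increment : forall s t, 0 <= s -> s < t -> sq_integrable (fun w => M t w - M s w) /\
     \int[P]_w ((M t w - M s w) ^+ 2) = theta * (t - s))
  (nE : forall t, 0 <= t -> {ae P, forall w, n t w + k * N t w = phi * M t w}).

Let mean_cst (c : R) : \int[P]_w c = c.
Proof. by rewrite Rintegral_cst//= probability_setT/= mulr1. Qed.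

Let cN w : continuous ((N ^~ w) : R -> R).
Proof. exact: continuous_primitive_itv0. Qed.

Let mN u : measurable_fun setT (N u).
Proof. exact: measurable_primitive_itv0. Qed.

Let M_sqr t : 0 <= t -> sq_integrable (M t) /\ \int[P]_w (M t w ^+ 2) = theta * t.
Proof.
rewrite le_eqVlt => /predU1P[<-|t0].
  have ae0 : {ae P, forall w, cst 0 w = M 0 w ^+ 2}.
    by apply: filterS M0 => w ->; rewrite expr0n.
  split.
    apply: ae_eq_integrable ae0 _; first exact: measurable_funX.
    exact: finite_measure_integrable_cst.
  by rewrite -(ae_eq_Rintegral _ _ ae0) ?mean_cst ?mulr0//; exact: measurable_funX.
have [iM ME] := M_increment (lexx 0) t0.
have ae0 : {ae P, forall w, (M t w - M 0 w) ^+ 2 = M t w ^+ 2}.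
  by apply: filterS M0 => w ->; rewrite subr0.
split.
  by apply: ae_eq_integrable ae0 iM; exact: measurable_funX.
rewrite -(ae_eq_Rintegral _ _ ae0) ?ME ?subr0//.
- by apply: measurable_funX; exact: measurable_funB.
- exact: measurable_funX.
Qed.

(** Polarization, 2 M_u M_t = M_u^2 + M_t^2 - (M_t - M_u)^2: covariances follow from the variances
    of increments, without a martingale property. *)
Let M_cov u t : 0 <= u <= t -> \int[P]_w (M u w * M t w) = theta * u.
Proof.
case/andP => u0; rewrite le_eqVlt => /predU1P[<-|ut].
  by rewrite -(M_sqr u0).2; apply: eq_Rintegral => w _; rewrite expr2.
have t0 := le_trans u0 (ltW ut).
have [iMu uE] := M_sqr u0; have [iMt tE] := M_sqr t0.
have [iB BE] := M_increment u0 ut.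
have [i1 E1] := Rintegral_affine (1/2) (1/2) 0 iMu iMt.
have [_ E2] := Rintegral_affine 1 (- (1/2)) 0 i1 iB.
transitivity (1 * (1/2 * (theta * u) + 1/2 * (theta * t) + 0) + - (1/2) * (theta * (t - u)) + 0).
  rewrite -uE -tE -BE -E1 -E2; apply: eq_Rintegral => w _.
  by field.
by field.
Qed.

(** The derivative in u of exp(k u) N_u. Written with n and N it is continuous in u; for each fixed
    u it is almost surely phi exp(k u) M_u, which is enough once expectations are taken under the
    time integral. *)
Let Y u w := expR (k * u) * (n u w + k * N u w).

Let cY w : continuous (Y ^~ w).
Proof.
move=> u; apply: cvgM; first exact: continuous_expRM.
by apply: cvgD; [exact: cn|apply: cvgM; [exact: cvg_cst|exact: cN]].
Qed.

Let mY u : measurable_fun setT (Y u).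
Proof. by apply: measurable_funM => //; apply: measurable_funD => //; exact: measurable_funM. Qed.

Let YE u : 0 <= u -> {ae P, forall w, Y u w = expR (k * u) * phi * M u w}.
Proof. by move=> u0; apply: filterS (nE u0) => w nw; rewrite /Y nw mulrA. Qed.

Let NE t w : 0 < t -> \int[mu]_(u in `[0, t]) Y u w = expR (k * t) * N t w.
Proof. by move=> t0; apply: integrating_factor => //; exact: continuous_subspaceT. Qed.

(** Jensen in time for exp(k t) N_t = int Y, with E Y_u^2 <= exp(2 k t) phi^2 theta t; the
    exponentials cancel. This crude bound provides the integrability for Fubini, before the exact
    value is computed. *)
Let N_sqr t : 0 <= t -> sq_integrable (N t) /\
  \int[P]_w (N t w ^+ 2) <= t * (t * (phi ^+ 2 * theta * t)).
Proof.
rewrite le_eqVlt => /predU1P[<-|t0].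
  have N0 : N 0 = cst 0 by apply/funext => w; rewrite /N set_itv1 Rintegral_set1.
  rewrite N0 /=; under eq_Rintegral do rewrite expr0n/=.
  rewrite mean_cst mul0r; split => //.
  rewrite (_ : _ \o _ = cst 0%:E); first exact: finite_measure_integrable_cst.
  by apply/funext => w /=; rewrite expr0n.
pose K := expR (k * t) ^+ 2 * (phi ^+ 2 * theta * t).
have bY s : 0 <= s <= t -> (\int[P]_w (`|Y s w ^+ 2|)%:E <= K%:E)%E.
  move=> /andP[s0 st]; have [iM ME] := M_sqr s0.
  have iM' : P.-integrable setT (EFin \o (fun w => (expR (k * s) * phi) ^+ 2 * M s w ^+ 2)).
    exact: (integrableZl measurableT _ iM).
  rewrite (@ae_eq_integral _ _ _ P setT
      (EFin \o (fun w => (expR (k * s) * phi) ^+ 2 * M s w ^+ 2)))//.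
  - rewrite (EFin_Rintegral iM') RintegralZl// ME lee_fin /K exprMn.
    have e2 : expR (k * s) ^+ 2 <= expR (k * t) ^+ 2.
      by rewrite lerXn2r ?nnegrE ?expR_ge0// ler_expR ler_pM2l.
    have p2 : phi ^+ 2 * theta * s <= phi ^+ 2 * theta * t.
      by rewrite ler_wpM2l// mulr_ge0// sqr_ge0.
    have -> : expR (k * s) ^+ 2 * phi ^+ 2 * (theta * s) =
        expR (k * s) ^+ 2 * (phi ^+ 2 * theta * s) by rewrite !mulrA.
    by apply: ler_pM => //; exact: (mulr_ge0 (mulr_ge0 (sqr_ge0 phi) theta0) s0).
  - apply/measurable_EFinP; apply: measurableT_comp => //.
    exact: measurable_funX.
  - by case/integrableP : iM'.
  - apply: filterS (YE s0) => w /= -> _.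
    by rewrite ger0_norm ?sqr_ge0// !exprMn.
have cY2 w : continuous (fun u => Y u w ^+ 2).
  move=> u; apply: (@continuous_comp _ _ _ (Y ^~ w) (fun x => x ^+ 2)); first exact: cY.
  exact: exprn_continuous.
have mY2 u : measurable_fun setT (fun w => Y u w ^+ 2) by exact: measurable_funX.
have [iY2 [Y2E Y2K]] := Rintegral_process_fubini cY2 mY2 (ltW t0) bY.
rewrite -Y2E in Y2K.
pose c := t * (expR (k * t) ^+ 2)^-1.
have icY : P.-integrable setT (EFin \o (fun w => c * \int[mu]_(u in `[0, t]) (Y u w ^+ 2))).
  exact: (integrableZl measurableT _ iY2).
have le w : N t w ^+ 2 <= c * \int[mu]_(u in `[0, t]) (Y u w ^+ 2).
  rewrite /c mulrAC ler_pdivlMr ?exprn_gt0 ?expR_gt0// mulrC -exprMn -NE//.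
  exact: Rintegral_sqr_le.
have iN : sq_integrable (N t).
  apply: (le_integrable _ _ _ icY) => //.
    by apply/measurable_EFinP; exact: measurable_funX.
  by move=> w _ /=; rewrite lee_fin ger0_norm ?sqr_ge0// (le_trans (le w))// ler_norm.
split => //.
apply: (@le_trans _ _ (c * (t * K))).
  apply: (@le_trans _ _ (\int[P]_w (c * \int[mu]_(u in `[0, t]) (Y u w ^+ 2)))).
    by apply: le_Rintegral => // w _; exact: le.
  rewrite RintegralZl// ler_wpM2l// mulr_ge0 ?invr_ge0 ?sqr_ge0//; exact: ltW.
by rewrite /c /K -mulrA; set e := expR _ ^+ 2; rewrite [e^-1 * _](_ : _ = t * (phi ^+ 2 * theta * t))// mulrCA mulKf// expf_eq0/= gt_eqF// expR_gt0.
Qed.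

(** Multiplying exp(k t) N_t = int Y by Z and exchanging the integrals expresses E [N_t Z] through
    the correlations E [M_u Z]. Z = 1 gives the mean of N_t, Z = M_t its covariance with M_t. *)
Lemma linear_response (Z : T -> R) (h : R -> R) (t : R) : 0 < t -> continuous h ->
  measurable_fun setT Z -> sq_integrable Z ->
  (forall u, 0 <= u <= t -> \int[P]_w (M u w * Z w) = h u) ->
  expR (k * t) * \int[P]_w (N t w * Z w) = phi * \int[mu]_(u in `[0, t]) (expR (k * u) * h u).
Proof.
move=> t0 ch mZ iZ hE; pose X u w := Y u w * Z w.
have cX w : continuous (X ^~ w).
  by move=> u; apply: cvgM; [exact: cY|exact: cvg_cst].
have mX u : measurable_fun setT (X u) by exact: measurable_funM.
have XE u : 0 <= u -> {ae P, forall w, X u w = expR (k * u) * phi * (M u w * Z w)}.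
  by move=> u0; apply: filterS (YE u0) => w Yw; rewrite /X Yw mulrA.
have iMZ u : 0 <= u -> _ := fun u0 => sq_integrable_mul (mM u) mZ (M_sqr u0).1 iZ.
have mMZ u : measurable_fun setT (fun w => M u w * Z w) by exact: measurable_funM.
pose K := expR (k * t) * `|phi| * (theta * t + \int[P]_w (Z w ^+ 2)).
have XK u : 0 <= u <= t -> (\int[P]_w (`|X u w|)%:E <= K%:E)%E.
  move=> /andP[u0 ut].
  have mA : measurable_fun setT (fun w => `|M u w * Z w|) by exact: measurableT_comp.
  rewrite (@ae_eq_integral _ _ _ P setT
    (fun w => (expR (k * u) * `|phi| * `|M u w * Z w|)%:E))//.
  - rewrite integral_ge0_scale// ?mulr_ge0 ?expR_ge0//.
    have c1 : 0 <= expR (k * u) * `|phi| by rewrite mulr_ge0 ?expR_ge0.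
    apply: le_trans (lee_wpmul2l _ (iMZ u u0).2) _; rewrite ?lee_fin//.
    rewrite (M_sqr u0).2 /K ler_pM//.
    + rewrite addr_ge0 ?mulr_ge0//; apply: Rintegral_ge0 => w _; exact: sqr_ge0.
    + by rewrite ler_wpM2r// ler_expR ler_pM2l.
    + by rewrite lerD2r ler_wpM2l.
  - by apply/measurable_EFinP; exact: measurableT_comp.
  - by apply/measurable_EFinP; exact: measurable_funM.
  - by apply: filterS (XE u u0) => w -> _; rewrite !normrM ger0_norm ?expR_ge0.
have [_ [+ _]] := Rintegral_process_fubini cX mX (ltW t0) XK.
rewrite (@eq_Rintegral _ _ _ P _ (fun w => expR (k * t) * (N t w * Z w))); last first.
  move=> w _; rewrite mulrA -NE// -RintegralZr//.
  by apply: continuous_paths_integrable; exact: cY.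
rewrite RintegralZl//; last exact: (sq_integrable_mul (mN t) mZ (N_sqr (ltW t0)).1 iZ).1.
move=> ->; rewrite (@eq_Rintegral _ _ _ mu _ (fun u => phi * (expR (k * u) * h u))).
  rewrite RintegralZl//; apply: continuous_paths_integrable => u.
  by apply: cvgM; [exact: continuous_expRM|exact: ch].
move=> u; rewrite inE/= in_itv/= => /andP[u0 ut].
rewrite (ae_eq_Rintegral (mX u) _ (XE u u0)); last exact: measurable_funM.
rewrite RintegralZl// ?hE ?u0//; last exact: (iMZ u u0).1.
ring.
Qed.

(** The value of E [N_t M_t], namely phi theta exp(- k t) int_0^t u exp(k u) du. *)
Let c t := phi * theta * (t / k - 1 / k ^+ 2 + expR (- k * t) / k ^+ 2).

Let kn0 : k != 0. Proof. by rewrite gt_eqF. Qed.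

Let expRNk t : expR (- k * t) = (expR (k * t))^-1.
Proof. by rewrite mulNr expRN. Qed.

Let i1 : sq_integrable (cst (1 : R)).
Proof.
rewrite (_ : EFin \o _ = cst 1%:E); first exact: finite_measure_integrable_cst.
by apply/funext => w /=; rewrite expr1n.
Qed.

Let N_mean t : 0 <= t -> \int[P]_w N t w = 0.
Proof.
rewrite le_eqVlt => /predU1P[<-|t0].
  by rewrite /N; under eq_Rintegral do rewrite set_itv1 Rintegral_set1; exact: mean_cst.
have h0 u : 0 <= u <= t -> \int[P]_w (M u w * cst 1 w) = (cst 0 : R -> R) u.
  by move=> /andP[u0 _]; under eq_Rintegral do rewrite /= mulr1; exact: M_mean.
have := linear_response t0 (@cst_continuous _ _ (0 : R)) (measurable_cst (1 : R)) i1 h0.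
rewrite [X in _ = _ * X](@eq_Rintegral _ _ _ mu _ (cst 0)); last first.
  by move=> u _; rewrite /= mulr0.
rewrite Rintegral_itv_cst ?(ltW t0)// mul0r mulr0 => /eqP.
rewrite mulf_eq0 gt_eqF ?expR_gt0//= => /eqP <-.
by apply: eq_Rintegral => w _; rewrite /= mulr1.
Qed.

Let N0 w : N 0 w = 0. Proof. by rewrite /N set_itv1 Rintegral_set1. Qed.

Let NM_mean t : 0 <= t -> \int[P]_w (N t w * M t w) = c t.
Proof.
rewrite le_eqVlt => /predU1P[<-|t0].
  under eq_Rintegral do rewrite N0 mul0r.
  by rewrite mean_cst /c !mulr0 expR0 mul0r; field.
have ch : continuous (fun u => theta * u) by move=> u; apply: cvgM; [exact: cvg_cst|exact: cvg_id].
have := linear_response t0 ch (mM t) (M_sqr (ltW t0)).1 (fun u => @M_cov u t).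
pose G u := theta * (expR (k * u) * (u / k - 1 / k ^+ 2)).
have dG (u : R) : is_derive u (1 : R) G (expR (k * u) * (theta * u)).
  by rewrite /G; apply: is_derive_eq; rewrite /GRing.scale/=; field.
have cf : continuous (fun u => expR (k * u) * (theta * u)).
  by move=> u; apply: cvgM; [exact: continuous_expRM|exact: ch].
rewrite {2}/Rintegral (integral_FTC2 (ltW t0) cf dG)/= /G mulr0 expR0 => h.
have e0 : expR (k * t) != 0 by rewrite gt_eqF// expR_gt0.
apply: (mulfI e0); rewrite h /c expRNk; field.
by rewrite e0 kn0.
Qed.

(** Expectation of [integrating_factor_sqr]: exp(2 k t) E N_t^2 is the integral over [0, t] of 2 phi
    exp(2 k u) c(u). *)
Let N_sqr_mean t : 0 <= t -> \int[P]_w (N t w ^+ 2) =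
  phi ^+ 2 * theta * (- expR (- 2 * k * t) + 4 * expR (- k * t) - 3 + 2 * k * t) / (2 * k ^+ 3).
Proof.
rewrite le_eqVlt => /predU1P[<-|t0].
  under eq_Rintegral do rewrite N0 expr0n/=.
  by rewrite mean_cst !mulr0 expR0; field.
pose X u w := 2 * expR (2 * k * u) * N u w * (n u w + k * N u w).
have cX w : continuous (X ^~ w).
  move=> u; apply: cvgM.
    by apply: cvgM; [apply: cvgM; [exact: cvg_cst|exact: continuous_expRM]|exact: cN].
  by apply: cvgD; [exact: cn|apply: cvgM; [exact: cvg_cst|exact: cN]].
have mX u : measurable_fun setT (X u).
  apply: measurable_funM; first exact: measurable_funM.
  by apply: measurable_funD => //; exact: measurable_funM.
have XE u : 0 <= u -> {ae P, forall w, X u w = 2 * expR (2 * k * u) * phi * (N u w * M u w)}.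
  by move=> u0; apply: filterS (nE u0) => w nw; rewrite /X nw; ring.
have iNM u : 0 <= u -> _ := fun u0 => sq_integrable_mul (mN u) (mM u) (N_sqr u0).1 (M_sqr u0).1.
have mNM u : measurable_fun setT (fun w => N u w * M u w) by exact: measurable_funM.
pose K := 2 * expR (2 * k * t) * `|phi| * (t * (t * (phi ^+ 2 * theta * t)) + theta * t).
have XK u : 0 <= u <= t -> (\int[P]_w (`|X u w|)%:E <= K%:E)%E.
  move=> /andP[u0 ut].
  have mA : measurable_fun setT (fun w => `|N u w * M u w|) by exact: measurableT_comp.
  rewrite (@ae_eq_integral _ _ _ P setT
    (fun w => (2 * expR (2 * k * u) * `|phi| * `|N u w * M u w|)%:E))//.
  - rewrite integral_ge0_scale// ?mulr_ge0 ?expR_ge0//.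
    have c1 : 0 <= 2 * expR (2 * k * u) * `|phi| by rewrite !mulr_ge0 ?expR_ge0.
    apply: le_trans (lee_wpmul2l _ (iNM u u0).2) _; rewrite ?lee_fin//.
    have pt : 0 <= phi ^+ 2 * theta by rewrite mulr_ge0// sqr_ge0.
    rewrite (M_sqr u0).2 /K ler_pM//.
    + rewrite addr_ge0 ?mulr_ge0//; apply: Rintegral_ge0 => w _; exact: sqr_ge0.
    + by rewrite ler_wpM2r// ler_pM2l// ler_expR ler_pM2l// mulr_gt0.
    + apply: lerD; last exact: ler_wpM2l.
      apply: le_trans (N_sqr u0).2 _.
      have h1 : phi ^+ 2 * theta * u <= phi ^+ 2 * theta * t by rewrite ler_wpM2l.
      have h2 := ler_pM u0 (mulr_ge0 pt u0) ut h1.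
      exact: ler_pM u0 (mulr_ge0 u0 (mulr_ge0 pt u0)) ut h2.
  - by apply/measurable_EFinP; exact: measurableT_comp.
  - by apply/measurable_EFinP; exact: measurable_funM.
  - apply: filterS (XE u u0) => w -> _; rewrite !normrM (ger0_norm (expR_ge0 _)).
    by rewrite ger0_norm.
have [_ [+ _]] := Rintegral_process_fubini cX mX (ltW t0) XK.
rewrite (@eq_Rintegral _ _ _ P _ (fun w => expR (2 * k * t) * N t w ^+ 2)); last first.
  move=> w _; rewrite /X integrating_factor_sqr//; exact: continuous_subspaceT.
rewrite RintegralZl//; last exact: (N_sqr (ltW t0)).1.
pose f u := 2 * expR (2 * k * u) * phi * c u.
rewrite (@eq_Rintegral _ _ _ mu _ f); last first.
  move=> u; rewrite inE/= in_itv/= => /andP[u0 ut].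
  rewrite (ae_eq_Rintegral (mX u) _ (XE u u0)); last exact: measurable_funM.
  by rewrite RintegralZl// ?NM_mean//; exact: (iNM u u0).1.
(* A primitive of the form of [f] given in [fE], by parts: 3 / (4 k^3) is 1 / (2 k^3), from the
   constant - 1 / k^2, plus 1 / (4 k^3), from the linear term. *)
pose G u := 2 * phi ^+ 2 * theta * (expR (2 * k * u) * (u / (2 * k ^+ 2) - 3 / (4 * k ^+ 3))
  + expR (k * u) / k ^+ 3).
have fE u : f u = 2 * phi ^+ 2 * theta * (expR (2 * k * u) * (u / k - 1 / k ^+ 2)
    + expR (k * u) / k ^+ 2).
  have e0 : expR (k * u) != 0 by rewrite gt_eqF// expR_gt0.
  have e2 : expR (2 * k * u) = expR (k * u) * expR (k * u).
    by rewrite -expRD; congr expR; ring.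
  rewrite /f /c e2 expRNk; field.
  by rewrite e0 kn0.
have dG (u : R) : is_derive u (1 : R) G (f u).
  by rewrite fE /G; apply: is_derive_eq; rewrite /GRing.scale/=; field.
have cf : continuous f.
  rewrite (funext fE) => u; apply: cvgM; first exact: cvg_cst.
  apply: cvgD; last by apply: cvgM; [exact: continuous_expRM|exact: cvg_cst].
  apply: cvgM; first exact: continuous_expRM.
  apply: cvgB; last exact: cvg_cst.
  by apply: cvgM; [exact: cvg_id|exact: cvg_cst].
rewrite {2}/Rintegral (integral_FTC2 (ltW t0) cf dG)/= /G !mulr0 expR0 => h.
have e0 : expR (k * t) != 0 by rewrite gt_eqF// expR_gt0.
have e2 : expR (2 * k * t) = expR (k * t) * expR (k * t).
  by rewrite -expRD; congr expR; ring.
have eN2 : expR (- 2 * k * t) = (expR (k * t) * expR (k * t))^-1.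
  by rewrite -e2 !mulNr expRN.
have e20 : expR (2 * k * t) != 0 by rewrite gt_eqF// expR_gt0.
apply: (mulfI e20); rewrite h e2 eN2 expRNk; field.
by rewrite e0 kn0.
Qed.

(** M + N is S - S_0. The three terms of its second moment come in order from N^2, from the cross
    term 2 N M and from M^2. *)
Lemma linear_response_moments t : 0 <= t ->
  [/\ P.-integrable setT (EFin \o (fun w => M t w + N t w)),
   sq_integrable (fun w => M t w + N t w),
   \int[P]_w (M t w + N t w) = 0 &
   \int[P]_w ((M t w + N t w) ^+ 2) =
     phi ^+ 2 * theta * (- expR (- 2 * k * t) + 4 * expR (- k * t) - 3 + 2 * k * t)
       / (2 * k ^+ 3) +
     2 * phi * theta * (k * t - 1 + expR (- k * t)) / k ^+ 2 + theta * t].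
Proof.
move=> t0.
have iX (X : T -> R) : measurable_fun setT X -> sq_integrable X -> P.-integrable setT (EFin \o X).
  move=> mX isX; have [+ _] := sq_integrable_mul mX (measurable_cst (1 : R)) isX i1.
  by rewrite (_ : (fun w => X w * cst 1 w) = X)//; apply/funext => w; rewrite mulr1.
have [iM2 M2] := M_sqr t0; have [iN2 _] := N_sqr t0; have N2 := N_sqr_mean t0.
have [iS SE] := Rintegral_affine 1 1 0 (iX _ (mM t) iM2) (iX _ (mN t) iN2).
have [i3 E3] := Rintegral_affine 1 1 0 iM2 iN2.
have [i4 E4] := Rintegral_affine 1 2 0 i3 (sq_integrable_mul (mN t) (mM t) iN2 iM2).1.
have E w : 1 * M t w + 1 * N t w + 0 = M t w + N t w by ring.
have E' w : 1 * (1 * M t w ^+ 2 + 1 * N t w ^+ 2 + 0) + 2 * (N t w * M t w) + 0 =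
  (M t w + N t w) ^+ 2 by ring.
rewrite (funext E) in iS SE; rewrite (funext E') in i4 E4; split => //.
  by rewrite SE M_mean// N_mean//; ring.
rewrite E4 E3 M2 N2 NM_mean// /c; field.
exact: kn0.
Qed.

End linear_response.

(** * Variance of the return *)

Section variance_ae.
Context {R : realType} {d : measure_display} {T : measurableType d}.
Variable P : probability T R.

Lemma variance_ae_scale (X Y : T -> R) (a : R) : measurable_fun setT X ->
  measurable_fun setT Y -> {ae P, forall w, X w = a * Y w} ->
  P.-integrable setT (EFin \o Y) -> \int[P]_w Y w = 0 ->
  P.-integrable setT (EFin \o (fun w => Y w ^+ 2)) ->
  'V_P[X]%E = (a ^+ 2 * \int[P]_w (Y w ^+ 2))%:E.
Proof.
move=> mX mY XY iY Y0 iY2.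
have iaY : P.-integrable setT (EFin \o (fun w => a * Y w)).
  exact: (integrableZl measurableT _ iY).
have EX : ('E_P[X] = 0)%E.
  rewrite unlock (@ae_eq_integral _ _ _ P setT (EFin \o (fun w => a * Y w)))//.
  - by rewrite (EFin_Rintegral iaY) RintegralZl// Y0 mulr0.
  - exact/measurable_EFinP.
  - by case/integrableP : iaY.
  - by apply: filterS XY => w /= ->.
have iaY2 : P.-integrable setT (EFin \o (fun w => a ^+ 2 * Y w ^+ 2)).
  exact: (integrableZl measurableT _ iY2).
rewrite /variance unlock EX/= unlock.
rewrite (@ae_eq_integral _ _ _ P setT (EFin \o (fun w => a ^+ 2 * Y w ^+ 2)))//.
- by rewrite (EFin_Rintegral iaY2) RintegralZl.
- by apply/measurable_EFinP; apply: measurable_funM; exact: measurable_funB.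
- by case/integrableP : iaY2.
- by apply: filterS XY => w XYw _; rewrite !fctE/= XYw subr0 -exprMn expr2.
Qed.

End variance_ae.

Section square_root_volatility.
Context {R : realType} {d : measure_display} {T : measurableType d}.
Variable P : probability T R.
Local Notation mu := (@lebesgue_measure R).
Variables (F : R -> set_system T) (Ws Wv S n V Sc nc Vc : R -> T -> R).
Variables (kappa1 kappa2 theta gamma phi S0 : R).
Hypotheses (hF : filtration F) (hWs : brownian_motion P F Ws) (hWv : brownian_motion P F Wv)
  (k1 : 0 < kappa1) (k2 : 0 < kappa2) (theta0 : 0 < theta)
  (dS : ito_process P F Ws S n (fun t w => Num.sqrt (V t w)))
  (dn : ito_process P F Ws n (fun t w => - kappa1 * n t w) (fun t w => phi * Num.sqrt (V t w)))
  (dV : ito_process P F Wv V (fun t w => kappa2 * (theta - V t w))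
    (fun t w => gamma * Num.sqrt (V t w)))
  (V_ge0 : {ae P, forall w, forall t : R, 0 <= t -> 0 <= V t w})
  (initS : {ae P, forall w, S 0 w = S0}) (initn : {ae P, forall w, n 0 w = 0})
  (initV : {ae P, forall w, V 0 w = theta})
  (mS : forall u, measurable_fun setT (Sc u))
  (ScS : {ae P, forall w, forall u, 0 <= u -> Sc u w = S u w})
  (cn : forall w, continuous (nc ^~ w)) (mn : forall u, measurable_fun setT (nc u))
  (ncn : {ae P, forall w, forall u, 0 <= u -> nc u w = n u w})
  (cV : forall w, continuous (Vc ^~ w)) (mV : forall u, measurable_fun setT (Vc u))
  (VcV : {ae P, forall w, forall u, 0 <= u -> Vc u w = V u w}).

Let N t w := \int[mu]_(u in `[0, t]) nc u w.
(** Defined pathwise from S and the time integral of n, hence measurable and given at every time at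
    once; that its increments are Ito integrals of sqrt(V) holds almost surely for each pair of
    times, by [M_ito]. *)
Let M t w := Sc t w - S0 - N t w.
Let H u w := Num.sqrt (V u w).
Let Hc u w := Num.sqrt (Vc u w).

Let aH : adapted F H := ito_diffusion_adapted dS.

Let cHc w : continuous (Hc ^~ w).
Proof.
move=> u; apply: (@continuous_comp _ _ _ (Vc ^~ w) Num.sqrt); first exact: cV.
exact: sqrt_continuous.
Qed.

Let mHc u : measurable_fun setT (Hc u).
Proof.
apply: measurableT_comp => //.
by apply: continuous_measurable_fun; exact: sqrt_continuous.
Qed.

Let HcH : {ae P, forall w, forall u, 0 <= u -> Hc u w = H u w}.
Proof. by apply: filterS VcV => w VcVw u u0; rewrite /Hc VcVw. Qed.

Let mN u : measurable_fun setT (N u).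
Proof. exact: measurable_primitive_itv0. Qed.

Let mM u : measurable_fun setT (M u).
Proof. by apply: measurable_funB => //; exact: measurable_funB. Qed.

Let N_drift : {ae P, forall w, forall t, \int[mu]_(u in `[0, t]) n u w = N t w}.
Proof.
apply: filterS ncn => w ncw t; apply: eq_Rintegral => u.
by rewrite inE/= in_itv/= => /andP[u0 _]; rewrite ncw.
Qed.

Let M_ito s t : 0 <= s -> s <= t -> exists It Is,
  [/\ ito_integral P F Ws H t It, ito_integral P F Ws H s Is &
   {ae P, forall w, M t w - M s w = It w - Is w}].
Proof.
move=> s0 st; have [It [Is [hIt hIs ae1]]] := ito_process_increment dS s0 st.
exists It, Is; split => //.
apply: filterS3 N_drift ScS ae1 => w Nw Scw <-.
rewrite !Nw /M !Scw ?(le_trans s0)//; ring.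
Qed.

Let M0 : {ae P, forall w, M 0 w = 0}.
Proof.
apply: filterS2 ScS initS => w Scw Sw.
by rewrite /M Scw// Sw /N set_itv1 Rintegral_set1; ring.
Qed.

Let H_sqr u : 0 <= u -> (\int[P]_w (H u w ^+ 2)%:E = theta%:E)%E.
Proof.
move=> u0; rewrite -(cir_mean hF hWv k2 theta0 dV V_ge0 initV cV mV VcV u0).
have mHu : measurable_fun setT (H u) by apply: (filtration_measurable hF u0); exact: aH.
apply: ae_eq_integral => //.
- by apply/measurable_EFinP; exact: measurable_funX.
- by apply/measurable_EFinP; apply: (filtration_measurable hF u0); exact: (ito_adapted dV).
- by apply: filterS V_ge0 => w Vw _; rewrite /H sqr_sqrtr// Vw.
Qed.

Let H_expR : exists2 lam, 0 < lam & forall t u, 0 <= u <= t ->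
  (\int[P]_w (expR (lam * H u w ^+ 2))%:E <= (expR (lam * theta * (1 + kappa2 * t)))%:E)%E.
Proof.
have [lam lam0 hlam] := cir_expR_moment hF hWv k2 dV V_ge0 initV cV mV VcV.
exists lam => // t u /andP[u0 ut].
have mHu : measurable_fun setT (H u) by apply: (filtration_measurable hF u0); exact: aH.
have mVu : measurable_fun setT (V u).
  by apply: (filtration_measurable hF u0); exact: (ito_adapted dV).
rewrite (@ae_eq_integral _ _ _ P setT (fun w => (expR (lam * V u w))%:E))//.
- apply: le_trans (hlam _ u0) _; rewrite lee_fin ler_expR ler_wpM2l//.
    by rewrite mulr_ge0// ?(ltW lam0)// (ltW theta0).
  by rewrite lerD2l ler_pM2l.
- apply/measurable_EFinP; apply: measurableT_comp => //; apply: measurable_funM => //.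
  exact: measurable_funX.
- by apply/measurable_EFinP; apply: measurableT_comp => //; exact: measurable_funM.
- by apply: filterS V_ge0 => w Vw _; rewrite /H sqr_sqrtr// Vw.
Qed.

Let M_increment s t : 0 <= s -> s < t ->
  P.-integrable setT (EFin \o (fun w => (M t w - M s w) ^+ 2)) /\
  \int[P]_w ((M t w - M s w) ^+ 2) = theta * (t - s).
Proof.
move=> s0 st; have [It [Is [hIt hIs ae1]]] := M_ito s0 (ltW st).
have [lam lam0 hlam] := H_expR.
have H2 u : s <= u <= t -> (\int[P]_w (H u w ^+ 2)%:E = theta%:E)%E.
  by move=> /andP[su _]; apply: H_sqr; exact: le_trans su.
have HE u : s <= u <= t -> (\int[P]_w (expR (lam * H u w ^+ 2))%:E <=
    (expR (lam * theta * (1 + kappa2 * t)))%:E)%E.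
  by move=> /andP[su ut]; apply: hlam; rewrite (le_trans s0).
have [iM ME] := ito_isometry hF hWs aH cHc mHc HcH s0 st hIt hIs
  (measurable_funB (mM t) (mM s)) ae1 lam0 H2 HE.
by split => //; rewrite /Rintegral ME.
Qed.

Let M_mean t : 0 <= t -> \int[P]_w M t w = 0.
Proof.
rewrite le_eqVlt => /predU1P[<-|t0].
  rewrite (ae_eq_Rintegral (mM 0) (measurable_cst (0 : R)) M0).
  by rewrite Rintegral_cst//= mul0r.
have [It [Is [hIt hIs ae1]]] := M_ito (lexx 0) (ltW t0).
have mB := measurable_funB (mM t) (mM 0).
have ae0 : {ae P, forall w, M t w - M 0 w = M t w} by apply: filterS M0 => w ->; rewrite subr0.
rewrite -(ae_eq_Rintegral mB (mM t) ae0).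
apply: (ito_mean0 hF hWs aH cHc mHc HcH (lexx 0) t0 hIt hIs mB ae1).
  have i1 : P.-integrable setT (EFin \o (fun w => cst (1 : R) w ^+ 2)).
    rewrite (_ : EFin \o _ = cst 1%:E); first exact: finite_measure_integrable_cst.
    by apply/funext => w /=; rewrite expr1n.
  have [+ _] := sq_integrable_mul mB (measurable_cst (1 : R)) (M_increment (lexx 0) t0).1 i1.
  by congr (P.-integrable setT _); apply/funext => w /=; rewrite mulr1.
have cH2 w : continuous (fun u => Hc u w ^+ 2).
  move=> u; apply: (@continuous_comp _ _ _ (Hc ^~ w) (fun x => x ^+ 2)); first exact: cHc.
  exact: exprn_continuous.
have mH2 u : measurable_fun setT (fun w => Hc u w ^+ 2) by exact: measurable_funX.
apply: (Rintegral_process_fubini cH2 mH2 (ltW t0) (K := theta) _).1 => u /andP[u0 _].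
rewrite -(H_sqr u0); have mHu : measurable_fun setT (H u).
  by apply: (filtration_measurable hF u0); exact: aH.
rewrite (@ae_eq_integral _ _ _ P setT (fun w => (H u w ^+ 2)%:E))//.
- by apply/measurable_EFinP; exact: measurableT_comp.
- by apply/measurable_EFinP; exact: measurable_funX.
- by apply: filterS HcH => w Hw _; rewrite Hw// ger0_norm// sqr_ge0.
Qed.

(** The equations for S and n provide integrals of sqrt(V) and phi sqrt(V) with unrelated
    approximations. The grid sums of the second are phi times those of the first, so both sides are
    limits in probability of one sequence. *)
Let n_response t : 0 <= t -> {ae P, forall w, nc t w + kappa1 * N t w = phi * M t w}.
Proof.
rewrite le_eqVlt => /predU1P[<-|t0].
  apply: filterS3 ncn initn M0 => w ncw nw ->.
  by rewrite ncw// nw /N set_itv1 Rintegral_set1; ring.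
have [It [Is [hIt hIs aeM]]] := M_ito (lexx 0) (ltW t0).
have [Jt [Js [hJt hJs aen]]] := ito_process_increment dn (lexx 0) (ltW t0).
have mB := measurable_funB (mM t) (mM 0).
have mphiB : measurable_fun setT (fun w => phi * (M t w - M 0 w)) by exact: measurable_funM.
have mY : measurable_fun setT (fun w => nc t w + kappa1 * N t w).
  by apply: measurable_funD => //; exact: measurable_funM.
have aeY : {ae P, forall w, nc t w + kappa1 * N t w = Jt w - Js w}.
  apply: filterS3 ncn initn aen => w ncw nw <-.
  rewrite ncw ?ltW// nw set_itv1 Rintegral_set1 !subr0.
  rewrite (@eq_Rintegral _ _ _ mu _ (fun u => - kappa1 * nc u w)); last first.
    by move=> u; rewrite inE/= in_itv/= => /andP[u0 _]; rewrite ncw.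
  by rewrite RintegralZl ?mulNr ?opprK//; exact: continuous_paths_integrable.
have XM := cvg0_in_probability_scale phi
  (ito_grid_approx hF hWs aH cHc mHc HcH (lexx 0) t0 hIt hIs aeM).
have cphiH w : continuous (fun u => phi * Hc u w).
  by move=> u; apply: cvgM; [exact: cvg_cst|exact: cHc].
have mphiH u : measurable_fun setT (fun w => phi * Hc u w) by exact: measurable_funM.
have phiHcH : {ae P, forall w, forall u, 0 <= u -> phi * Hc u w = phi * H u w}.
  by apply: filterS HcH => w Hw u u0; rewrite Hw.
have XY := ito_grid_approx hF hWs (ito_diffusion_adapted dn) cphiH mphiH phiHcH
  (lexx 0) t0 hJt hJs aeY.
have gE m w : block_sum Ws (grid_blocks (fun u w => phi * H u w) 0 t m) w =
    phi * block_sum Ws (grid_blocks H 0 t m) w.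
  by rewrite !grid_blocks_sum /step_sum mulr_sumr; apply: eq_bigr => i _; rewrite mulrA.
have XY' : cvg0_in_probability P (fun m w =>
    (`|phi * block_sum Ws (grid_blocks H 0 t m) w - (nc t w + kappa1 * N t w)|)%:E).
  by move: XY; under eq_fun do under eq_fun do rewrite gE.
have XM' : cvg0_in_probability P (fun m w =>
    (`|phi * block_sum Ws (grid_blocks H 0 t m) w - phi * (M t w - M 0 w)|)%:E).
  by move: XM; under eq_fun do under eq_fun do rewrite mulrBr.
apply: filterS2 M0 (cvg_in_probability_unique mY mphiB XY' XM') => w Mw ->.
by rewrite Mw subr0.
Qed.

Lemma return_variance t : 0 <= t ->
  'V_P[(fun w : T => (S t w - S0) / S0)%R]%E =
    (1 / S0 ^+ 2 *
      (phi ^+ 2 * theta *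
         (- expR (- 2 * kappa1 * t) + 4 * expR (- kappa1 * t) - 3
          + 2 * kappa1 * t) / (2 * kappa1 ^+ 3)
       + 2 * phi * theta * (kappa1 * t - 1 + expR (- kappa1 * t))
         / kappa1 ^+ 2
       + theta * t))%:E.
Proof.
move=> t0.
have [iMN iMN2 MN0 <-] := linear_response_moments k1 (ltW theta0) mM cn mn M0 M_mean
  M_increment n_response t0.
rewrite (@variance_ae_scale _ _ _ P _ (fun w => M t w + N t w) S0^-1)//.
- by rewrite exprVn div1r.
- have mSt : measurable_fun setT (S t).
    by apply: (filtration_measurable hF t0); exact: (ito_adapted dS).
  by apply: measurable_funM => //; exact: measurable_funB.
- exact: measurable_funD.
- by apply: filterS ScS => w Scw; rewrite /M Scw// subrK mulrC.
Qed.

End square_root_volatility.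

Theorem proposition4 (R : realType) (d : measure_display) (T : measurableType d)
    (P : probability T R) (F : R -> set_system T) (Ws Wv S_ n_ V_ : R -> T -> R)
    (rho kappa1 kappa2 theta gamma phi S0 : R)
    (hF : filtration F)
    (hWs : brownian_motion P F Ws) (hWv : brownian_motion P F Wv)
    (hrho : -1 <= rho <= 1)
    (hcov : quadratic_covariation P Ws Wv (fun t _ => rho * t))
    (hkappa1 : 0 < kappa1) (hkappa2 : 0 < kappa2) (htheta : 0 < theta)
    (hgamma : 0 <= gamma) (hS0 : 0 < S0)
    (dS : ito_process P F Ws S_ n_ (fun t w => Num.sqrt (V_ t w)))
    (dn : ito_process P F Ws n_ (fun t w => - kappa1 * n_ t w)
            (fun t w => phi * Num.sqrt (V_ t w)))
    (dV : ito_process P F Wv V_ (fun t w => kappa2 * (theta - V_ t w))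
            (fun t w => gamma * Num.sqrt (V_ t w)))
    (V_ge0 : {ae P, forall w, forall t : R, 0 <= t -> 0 <= V_ t w})
    (initS : {ae P, forall w, S_ 0 w = S0})
    (initn : {ae P, forall w, n_ 0 w = 0})
    (initV : {ae P, forall w, V_ 0 w = theta}) :
  forall t : R, 0 <= t ->
    'V_P[(fun w : T => (S_ t w - S0) / S0)%R]%E =
    (1 / S0 ^+ 2 *
      (phi ^+ 2 * theta *
         (- expR (- 2 * kappa1 * t) + 4 * expR (- kappa1 * t) - 3
          + 2 * kappa1 * t) / (2 * kappa1 ^+ 3)
       + 2 * phi * theta * (kappa1 * t - 1 + expR (- kappa1 * t))
         / kappa1 ^+ 2
       + theta * t))%:E.
Proof.
have modification W X b H : ito_process P F W X b H -> exists Y : R -> T -> R,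
    [/\ forall w, continuous (Y ^~ w), forall s, measurable_fun setT (Y s) &
     {ae P, forall w, forall s, 0 <= s -> Y s w = X s w}].
  move=> dX; apply: continuous_modification (ito_continuous dX) => s s0.
  by apply: (filtration_measurable hF s0); exact: (ito_adapted dX).
have [Sc [_ mS ScS]] := modification _ _ _ _ dS.
have [nc [cn mn ncn]] := modification _ _ _ _ dn.
have [Vc [cV mV VcV]] := modification _ _ _ _ dV.
move=> t; exact: (return_variance hF hWs hWv hkappa1 hkappa2 htheta dS dn dV V_ge0
  initS initn initV mS ScS cn mn ncn cV mV VcV).
Qed.
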